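(* Let $(\gamma,c)$ be a colored trivalent graph of genus $g\ge3$. The toric variety $X_{P_{\gamma,c},M_\gamma}$ has terminal singularities if and only if $\gamma$ has no separating edges.
   Context: A trivalent graph $\gamma=(V,E)$ is a finite connected undirected graph with all vertices of valency 3 (loops and multiple edges allowed, no half-edges); its genus $g$ is its first Betti number, so $\#V=2g-2$, $\#E=3g-3$. An edge is separating if removing it disconnects the graph. A coloring is a function $c\colon V\to\mathbb{F}_2$. Let $\widetilde N_\gamma=\mathbb{Z}^E$ with basis $x_e$. Let $N_\gamma\subset\widetilde N_\gamma$ be the sublattice generated by all vectors $\pm x_i\pm x_j\pm x_k$, for $v\in V$ with adjacent edges $e_i,e_j,e_k$ (a loop is counted twice), and $M_\gamma=N_\gamma^\vee$. Let $P^\circ_{\gamma,c}\subset\mathbb{R}^E$ be the convex hull of all vectors $(-1)^{s_i}x_i+(-1)^{s_j}x_j+(-1)^{s_k}x_k$ with $v\in V$ and $(s_i,s_j,s_k)\in\mathbb{F}_2^3$ satisfying $s_i+s_j+s_k=c(v)$, and let $P_{\gamma,c}=\{u:\langle p,u\rangle\ge-1\ \forall p\in P^\circ_{\gamma,c}\}$ be its polar dual. $X_{P_{\gamma,c},M_\gamma}$ is the projective toric variety with character lattice $M_\gamma$ and moment polytope $P_{\gamma,c}$; equivalently its fan, in the cocharacter lattice $N_\gamma$, consists of the cones over the proper faces of $P^\circ_{\gamma,c}$. *)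

(* Defs.v *)
From HB Require Import structures.
From mathcomp Require Import all_boot all_order all_algebra.
From mathcomp Require Import fraction generic_quotient reals.
From mathcomp Require Import mpoly.

Set Implicit Arguments.
Unset Strict Implicit.
Unset Printing Implicit Defensive.

Import Order.TTheory GRing.Theory Num.Theory.
Local Open Scope ring_scope.

(** * Trivalent graphs *)

(* Loops and multiple edges are allowed.  The half-edges are the pairs (e, d);
   numbering the two ends of an edge by [false] and [true] is bookkeeping, and
   no notion below depends on it. *)
Record graph := Graph {
  vertex : finType;
  edge : finType;
  endpoint : edge * bool -> vertex
}.

Definition adjacent (G : graph) (S : {set edge G}) : rel (vertex G) :=
  fun x y => [exists e in S, exists d : bool,
    (endpoint (e, d) == x) && (endpoint (e, ~~ d) == y)].

Definition connected_by (G : graph) (S : {set edge G}) : bool :=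
  [forall x, forall y, connect (adjacent S) x y].

Definition valency (G : graph) (v : vertex G) : nat :=
  #|[set h : edge G * bool | endpoint h == v]|.

Definition trivalent_graph (G : graph) : Prop :=
  [/\ (0 < #|vertex G|)%N, connected_by [set: edge G]
    & forall v : vertex G, valency v = 3].

Definition genus (G : graph) : nat :=
  (#|edge G| + n_comp (adjacent [set: edge G]) predT - #|vertex G|)%N.

Definition separating (G : graph) (e : edge G) : bool :=
  ~~ connected_by [set~ e].

Definition coloring (G : graph) := vertex G -> 'F_2.

(** * The lattices and the polytopes *)

Section Polytopes.
Variable G : graph.

(* Of the signs in the second component, only those of the half-edges at the
   vertex matter.  The two half-edges of a loop carry independent signs. *)
Definition corner := (vertex G * {ffun edge G * bool -> 'F_2})%type.

Definition corner_vec (t : corner) (e : edge G) : int :=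
  \sum_(d : bool | endpoint (e, d) == t.1) (-1) ^+ t.2 (e, d).

Definition corner_parity (t : corner) : 'F_2 :=
  \sum_(h | endpoint h == t.1) t.2 h.

Definition in_N (u : edge G -> int) : Prop :=
  exists a : corner -> int, forall e, u e = \sum_t a t * corner_vec t e.

Definition lattice_basis (n : nat) (b : 'I_n -> edge G -> int) : Prop :=
  [/\ forall i, in_N (b i),
      forall u, in_N u ->
        exists a : 'I_n -> int, forall e, u e = \sum_i a i * b i e
    & forall a : 'I_n -> int,
        (forall e, \sum_i a i * b i e = 0) -> forall i, a i = 0].

Variable R : realType.

Definition pairing (p q : edge G -> R) : R := \sum_e p e * q e.

Definition int_vec (u : edge G -> int) : edge G -> R := fun e => (u e)%:~R.

Definition in_M (m : edge G -> R) : Prop :=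
  forall u, in_N u -> pairing m (int_vec u) \is a Num.int.

Variable c : coloring G.

Definition in_Pcirc (p : edge G -> R) : Prop :=
  exists a : corner -> R,
    [/\ forall t, 0 <= a t,
        forall t, corner_parity t != c t.1 -> a t = 0,
        \sum_t a t = 1
      & forall e, p e = \sum_t a t * (corner_vec t e)%:~R].

Definition in_P (q : edge G -> R) : Prop :=
  forall p, in_Pcirc p -> -1 <= pairing p q.

(* For q in P, the points p of Pcirc with <p, q> = -1 form a proper
   face, and every proper face (the empty one included) arises in this way.
   The cone over it is also the inner normal cone of P at q, so these cones
   form the normal fan of P. *)
Definition fan_cone (q p : edge G -> R) : Prop :=
  (forall e, p e = 0) \/
  exists (t : R) (x : edge G -> R),
    [/\ 0 <= t, in_Pcirc x, pairing x q = -1 & forall e, p e = t * x e].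

Definition dual_cone (q m : edge G -> R) : Prop :=
  forall p, fan_cone q p -> 0 <= pairing m p.

End Polytopes.

(* Since N contains 2 Z^E, the number n is that of the edges. *)
Lemma lattice_basis_exists (G : graph) :
  exists (n : nat) (b : 'I_n -> edge G -> int), lattice_basis b.
Proof.
pose A : 'M[int]_(#|{: corner G}|, #|edge G|) :=
  \matrix_(i, j) corner_vec (enum_val i) (enum_val j).
have [L uL [V uV [d _ defA]]] := int_Smith_normal_form A.
set D := (\matrix_(i, j) _) in defA.
pose dd (j : 'I_#|edge G|) : int := if (j < #|{: corner G}|)%N then d`_j else 0.
have NE (u : edge G -> int) : in_N u <->
    exists y : 'rV[int]_#|{: corner G}|, forall e, u e = (y *m D *m V) 0 (enum_rank e).
  split=> [[a ua]|[y uy]].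
    exists (\row_i a (enum_val i) *m L) => e; rewrite ua.
    have ->: (\row_i a (enum_val i)) *m L *m D *m V = (\row_i a (enum_val i)) *m A.
      by rewrite defA !mulmxA.
    rewrite mxE.
    rewrite (reindex (@enum_val _ {: corner G})) /=; last first.
      exact/onW_bij/enum_val_bij.
    by apply: eq_bigr => i _; rewrite !mxE enum_rankK.
  exists (fun t => (y *m invmx L) 0 (enum_rank t)) => e.
  rewrite uy.
  have ->: y *m D *m V = y *m invmx L *m A.
    by rewrite defA -!mulmxA (mulmxA (invmx L)) mulVmx // mul1mx !mulmxA.
  rewrite mxE (reindex (@enum_val _ {: corner G})) /=; last first.
    exact/onW_bij/enum_val_bij.
  by apply: eq_bigr => i _; rewrite !mxE enum_valK enum_rankK.
have yD (y : 'rV[int]_#|{: corner G}|) (j : 'I_#|edge G|) :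
    (y *m D) 0 j = if insub (val j) is Some i then y 0 i * dd j else 0.
  rewrite mxE; case: insubP => [i lti ij|nlt].
    rewrite (bigD1 i) //= big1 ?addr0 => [|i' ne].
      by rewrite mxE /dd -ij ltn_ord eqxx mulr1n.
    rewrite mxE -ij; case: eqP => [/val_inj e|]; last by rewrite mulr0n mulr0.
    by rewrite e eqxx in ne.
  apply: big1 => i _; rewrite mxE; case: eqP => [e|]; last by rewrite mulr0n mulr0.
  by move: nlt; rewrite -[val j]e ltn_ord.
pose J := [pred j : 'I_#|edge G| | dd j != 0].
have ddlt j : dd j != 0 -> (j < #|{: corner G}|)%N by rewrite /dd; case: ifP; rewrite ?eqxx.
exists #|J|, (fun i e => dd (enum_val i) * V (enum_val i) (enum_rank e)).
have sumJ (F : 'I_#|edge G| -> int) : (forall j, dd j = 0 -> F j = 0) ->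
    \sum_j F j = \sum_(i < #|J|) F (enum_val i).
  move=> F0; rewrite (bigID J) /= [X in _ + X]big1 ?addr0; last first.
    by move=> j /negPn/eqP/F0.
  by rewrite -(big_enum_val (A := J)).
split=> [i|u /NE[y uy]|a a0].
- have iJ : dd (enum_val i) != 0 by exact: (enum_valP i).
  apply/NE; exists (delta_mx 0 (Ordinal (ddlt _ iJ))) => e.
  rewrite mxE (bigD1 (enum_val i)) //= big1 ?addr0 => [|j ne].
    by rewrite yD insubT ?ddlt // => lt; rewrite mxE eqxx -val_eqE /= eqxx mul1r.
  rewrite yD; case: insubP => [i' _ ij|]; rewrite ?mul0r // mxE eqxx /=.
  case: eqP => [e'|]; rewrite ?mul0r //.
  by case/negP: ne; rewrite -val_eqE /= -ij e'.
- exists (fun i => if insub (val (enum_val i)) is Some i' then y 0 i' else 0) => e.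
  rewrite uy mxE sumJ => [|j dj]; last first.
    by rewrite yD dj; case: insub => [?|]; rewrite ?mulr0 mul0r.
  apply: eq_bigr => i _; rewrite yD; case: insub => [?|]; rewrite ?mul0r //.
  by rewrite mulrA.
- move=> i.
  pose x : 'rV[int]_#|edge G| := \row_j
    (if [pick i | enum_val i == j] is Some i then a i * dd j else 0).
  have xV : x *m V = 0.
    apply/rowP=> j; rewrite mxE [RHS]mxE sumJ => [|l dl].
      rewrite -[RHS](a0 (enum_val j)); apply: eq_bigr => i' _.
      rewrite mxE enum_valK; case: pickP => [i2 /eqP/enum_val_inj->|/(_ i')]; last by rewrite eqxx.
      by rewrite mulrA.
    by rewrite mxE; case: pickP => [i' _|_]; rewrite ?dl ?mulr0 mul0r.
  have : x = 0 by rewrite -[x]mulmx1 -(mulmxV uV) mulmxA xV mul0mx.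
  move/rowP/(_ (enum_val i)); rewrite !mxE.
  case: pickP => [i2 /eqP/enum_val_inj->|/(_ i)]; last by rewrite eqxx.
  move/eqP; rewrite mulf_eq0 => /orP[/eqP//|].
  by move/negP: (enum_valP i) => /[swap] ->.
Qed.

(** * Discrepancies in a rational function field *)

Section Discrepancies.
Variables (k : fieldType) (n : nat).

Notation K := {fraction {mpoly k[n]}}.

Definition cst (a : k) : K := FracField.tofrac (a%:MP_[n]).

Definition coord (i : 'I_n) : K := FracField.tofrac 'X_i.

Definition monom (a : 'I_n -> int) : K := \prod_i coord i ^ a i.

Definition partial (i : 'I_n) (f : K) : K :=
  let p := \n_(repr f) in let q := \d_(repr f) in
  FracField.tofrac (p^`M(i) * q - p * q^`M(i)) / FracField.tofrac (q ^+ 2).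

Definition jacobian (f : 'I_n -> K) : K := \det (\matrix_(i, j) partial i (f j)).

(* Normalized discrete valuations of K trivial on k; the value at 0 is junk. *)
Definition discrete_valuation (v : K -> int) : Prop :=
  [/\ forall f g, f != 0 -> g != 0 -> v (f * g) = v f + v g,
      forall f g, f != 0 -> g != 0 -> f + g != 0 ->
        Num.min (v f) (v g) <= v (f + g),
      forall a : k, a != 0 -> v (cst a) = 0
    & exists2 f, f != 0 & v f = 1].

Definition val_ring (v : K -> int) (f : K) : Prop := f = 0 \/ 0 <= v f.

(* The residue field has transcendence degree n - 1 over k: the residues of
   the f j are algebraically independent when no nonzero polynomial in the f j
   lies in the maximal ideal. *)
Definition divisorial (v : K -> int) : Prop :=
  discrete_valuation v /\
  exists f : 'I_n.-1 -> K, (forall j, val_ring v (f j)) /\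
    forall p : {mpoly k[n.-1]}, p != 0 ->
      mmap cst f p != 0 /\ v (mmap cst f p) = 0.

(* For O the valuation ring of a divisorial v, the top exterior power of the
   module of differentials of O over k is free of rank one, and it is spanned
   by the df_1 /\ ... /\ df_n with the f_j in O.  Since
   df_1 /\ ... /\ df_n = jacobian f * dx_1 /\ ... /\ dx_n, the next predicate
   says that the rational form dx_1 /\ ... /\ dx_n has order at least e
   along v. *)
Definition dx_order_ge (v : K -> int) (e : int) : Prop :=
  exists f : 'I_n -> K,
    [/\ forall j, val_ring v (f j), jacobian f != 0 & v (jacobian f) <= - e].

Definition dx_order (v : K -> int) (e : int) : Prop :=
  dx_order_ge v e /\ ~ dx_order_ge v (e + 1).

(* In the rest of the section, A is the coordinate ring of a normal affine
   variety U with function field K. *)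

Definition centered (A : K -> Prop) (v : K -> int) : Prop :=
  forall f, A f -> val_ring v f.

(* v is the valuation of a prime divisor of U: it has a center on U, and the
   local ring of U at this center is the valuation ring of v. *)
Definition prime_divisor (A : K -> Prop) (v : K -> int) : Prop :=
  [/\ discrete_valuation v, centered A v
    & forall f, val_ring v f ->
        exists g h, [/\ A g, A h, h != 0, v h = 0 & f = g / h]].

Definition exceptional (A : K -> Prop) (v : K -> int) : Prop :=
  [/\ divisorial v, centered A v & ~ prime_divisor A v].

(* U is an affine toric variety with torus coordinates x_1, ..., x_n, so the
   divisor of dx_1 /\ ... /\ dx_n is torus-invariant, and if a multiple r K_U
   is Cartier, then it is the divisor of monom a * (dx_1 /\ ... /\ dx_n)^r for
   some a (a torus-invariant Cartier divisor on an affine toric variety is the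
   divisor of a character).  This is the first condition below.  The second
   one says that the order r * a(E, U) of this form along every exceptional
   divisor E over U is positive. *)
Definition terminal_chart (A : K -> Prop) : Prop :=
  exists (r : nat) (a : 'I_n -> int),
    [/\ (0 < r)%N,
        forall w, prime_divisor A w ->
          exists2 e, dx_order w e & r%:Z * e + w (monom a) = 0
      & forall v, exceptional A v ->
          exists2 e, dx_order_ge v e & 0 < r%:Z * e + v (monom a)].

End Discrepancies.

(** * The toric variety *)

Section ToricVariety.
Variables (G : graph) (R : realType) (k : fieldType).
Variables (n : nat) (b : 'I_n -> edge G -> int).

(* With x_1, ..., x_n the coordinates of the torus dual to a basis b of N, the
   character of m in M is the monomial with exponents <m, b_i>, which are
   integers, so that taking floors is only a cast. *)
Definition character (m : edge G -> R) : {fraction {mpoly k[n]}} :=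
  monom k (fun i => Num.floor (pairing m (int_vec R (b i)))).

(* The semigroup algebra of the lattice points of the dual cone. *)
Definition chart_ring (c : coloring G) (q : edge G -> R)
    (f : {fraction {mpoly k[n]}}) : Prop :=
  exists (l : nat) (z : 'I_l -> k) (m : 'I_l -> edge G -> R),
    (forall j, in_M (m j) /\ dual_cone c q (m j)) /\
    f = \sum_j cst n (z j) * character (m j).

(* Discrepancies are local on the variety, which is covered by the affine
   charts of the cones of its fan. *)
Definition terminal_toric_variety (c : coloring G) : Prop :=
  forall q, in_P c q -> terminal_chart (chart_ring c q).

End ToricVariety.

(* Main.v *)
From HB Require Import structures.
From mathcomp Require Import all_boot all_order all_algebra.
From mathcomp Require Import fraction generic_quotient boolp reals perm.
From mathcomp Require Import mpoly zify ring lra.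
Require Import Defs.

Set Implicit Arguments.
Unset Strict Implicit.
Unset Printing Implicit Defensive.

Import Order.TTheory GRing.Theory Num.Theory.
Local Open Scope ring_scope.

(* The fan of the variety lives in N, the lattice of the integral vectors whose
   reduction modulo 2 is a cut of the graph, and its rays are corner vectors.  The
   form monom a * (dx_1 /\ ... /\ dx_n)^r has order r (<m, u> - 1) along the
   monomial valuation of weight u, where m is 1 on the rays of the cone at hand.

   If e is a separating edge, then {e} is a cut, so x_e is in N up to sign.  It is
   the midpoint of two corner vectors at an end of e, hence its monomial valuation
   is exceptional of discrepancy 0.

   If there is no separating edge, then cuts have at least two edges, and the only
   nonzero points of N in the polytope are the corner vectors: such a point has
   entries in {0, 1, -1}, and its support is a cut of two or three edges.  It
   remains to bound discrepancies of arbitrary divisorial valuations v, which is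
   done with derivations.  Let u be the weight of v, D the Euler derivation
   sum_i u_i x_i d/dx_i, and O the valuation ring.
   - If u <> 0, then n independent monomials, all but one of weight 0, give a
     jacobian which settles every case but that of u = d rho with rho a ray.
   - In this last case, if replacing one of these monomials by g in O never
     improves the bound, then D g is in the maximal ideal for all g in O; this
     forces d = 1 and v = the monomial valuation of rho, a prime divisor.
   - If u = 0 and no jacobian improves on that of the coordinates, then O is
     stable under all d/dx_i; such a discrete valuation ring is a localization of
     k[x], so v is a prime divisor of the torus. *)

(** * Valuations and derivations of a field *)

(** Terminality is tested on all divisorial valuations, most of them not monomial, and no resolution
    reduces the test to monomial ones. What replaces it: [dx_order_ge] asks for a single Jacobian,
    so the failure of a better bound speaks about every Jacobian, and inserting an arbitrary [g] in
    one column turns it into stability of the valuation ring under a derivation. Characteristic zero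
    makes the nonzero integers [<a, u>] units, so eigenvalues of Euler derivations cost nothing. The
    coloring matters for cuts of two edges. Without a parity condition, two corners at one vertex
    that differ only in the sign at the third half-edge would average to such a cut; parity excludes
    this. At an end of a separating edge, parity leaves the common sign of the other two half-edges
    free, which is why a midpoint exists there. Cones are given by real points [q], while [m] has to
    be rational with common denominator [r]; the equations [<m, rho> = 1] have integer coefficients,
    which allows the descent. *)

Definition valuation (K : fieldType) (v : K -> int) : Prop :=
  (forall f g, f != 0 -> g != 0 -> v (f * g) = v f + v g) /\
  (forall f g, f != 0 -> g != 0 -> f + g != 0 -> Num.min (v f) (v g) <= v (f + g)).

(* The value of v at 0 is junk, so 0 is treated apart. *)
Definition val_ge (K : fieldType) (v : K -> int) (s : int) (f : K) : bool :=
  (f == 0) || (s <= v f).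

Section Valuation.
Variables (K : fieldType) (v : K -> int).
Hypothesis v_val : valuation v.

Lemma valM f g : f != 0 -> g != 0 -> v (f * g) = v f + v g.
Proof. by case: v_val => vM _; apply: vM. Qed.

Lemma val1 : v 1 = 0.
Proof.
have := valM (oner_neq0 K) (oner_neq0 K).
by rewrite mulr1 => /eqP; rewrite -subr_eq0 opprD addNKr oppr_eq0 => /eqP.
Qed.

Lemma valX f n : f != 0 -> v (f ^+ n) = v f *+ n.
Proof.
move=> f0; elim: n => [|n IH]; first by rewrite expr0 val1.
by rewrite exprS valM ?expf_neq0 // IH mulrS.
Qed.

Lemma valV f : f != 0 -> v f^-1 = - v f.
Proof.
move=> f0; have := valM f0 (invr_neq0 f0).
by rewrite mulfV // val1 => /esym/eqP; rewrite addrC addr_eq0 => /eqP.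
Qed.

Lemma val_div f g : f != 0 -> g != 0 -> v (f / g) = v f - v g.
Proof. by move=> f0 g0; rewrite valM ?invr_neq0 // valV. Qed.

Lemma valXz f (n : int) : f != 0 -> v (f ^ n) = v f * n.
Proof.
move=> f0; case: n => n; first by rewrite -exprnP valX // -mulr_natr; congr (_ * _); lia.
by rewrite NegzE -exprnN valV ?expf_neq0 // valX // -mulr_natr; lia.
Qed.

Lemma val_prod (I : finType) (F : I -> K) : (forall i, F i != 0) ->
  v (\prod_i F i) = \sum_i v (F i).
Proof.
move=> F0; suff: \prod_i F i != 0 /\ v (\prod_i F i) = \sum_i v (F i) by case.
apply: (big_rec2 (fun x y => x != 0 /\ v x = y)) => [|i x y _ [x0 vx]].
  by rewrite oner_neq0 val1.
by rewrite mulf_neq0 // valM // vx.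
Qed.

Lemma valN f : v (- f) = v f.
Proof.
have vN1 : v (-1) = 0.
  have n0 : -1 != 0 :> K by rewrite oppr_eq0 oner_eq0.
  by have := valM n0 n0; rewrite mulrNN mulr1 val1; move: (v (-1)) => z; lia.
have [->|f0] := eqVneq f 0; first by rewrite oppr0.
by rewrite -mulN1r valM ?oppr_eq0 ?oner_eq0 // vN1 add0r.
Qed.

Lemma val_ge0 s : val_ge v s 0.
Proof. by rewrite /val_ge eqxx. Qed.

Lemma val_geE s f : f != 0 -> val_ge v s f = (s <= v f).
Proof. by rewrite /val_ge => /negPf->. Qed.

Lemma val_geW s t f : t <= s -> val_ge v s f -> val_ge v t f.
Proof. by rewrite /val_ge => ts /orP[->//|/(le_trans ts)->]; rewrite orbT. Qed.

Lemma val_geD s f g : val_ge v s f -> val_ge v s g -> val_ge v s (f + g).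
Proof.
have [->|f0] := eqVneq f 0; first by rewrite add0r.
have [->|g0] := eqVneq g 0; first by rewrite addr0.
have [->|fg0] := eqVneq (f + g) 0; first by rewrite val_ge0.
rewrite !val_geE // => sf sg; case: v_val => _ /(_ f g f0 g0 fg0).
by apply: le_trans; rewrite le_min sf.
Qed.

Lemma val_geM s t f g : val_ge v s f -> val_ge v t g -> val_ge v (s + t) (f * g).
Proof.
have [->|f0] := eqVneq f 0; first by rewrite mul0r !val_ge0.
have [->|g0] := eqVneq g 0; first by rewrite mulr0 !val_ge0.
by rewrite !val_geE ?mulf_neq0 // valM //; apply: lerD.
Qed.

Lemma val_geN s f : val_ge v s (- f) = val_ge v s f.
Proof. by rewrite /val_ge oppr_eq0 valN. Qed.

Lemma val_geB s f g : val_ge v s f -> val_ge v s g -> val_ge v s (f - g).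
Proof. by move=> sf sg; rewrite val_geD ?val_geN. Qed.

Lemma val_ge_sum (I : Type) (r : seq I) (P : pred I) (F : I -> K) s :
  (forall i, P i -> val_ge v s (F i)) -> val_ge v s (\sum_(i <- r | P i) F i).
Proof. by move=> sF; elim/big_ind: _ => *; [apply: val_ge0|apply: val_geD|apply: sF]. Qed.

Lemma val_ge_prod (I : Type) (r : seq I) (P : pred I) (F : I -> K) (s : I -> int) :
  (forall i, P i -> val_ge v (s i) (F i)) ->
  val_ge v (\sum_(i <- r | P i) s i) (\prod_(i <- r | P i) F i).
Proof.
move=> sF; apply: (big_rec2 (fun x y => val_ge v x y)) => [|i x y Pi].
  by rewrite val_geE ?oner_neq0 // val1.
by apply: val_geM; apply: sF.
Qed.

Lemma val_ge_det n (A : 'M[K]_n) :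
  (forall i j, val_ge v 0 (A i j)) -> val_ge v 0 (\det A).
Proof.
move=> A0; apply: val_ge_sum => s _; rewrite -[0]addr0; apply: val_geM.
  by case: (odd_perm s); rewrite ?expr0 ?expr1 ?val_geN val_geE ?oner_neq0 ?val1.
have := @val_ge_prod _ (index_enum 'I_n) predT (fun i => A i (s i)) (fun=> 0).
by rewrite big1 //; apply=> i _; apply: A0.
Qed.

Lemma val_ge_cofactor n (A : 'M[K]_n) i j :
  (forall i j, val_ge v 0 (A i j)) -> val_ge v 0 (cofactor A i j).
Proof.
move=> A0; rewrite /cofactor -[0]addr0; apply: val_geM; last first.
  by apply: val_ge_det => k l; rewrite !mxE; apply: A0.
by rewrite -signr_odd; case: odd; rewrite ?expr0 ?expr1 ?val_geN val_geE ?oner_neq0 ?val1.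
Qed.

Lemma val_addr f g : f != 0 -> val_ge v (v f + 1) g -> f + g != 0 /\ v (f + g) = v f.
Proof.
move=> f0 gf; have fg0 : f + g != 0.
  apply/eqP => fg; have gE : g = - f by apply/eqP; rewrite -addr_eq0 addrC fg.
  by move: gf; rewrite gE val_geN val_geE //; lia.
split=> //; apply/eqP; rewrite eq_le; apply/andP; split; last first.
  by rewrite -(val_geE _ fg0); apply: val_geD; [rewrite val_geE|apply: val_geW _ gf; lia].
rewrite leNgt; apply/negP => lt.
have : val_ge v (v f + 1) (f + g - g).
  by apply: val_geB => //; rewrite val_geE //; lia.
by rewrite addrK val_geE //; lia.
Qed.

Variable D : K -> K.
Hypothesis D_der : (forall f g, D (f + g) = D f + D g) /\
  (forall f g, D (f * g) = D f * g + f * D g).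

Lemma derD f g : D (f + g) = D f + D g. Proof. by case: D_der. Qed.
Lemma derM f g : D (f * g) = D f * g + f * D g. Proof. by case: D_der. Qed.

Lemma der0 : D 0 = 0.
Proof. by apply: (addrI (D 0)); rewrite -derD !addr0. Qed.

Lemma der1 : D 1 = 0.
Proof.
have := derM 1 1; rewrite !mulr1 mul1r => /eqP.
by rewrite -subr_eq0 opprD addNKr oppr_eq0 => /eqP.
Qed.

Lemma derN f : D (- f) = - D f.
Proof. by apply/eqP; rewrite -addr_eq0 addrC -derD subrr der0. Qed.

Lemma der_sum (I : Type) (r : seq I) (P : pred I) (F : I -> K) :
  D (\sum_(i <- r | P i) F i) = \sum_(i <- r | P i) D (F i).
Proof. exact: (big_morph D derD der0). Qed.

Lemma derX f n : D (f ^+ n) = f ^+ n.-1 * D f *+ n.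
Proof.
elim: n => [|n IH]; first by rewrite expr0 der1 mulr0n.
rewrite exprS derM IH /= mulrS [D f * _]mulrC; congr (_ + _).
by case: n {IH} => [|n]; rewrite ?mulr0n ?mulr0 //= mulrnAr mulrA -exprS.
Qed.

Lemma der_div f g : g != 0 -> D (f / g) = (D f * g - f * D g) / g ^+ 2.
Proof.
move=> g0; have -> : D f = D (f / g) * g + f / g * D g by rewrite -derM divfK.
by move: (D (f / g)) (D g) => a b; field.
Qed.

Lemma derV f : f != 0 -> D f^-1 = - D f / f ^+ 2.
Proof. by move=> f0; have := der_div 1 f0; rewrite der1 mul0r sub0r !mul1r. Qed.

Lemma derXz f (n : int) : f != 0 -> D (f ^ n) = f ^ (n - 1) * D f *~ n.
Proof.
move=> f0; case: n => n.
  rewrite -exprnP derX -pmulrn; case: n => [|n]; first by rewrite !mulr0n.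
  by rewrite /= exprnP; congr (_ ^ _ * _ *+ _); lia.
have ->: f ^ (Negz n - 1) = f ^+ n / (f ^+ n.+1) ^+ 2.
  by rewrite -exprM exprnN exprnP -expfzDr //; congr (_ ^ _); lia.
rewrite NegzE -exprnN derV ?expf_neq0 // derX /= mulrNz -pmulrn.
by rewrite mulNr mulrnAl mulrAC.
Qed.

(** In [f = t ^ s * e] with [e] a unit, Leibniz's rule loses at most one factor [t], on the power.
    That the loss is only one is what later bounds the gcd of the weights. *)
Lemma val_ge_der c f t : v t = 1 -> t != 0 ->
  (forall f, val_ge v 0 f -> val_ge v c (D f)) ->
  0 <= v f -> val_ge v (v f - 1 + c) (D f).
Proof.
move=> vt t0 Dc vf; have [->|f0] := eqVneq f 0; first by rewrite der0 val_ge0.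
have fE : f = t ^+ `|v f|%N * (f / t ^+ `|v f|%N) by rewrite mulrC divfK ?expf_neq0.
have eps0 : val_ge v 0 (f / t ^+ `|v f|%N).
  rewrite val_geE ?mulf_neq0 ?invr_neq0 ?expf_neq0 //.
  by rewrite val_div ?expf_neq0 // valX // vt; lia.
have tn n : val_ge v n%:Z (t ^+ n) by rewrite val_geE ?expf_neq0 // valX // vt; lia.
rewrite {2}fE derM derX; apply: val_geD.
  have [->|s0] := eqVneq `|v f|%N 0%N; first by rewrite mulr0n mul0r val_ge0.
  rewrite -mulr_natr -[v f - 1 + c]addr0; apply: val_geM => //.
  rewrite -[v f - 1 + c]addr0; apply: val_geM.
    apply: val_geM; first by apply: val_geW _ (tn _); lia.
    by apply: Dc; rewrite val_geE // vt.
  have : val_ge v 0 (1 : K) by rewrite val_geE ?oner_neq0 // val1.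
  by elim: `|v f|%N => [_|n IH H]; [rewrite val_ge0|rewrite -addn1 natrD val_geD ?IH].
apply: (@val_geW (v f + c)); first by lia.
by apply: val_geM; [apply: val_geW _ (tn _); lia|apply: Dc].
Qed.

End Valuation.

(** * Rational functions *)

Section QuotientRule.
Variable F : fieldType.
Implicit Types a b x y : F.

(** The letters [x], [y], [x'], [y'] stand for the derivatives of [a], [b], [a'], [b']; the second
    equation is the derivative of the first. *)
Lemma quotient_rule_wd a b x y a' b' x' y' : b != 0 -> b' != 0 ->
  a * b' = a' * b -> x * b' + a * y' = x' * b + a' * y ->
  (x' * b' - a' * y') / b' ^+ 2 = (x * b - a * y) / b ^+ 2.
Proof.
move=> b0 b'0 E1 E2; have aE : a = a' / b' * b by rewrite mulrAC -E1 mulfK.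
have -> : x = (x' * b + a' * y - (a' / b' * b) * y') / b'.
  apply: (canRL (mulfK b'0)); apply: (addIr (a * y')); rewrite E2 aE; field.
  by [].
by rewrite aE; field; rewrite b0.
Qed.

Lemma quotient_rule_add a b x y a' b' x' y' : b != 0 -> b' != 0 ->
  ((x * b' + a * y' + (x' * b + a' * y)) * (b * b') -
   (a * b' + a' * b) * (y * b' + b * y')) / (b * b') ^+ 2 =
  (x * b - a * y) / b ^+ 2 + (x' * b' - a' * y') / b' ^+ 2.
Proof. by move=> b0 b'0; field; rewrite ?b0 ?b'0. Qed.

Lemma quotient_rule_mul a b x y a' b' x' y' : b != 0 -> b' != 0 ->
  ((x * a' + a * x') * (b * b') - a * a' * (y * b' + b * y')) / (b * b') ^+ 2 =
  (x * b - a * y) / b ^+ 2 * (a' / b') + a / b * ((x' * b' - a' * y') / b' ^+ 2).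
Proof. by move=> b0 b'0; field; rewrite ?b0 ?b'0. Qed.

End QuotientRule.

Section RationalFunctions.
Variables (k : fieldType) (n : nat).

Notation K := {fraction {mpoly k[n]}}.
Notation tofrac := (@FracField.tofrac {mpoly k[n]}).
Implicit Types a b : 'I_n -> int.

Lemma frac_repr (f : K) : f = tofrac \n_(repr f) / tofrac \d_(repr f).
Proof.
apply: (canRL (mulfK _)); first by rewrite tofrac_eq0 denom_ratioP.
rewrite -[f in LHS]reprK /=; set x := repr f.
rewrite !piE; apply/eqmodP => /=.
rewrite /FracField.mulf /= FracField.equivfE.
rewrite !numden_Ratio ?mulr1 ?oner_neq0 ?denom_ratioP //.
by rewrite /x reprK mulrC.
Qed.

Lemma fracP (f : K) : exists2 pq : {mpoly k[n]} * {mpoly k[n]},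
  pq.2 != 0 & f = tofrac pq.1 / tofrac pq.2.
Proof. by exists (\n_(repr f), \d_(repr f)); [apply: denom_ratioP|apply: frac_repr]. Qed.

(** [partial] reads a representative picked by [repr]; differentiating the cross-multiplied equality
    of two representatives shows that the choice does not matter. *)
Lemma partial_frac i p q : q != 0 ->
  partial i (tofrac p / tofrac q) = tofrac (p^`M(i) * q - p * q^`M(i)) / tofrac (q ^+ 2).
Proof.
move=> q0; rewrite /partial; have := frac_repr (tofrac p / tofrac q).
have := denom_ratioP (repr (tofrac p / tofrac q)).
move: (\n__) (\d__) => p' q' q'0 eqf.
have Q0 : tofrac q != 0 by rewrite tofrac_eq0.
have Q'0 : tofrac q' != 0 by rewrite tofrac_eq0.
have eqp : p * q' = p' * q.
  by move/eqP: eqf; rewrite (eqr_div _ _ Q0 Q'0) -!tofracM tofrac_eq => /eqP.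
rewrite !(tofracXn, tofracM, tofracD, tofracN).
apply: (quotient_rule_wd Q0 Q'0).
  by rewrite -!tofracM eqp.
by have := congr1 tofrac (congr1 (mderiv i) eqp); rewrite !mderivM !(tofracM, tofracD).
Qed.

Lemma partial_tofrac i p : partial i (tofrac p : K) = tofrac p^`M(i).
Proof.
have := partial_frac i p (oner_neq0 {mpoly k[n]}).
by rewrite tofrac1 divr1 expr1n tofrac1 divr1 mulr1 -mpolyC1 mderivC mulr0 subr0.
Qed.

Lemma partial_der i : (forall f g, partial i (f + g : K) = partial i f + partial i g) /\
  (forall f g, partial i (f * g : K) = partial i f * g + f * partial i g).
Proof.
split=> f g; have [[p q] /= q0 ->] := fracP f; have [[p' q'] /= q'0 ->] := fracP g.
- have Q0 : tofrac q != 0 by rewrite tofrac_eq0.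
  have Q'0 : tofrac q' != 0 by rewrite tofrac_eq0.
  rewrite (addf_div _ _ Q0 Q'0) -!tofracM -tofracD !partial_frac ?mulf_neq0 //.
  rewrite !mderivD !mderivM !(tofracXn, tofracM, tofracD, tofracN).
  exact: (quotient_rule_add _ _ _ _ _ _ Q0 Q'0).
- have Q0 : tofrac q != 0 by rewrite tofrac_eq0.
  have Q'0 : tofrac q' != 0 by rewrite tofrac_eq0.
  rewrite mulf_div -!tofracM !partial_frac ?mulf_neq0 // !mderivM.
  rewrite !(tofracXn, tofracM, tofracD, tofracN).
  exact: (quotient_rule_mul _ _ _ _ _ _ Q0 Q'0).
Qed.

Lemma partial_cst i (a : k) : partial i (cst n a : K) = 0.
Proof. by rewrite partial_tofrac mderivC tofrac0. Qed.

Lemma partial_coord i j : partial i (coord k j : K) = (i == j)%:R.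
Proof.
rewrite partial_tofrac mderivX mnmE [j == i]eq_sym; case: eqP => [->|_].
  have -> : (U_(j) - U_(j))%MM = 0%MM :> 'X_{1..n}.
    by apply/mnmP=> l; rewrite !mnmE subnn.
  by rewrite mpolyX0 scale1r tofrac1.
by rewrite scale0r tofrac0.
Qed.

Lemma cst_eq0 (a : k) : (cst n a == 0) = (a == 0).
Proof. by rewrite tofrac_eq0 mpolyC_eq0. Qed.

Lemma cstM (a b : k) : cst n (a * b) = cst n a * cst n b.
Proof. by rewrite /cst mpolyCM tofracM. Qed.

Lemma cst_int (z : int) : z%:~R = cst n (z%:~R : k).
Proof. by rewrite /cst !rmorph_int. Qed.

Lemma coord_neq0 (i : 'I_n) : coord k i != 0.
Proof. by rewrite tofrac_eq0 -msupp_eq0 msuppX. Qed.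

Lemma monom_neq0 a : monom k a != 0 :> K.
Proof. by apply/prodf_neq0 => i _; rewrite expfz_neq0 ?coord_neq0. Qed.

Lemma monomD a b : monom k (fun i => a i + b i) = monom k a * monom k b :> K.
Proof. by rewrite -big_split; apply: eq_bigr => i _; rewrite expfzDr ?coord_neq0. Qed.

Lemma monom0 : monom k (fun _ => 0) = 1 :> K.
Proof. by apply: big1 => i _; rewrite expr0z. Qed.

Lemma monomV a : monom k (fun i => - a i) = (monom k a)^-1 :> K.
Proof.
apply: (mulIf (monom_neq0 a)); rewrite -monomD mulVf ?monom_neq0 // -monom0.
by congr monom; apply: funext => i; rewrite addNr.
Qed.

Lemma monom_mnm (m : 'X_{1..n}) : monom k (fun i => (m i)%:Z) = tofrac 'X_[m].
Proof. by rewrite mpolyXE_id rmorph_prod; apply: eq_bigr => i _; rewrite rmorphXn. Qed.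

Lemma monom_coord (i : 'I_n) : monom k (fun j => (j == i)%:Z) = coord k i.
Proof.
rewrite /monom (bigD1 i) //= eqxx expr1z big1 ?mulr1 // => j /negPf->.
by rewrite expr0z.
Qed.

(** Logarithmic derivatives add up over products, so Laurent monomials are eigenvectors of
    [x_i d/dx_i]. Logarithmic Jacobians of monomials are thus integer determinants times
    monomials. *)
Lemma theta_monom i a :
  coord k i * partial i (monom k a) = (a i)%:~R * monom k a :> K.
Proof.
have der_prod (I : Type) (r : seq I) (F G : I -> K) :
    (forall j, coord k i * partial i (F j) = G j * F j) ->
    coord k i * partial i (\prod_(j <- r) F j) = (\sum_(j <- r) G j) * \prod_(j <- r) F j.
  move=> FG; elim: r => [|j r IH].
    by rewrite !big_nil (der1 (partial_der i)) mulr0 mul0r.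
  rewrite !big_cons (derM (partial_der i)) mulrDr [X in X + _]mulrA FG [X in _ + X]mulrCA IH.
  by rewrite mulrDl -mulrA [F j * (_ * _)]mulrCA.
rewrite (der_prod _ _ _ (fun j => ((j == i)%:Z * a j)%:~R)) => [|j].
  rewrite (bigD1 i) //= eqxx mul1r big1 ?addr0 // => j /negPf->.
  by rewrite mul0r.
rewrite (derXz (partial_der i)) ?coord_neq0 // partial_coord [i == j]eq_sym.
case: eqP => [->|_]; last by rewrite mulr0 mul0rz mulr0 mul0r mul0r.
rewrite mulr1 mul1r -mulrzr mulrA -{1}[coord k i]expr1z -expfzDr ?coord_neq0 //.
by rewrite subrKC mulrC.
Qed.

End RationalFunctions.

Lemma char0_intr_eq0 (F : fieldType) (z : int) : [pchar F] =i pred0 ->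
  (z%:~R == 0 :> F) = (z == 0).
Proof.
move=> /pcharf0P char0; case: z => z; first by rewrite -pmulrn char0.
by rewrite NegzE mulrNz oppr_eq0 -pmulrn char0.
Qed.

(** Cramer's rule, from [M *m \adj M = (\det M)%:M]. With [z] the weights and [M] a logarithmic
    Jacobian matrix, [z *m M] is the row of Euler derivatives. *)
Lemma mul_row_det (F : comNzRingType) n (z : 'rV[F]_n) (M : 'M[F]_n) l :
  z 0 l * \det M = \sum_j (z *m M) 0 j * cofactor M l j.
Proof.
have := congr1 (fun A : 'rV_n => A 0 l) (mulmxA z M (\adj M)).
rewrite mul_mx_adj mul_mx_scalar mxE mulrC => ->.
by rewrite mxE; apply: eq_bigr => j _; rewrite [X in _ * X]mxE.
Qed.

Definition dot n (a u : 'I_n -> int) : int := \sum_i a i * u i.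

Lemma dotDl n (a b u : 'I_n -> int) : dot (fun i => a i + b i) u = dot a u + dot b u.
Proof. by rewrite -big_split; apply: eq_bigr => i _; rewrite mulrDl. Qed.

Lemma dotNl n (a u : 'I_n -> int) : dot (fun i => - a i) u = - dot a u.
Proof. by rewrite -sumrN; apply: eq_bigr => i _; rewrite mulNr. Qed.

Lemma dotZl n z (a u : 'I_n -> int) : dot (fun i => z * a i) u = z * dot a u.
Proof. by rewrite mulr_sumr; apply: eq_bigr => i _; rewrite mulrA. Qed.

Lemma dotZr n z (a u : 'I_n -> int) : dot a (fun i => z * u i) = z * dot a u.
Proof. by rewrite mulr_sumr; apply: eq_bigr => i _; rewrite mulrCA. Qed.

Lemma dot_delta n (i : 'I_n) u : dot (fun j => (j == i)%:Z) u = u i.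
Proof.
rewrite /dot (bigD1 i) //= eqxx mul1r big1 ?addr0 // => j /negPf->.
by rewrite mul0r.
Qed.

(** * Laurent polynomials *)

Section Laurent.
Variables (k : fieldType) (n : nat).

Notation K := {fraction {mpoly k[n]}}.
Notation tofrac := (@FracField.tofrac {mpoly k[n]}).

(** One notion for several uses: [Q] a dual cone gives a chart ring, a half-space the Laurent
    polynomials of bounded weight, a level set the homogeneous ones. *)
Definition laurent (Q : ('I_n -> int) -> Prop) (f : K) : Prop :=
  exists (l : nat) (z : 'I_l -> k) (m : 'I_l -> 'I_n -> int),
    (forall j, Q (m j)) /\ f = \sum_j cst n (z j) * monom k (m j).

Definition shift (C : 'I_n -> int) (m : 'X_{1..n}) : 'I_n -> int :=
  fun i => (m i)%:Z + C i.

Lemma laurent_monom Q a : Q a -> laurent Q (monom k a).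
Proof.
move=> Qa; exists 1%N, (fun=> 1), (fun=> a); split=> //.
by rewrite big_ord1 /cst mpolyC1 tofrac1 mul1r.
Qed.

Lemma laurent_shift Q p C : (forall m, m \in msupp p -> Q (shift C m)) ->
  laurent Q (tofrac p * monom k C).
Proof.
move=> QC; exists (size (msupp p)), (fun j => p@_(tnth (in_tuple (msupp p)) j)),
  (fun j => shift C (tnth (in_tuple (msupp p)) j)); split=> [j|].
  by apply: QC; rewrite mem_tnth.
rewrite {1}(mpolyE p) rmorph_sum mulr_suml big_tnth; apply: eq_bigr => j _ /=.
by rewrite -mul_mpolyC tofracM -monom_mnm -mulrA -monomD.
Qed.

Lemma laurentP Q f : laurent Q f ->
  exists p C, f = tofrac p * monom k C /\ forall m, m \in msupp p -> Q (shift C m).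
Proof.
case=> l [z [m [Qm ->]]].
(* Adding [C] makes the exponents of all terms natural numbers. Terms with equal exponents may
   cancel, which only shrinks the support. *)
pose C i : int := \sum_j `|m j i|.
pose e j : 'X_{1..n} := [multinom `|(m j i + C i)%R|%N | i < n].
have eE j : shift (fun i => - C i) (e j) = m j.
  apply: funext => i; rewrite /shift mnmE /C (bigD1 j) //=.
  have : 0 <= \sum_(i0 < l | i0 != j) `|m i0 i| by apply: sumr_ge0.
  by move: (\sum_(_ | _) _) => s; lia.
exists (\sum_j z j *: 'X_[e j]), (fun i => - C i); split.
  rewrite rmorph_sum mulr_suml; apply: eq_bigr => j _ /=.
  by rewrite -mul_mpolyC tofracM -mulrA -monom_mnm -monomD -[in LHS](eE j).
move=> m'; rewrite mcoeff_msupp raddf_sum /=.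
have [/existsP[j /eqP <-] _|/existsPn ne] := boolP [exists j, e j == m'].
  by rewrite eE.
rewrite big1 ?eqxx // => j _; rewrite mcoeffZ mcoeffX.
by rewrite (negPf (ne j)) mulr0.
Qed.

Lemma laurentW (Q Q' : ('I_n -> int) -> Prop) f :
  (forall a, Q a -> Q' a) -> laurent Q f -> laurent Q' f.
Proof. by move=> QQ' [l [z [m [Qm ->]]]]; exists l, z, m; split=> // j; apply: QQ'. Qed.

Lemma mpoly_split (P : pred 'X_{1..n}) (p : {mpoly k[n]}) : exists p1 p2,
  [/\ p = p1 + p2, forall m, m \in msupp p1 -> m \in msupp p /\ P m
    & forall m, m \in msupp p2 -> m \in msupp p /\ ~~ P m].
Proof.
have supp (P' : pred 'X_{1..n}) m :
    m \in msupp (\sum_(m <- msupp p | P' m) p@_m *: 'X_[m]) -> m \in msupp p /\ P' m.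
  rewrite mcoeff_msupp raddf_sum /= => nz; apply/andP; apply: contraNT nz => nP.
  apply/eqP; rewrite big_seq_cond; apply: big1 => m' /andP[m'p Pm'].
  rewrite mcoeffZ mcoeffX; case: eqP nP => [<-|]; last by rewrite mulr0.
  by rewrite m'p Pm'.
exists (\sum_(m <- msupp p | P m) p@_m *: 'X_[m]).
exists (\sum_(m <- msupp p | ~~ P m) p@_m *: 'X_[m]).
by split; [rewrite {1}(mpolyE p) (bigID P)|apply: supp|apply: supp].
Qed.

Lemma val_ringE (v : K -> int) f : val_ring v f <-> val_ge v 0 f.
Proof.
by rewrite /val_ge; split=> [[->|->]|/orP[/eqP|]]; rewrite ?eqxx ?orbT //; [left|right].
Qed.

Section Values.
Variable v : K -> int.
Hypothesis v_disc : discrete_valuation v.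

Lemma disc_val : valuation v. Proof. by case: v_disc. Qed.

Lemma val_cst (a : k) : a != 0 -> v (cst n a) = 0. Proof. by case: v_disc => _ _ + _; apply. Qed.

Lemma uniformizer : exists2 t, t != 0 & v t = 1. Proof. by case: v_disc. Qed.

(** Restricted to characters, a valuation is a point of the cocharacter lattice of the torus. *)
Definition weights : 'I_n -> int := fun i => v (coord k i).

Lemma val_monom a : v (monom k a) = dot a weights.
Proof.
rewrite (val_prod disc_val) => [|i]; last by rewrite expfz_neq0 ?coord_neq0.
by apply: eq_bigr => i _; rewrite (valXz disc_val) ?coord_neq0 // mulrC.
Qed.

Lemma val_ge_cst (a : k) : val_ge v 0 (cst n a).
Proof.
have [->|a0] := eqVneq a 0; first by rewrite /cst mpolyC0 tofrac0 val_ge0.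
by rewrite val_geE ?cst_eq0 // val_cst.
Qed.

Lemma val_ge_laurent Q s f : (forall a, Q a -> s <= dot a weights) ->
  laurent Q f -> val_ge v s f.
Proof.
move=> Qs [l [z [m [Qm ->]]]]; apply: (val_ge_sum disc_val) => j _.
rewrite -[s]add0r; apply: (val_geM disc_val); first exact: val_ge_cst.
by rewrite val_geE ?monom_neq0 // val_monom; apply: Qs.
Qed.

End Values.

Definition theta i (f : K) : K := coord k i * partial i f.

(** The derivation attached to the one-parameter subgroup [u]; its eigenvalue on a monomial is the
    weight. *)
Definition euler (u : 'I_n -> int) (f : K) : K := \sum_i (u i)%:~R * theta i f.

Lemma theta_der i : (forall f g, theta i (f + g) = theta i f + theta i g) /\
  (forall f g, theta i (f * g) = theta i f * g + f * theta i g).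
Proof.
rewrite /theta; split=> f g; first by rewrite (derD (partial_der k i)) mulrDr.
by rewrite (derM (partial_der k i)) mulrDr mulrA [f * (_ * _)]mulrCA.
Qed.

Lemma euler_der u : (forall f g, euler u (f + g) = euler u f + euler u g) /\
  (forall f g, euler u (f * g) = euler u f * g + f * euler u g).
Proof.
rewrite /euler; split=> f g.
  by rewrite -big_split; apply: eq_bigr => i _; rewrite (derD (theta_der i)) mulrDr.
rewrite mulr_suml mulr_sumr -big_split; apply: eq_bigr => i _.
by rewrite (derM (theta_der i)) mulrDr [X in _ + X]mulrCA [X in X + _]mulrA.
Qed.

Lemma euler_monom u a : euler u (monom k a) = (dot a u)%:~R * monom k a.
Proof.
rewrite /euler /dot rmorph_sum mulr_suml; apply: eq_bigr => i _.
by rewrite /theta theta_monom mulrA -intrM mulrC [u i * _]mulrC mulrC.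
Qed.

Lemma theta_cst i (a : k) : theta i (cst n a) = 0.
Proof. by rewrite /theta partial_cst mulr0. Qed.

Lemma euler_cst u (a : k) : euler u (cst n a) = 0.
Proof. by apply: big1 => i _; rewrite theta_cst mulr0. Qed.

(** Passing from [d/dx_i] to [x_i d/dx_i] scales row [i] by the coordinate. This factor is the
    source of the sums of weights in all the orders below. *)
Lemma jacobian_theta (f : 'I_n -> K) :
  \det (\matrix_(i, j) theta i (f j)) = jacobian f * \prod_i coord k i.
Proof.
rewrite /jacobian mulrC.
have -> : \prod_i coord k i = \det (diag_mx (\row_(i < n) coord k i)).
  by rewrite det_diag; apply: eq_bigr => i _; rewrite mxE.
rewrite -det_mulmx; congr (\det _); apply/matrixP=> i j.
by rewrite mul_diag_mx !mxE.
Qed.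

Lemma euler_theta u (f : 'I_n -> K) j :
  ((\row_i (u i)%:~R) *m \matrix_(i, j) theta i (f j)) 0 j = euler u (f j).
Proof. by rewrite mxE; apply: eq_bigr => i _; rewrite !mxE. Qed.

End Laurent.

(** * The order of dx_1 /\ ... /\ dx_n along a valuation *)

Lemma jacobianE (k : fieldType) n (f : 'I_n -> {fraction {mpoly k[n]}}) :
  jacobian f = \det (\matrix_(i, j) partial i (f j)).
Proof. by []. Qed.

#[local] Opaque jacobian partial.

Section Orders.
Variables (k : fieldType) (n : nat).
Hypothesis char_k : [pchar k] =i pred0.

Notation K := {fraction {mpoly k[n]}}.
Implicit Types a u : 'I_n -> int.

(** The last condition of [prime_divisor]; it carries stability under derivations from [A] to the
    valuation ring. *)
Definition fractions_with_unit_denominators (A : K -> Prop) (v : K -> int) : Prop :=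
  forall f, val_ring v f ->
    exists g h, [/\ A g, A h, h != 0, v h = 0 & f = g / h].

Lemma intr_frac_eq0 (z : int) : (z%:~R == 0 :> K) = (z == 0).
Proof. by rewrite cst_int cst_eq0 char0_intr_eq0. Qed.

Lemma theta_laurent Q i f : laurent Q f -> laurent Q (theta i f : K).
Proof.
case=> l [z [m [Qm ->]]]; exists l, (fun j => z j * (m j i)%:~R), m; split=> //.
rewrite (der_sum (theta_der k i)); apply: eq_bigr => j _.
by rewrite (derM (theta_der k i)) theta_cst mul0r add0r /theta theta_monom cstM -cst_int mulrA.
Qed.

(* On the exponents a of weight <a, u> = 0 the Euler derivation vanishes. *)
Lemma euler_laurent u Q f : laurent Q f ->
  laurent (fun a => Q a /\ dot a u != 0) (euler u f : K).
Proof.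
case=> l [z [m [Qm ->]]].
pose J := [pred j | dot (m j) u != 0].
exists #|J|, (fun j => z (enum_val j) * (dot (m (enum_val j)) u)%:~R), (fun j => m (enum_val j)).
split=> [j|]; first by split; [apply: Qm|apply: (enum_valP j)].
rewrite (der_sum (euler_der k u)) (bigID J) /= [X in _ + X]big1 ?addr0.
  rewrite big_enum_val; apply: eq_bigr => j _.
  by rewrite (derM (euler_der k u)) euler_cst mul0r add0r euler_monom cstM -cst_int mulrA.
move=> j /negPn/eqP d0.
by rewrite (derM (euler_der k u)) euler_cst mul0r add0r euler_monom d0 mul0r mulr0.
Qed.

Section Valuation.
Variable v : K -> int.
Hypothesis v_disc : discrete_valuation v.

Let v_val := disc_val v_disc.
Notation alpha := (weights v).

Lemma val_int (z : int) : z != 0 -> v z%:~R = 0.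
Proof. by move=> z0; rewrite cst_int (val_cst v_disc) // char0_intr_eq0. Qed.

Lemma val_prod_coord : v (\prod_i coord k i) = \sum_i alpha i.
Proof. by rewrite (val_prod v_val) // => i; apply: coord_neq0. Qed.

Lemma prod_coord_neq0 : \prod_i coord k i != 0 :> K.
Proof. by apply/prodf_neq0 => i _; apply: coord_neq0. Qed.

Lemma det_theta_neq0 (f : 'I_n -> K) :
  jacobian f != 0 -> \det (\matrix_(i, j) theta i (f j)) != 0.
Proof. by rewrite jacobian_theta => J0; apply: mulf_neq0 prod_coord_neq0. Qed.

Lemma jacobian_neq0 (f : 'I_n -> K) :
  \det (\matrix_(i, j) theta i (f j)) != 0 -> jacobian f != 0.
Proof. by rewrite jacobian_theta mulf_eq0 => /norP[J0 _]; apply: J0. Qed.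

Lemma val_det_theta (f : 'I_n -> K) : jacobian f != 0 ->
  v (\det (\matrix_(i, j) theta i (f j))) = v (jacobian f) + \sum_i alpha i.
Proof.
move=> J0; rewrite jacobian_theta -val_prod_coord.
exact: (valM v_val J0 prod_coord_neq0).
Qed.

(** The denominators in the quotient rule are units, so no value is lost. *)
Lemma val_ge_der_fractions A c (D : K -> K) :
  (forall f g, D (f + g) = D f + D g) /\ (forall f g, D (f * g) = D f * g + f * D g) ->
  (forall f, A f -> val_ge v 0 f /\ val_ge v c (D f)) ->
  fractions_with_unit_denominators A v ->
  forall f, val_ge v 0 f -> val_ge v c (D f).
Proof.
move=> derD DA frac f /val_ringE/frac[g [h [Ag Ah h0 vh ->]]].
have [vg Dg] := DA _ Ag; have [vh' Dh] := DA _ Ah.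
rewrite (der_div derD) // -[c]addr0; apply: (val_geM v_val); last first.
  by rewrite val_geE ?invr_neq0 ?expf_neq0 // (valV v_val) ?expf_neq0 // (valX v_val) // vh.
apply: (val_geB v_val); rewrite -[c]addr0; first exact: (val_geM v_val).
by rewrite addrC; apply: (val_geM v_val).
Qed.

Lemma val_ge_theta A i :
  (forall f, A f -> laurent (fun a => 0 <= dot a alpha) f) ->
  fractions_with_unit_denominators A v ->
  forall f, val_ge v 0 f -> val_ge v 0 (theta i f).
Proof.
move=> AL frac; apply: val_ge_der_fractions frac; first exact: theta_der.
move=> f /AL fL; split; first by apply: (val_ge_laurent v_disc) fL.
by apply: (val_ge_laurent v_disc) (theta_laurent i fL).
Qed.

(** The Euler derivation kills the monomials of weight 0, and [d] bounds the remaining weights from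
    below. *)
Lemma val_ge_euler A d :
  (forall f, A f -> laurent (fun a => 0 <= dot a alpha) f) ->
  (forall a, 0 < dot a alpha -> d <= dot a alpha) ->
  fractions_with_unit_denominators A v ->
  forall f, val_ge v 0 f -> val_ge v d (euler alpha f).
Proof.
move=> AL dP frac; apply: val_ge_der_fractions frac; first exact: euler_der.
move=> f /AL fL; split; first by apply: (val_ge_laurent v_disc) fL.
apply: (val_ge_laurent v_disc) (euler_laurent alpha fL) => a [a0 ne].
by apply: dP; rewrite lt_def ne.
Qed.

(** By Cramer's rule the unit [alpha l] times the logarithmic Jacobian is a combination of Euler
    derivatives, which lie in the maximal ideal. So [v (jacobian f) + \sum_i alpha i] is at least
    1. *)
Lemma dx_order_upper A l :
  (forall f, A f -> laurent (fun a => 0 <= dot a alpha) f) ->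
  fractions_with_unit_denominators A v ->
  alpha l != 0 -> ~ dx_order_ge v (\sum_i alpha i).
Proof.
move=> AL frac l0 [f [fO J0 vJ]].
have f0 j : val_ge v 0 (f j) by apply/val_ringE.
have : val_ge v 1 ((alpha l)%:~R * \det (\matrix_(i, j) theta i (f j))).
  have := mul_row_det (\row_i (alpha i)%:~R) (\matrix_(i, j) theta i (f j)) l.
  rewrite mxE => ->; apply: (val_ge_sum v_val) => j _; rewrite -[1]addr0.
  apply: (val_geM v_val).
    by rewrite euler_theta; apply: (val_ge_euler AL) (f0 j) => // a; lia.
  by apply: (val_ge_cofactor v_val) => i' j'; rewrite mxE; apply: (val_ge_theta _ AL).
have := det_theta_neq0 J0; move: (val_det_theta J0).
move: (\det _) => P vP P0; have a0 : (alpha l)%:~R != 0 :> K by rewrite intr_frac_eq0.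
rewrite (val_geE _ _ (mulf_neq0 a0 P0)) (valM v_val a0 P0) (val_int l0) vP.
by move: (\sum_i _) vJ => s; lia.
Qed.

Lemma dx_order_upper0 A :
  (forall f, A f -> laurent (fun a => 0 <= dot a alpha) f) ->
  fractions_with_unit_denominators A v ->
  (forall i, alpha i = 0) -> ~ dx_order_ge v 1.
Proof.
move=> AL frac al0 [f [fO J0 vJ]].
have f0 j : val_ge v 0 (f j) by apply/val_ringE.
have : val_ge v 0 (\det (\matrix_(i, j) theta i (f j))).
  by apply: (val_ge_det v_val) => i j; rewrite mxE; apply: (val_ge_theta _ AL).
have := det_theta_neq0 J0; move: (val_det_theta J0).
move: (\det _) => P vP P0; rewrite (val_geE _ _ P0) vP big1 => [|i _]; last exact: al0.
by move: vJ; lia.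
Qed.

Lemma dx_order_ge0 : (forall i, alpha i = 0) -> dx_order_ge v 0.
Proof.
move=> al0; have J1 : jacobian (fun i => coord k i : K) = 1.
  rewrite jacobianE -[RHS](det1 _ n); congr (\det _); apply/matrixP=> i j.
  by rewrite !mxE partial_coord.
exists (fun i => coord k i); rewrite J1 (val1 v_val) oner_neq0; split=> // j.
by right; rewrite -/(alpha j) al0.
Qed.

Section AdaptedMonomials.
Variables (l : 'I_n) (m1 : 'I_n -> int) (d : int).
Hypotheses (al_l : alpha l != 0) (m1d : dot m1 alpha = d) (d_gt0 : 0 < d).

(* For j <> l, the monomials with these exponents and the one with exponent m1
   are algebraically independent. *)
Definition adapted (j : 'I_n) : 'I_n -> int :=
  fun i => alpha l * (i == j)%:Z - alpha j * (i == l)%:Z.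

Lemma dot_adapted j : dot (adapted j) alpha = 0.
Proof. by rewrite dotDl dotNl !dotZl !dot_delta mulrC subrr. Qed.

(** The logarithmic Jacobian of these [n] monomials is a nonzero integer times their product, of
    value [d]; removing the coordinates subtracts [\sum_i alpha i]. *)
Lemma dx_order_lower : dx_order_ge v (\sum_i alpha i - d).
Proof.
pose y j := if j == l then m1 else adapted j.
pose Y : 'M[int]_n := \matrix_(i, j) y j i.
have vy j : v (monom k (y j)) = if j == l then d else 0.
  by rewrite (val_monom v_disc) /y; case: eqP; rewrite // dot_adapted.
have detE : \det (\matrix_(i, j) theta i (monom k (y j))) =
    (\det Y)%:~R * \prod_j monom k (y j) :> K.
  have -> : \prod_j monom k (y j) = \det (diag_mx (\row_j monom k (y j))) :> K.
    by rewrite det_diag; apply: eq_bigr => i _; rewrite mxE.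
  rewrite -det_map_mx -det_mulmx; congr (\det _); apply/matrixP=> i j.
  by rewrite mul_mx_diag !mxE /theta theta_monom.
have detY : (\det Y)%:~R != 0 :> K.
  rewrite -det_map_mx; apply/det0P => -[z z0 zY].
  (* By the adapted columns, a row in the left kernel is proportional to the weights; column [m1]
     then yields [d * z_l = 0]. *)
  have zl j : (alpha l)%:~R * z 0 j = (alpha j)%:~R * z 0 l.
    have [->//|jl] := eqVneq j l.
    have := congr1 (fun A : 'rV_n => A 0 j) zY.
    rewrite !mxE (bigD1 j) //= (bigD1 l) 1?eq_sym //= big1 => [|i /andP[ij il]].
      rewrite !mxE /y (negPf jl) /adapted !eqxx (negPf jl) eq_sym (negPf jl).
      rewrite !(mulr1, mulr0, subr0, sub0r) addr0 mulrNz mulrN => /eqP.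
      by rewrite subr_eq0 ![z 0 _ * _]mulrC => /eqP.
    by rewrite !mxE /y (negPf jl) /adapted (negPf ij) (negPf il) !mulr0.
  have : \sum_j (alpha l)%:~R * (z 0 j * (m1 j)%:~R) = 0 :> K.
    rewrite -mulr_sumr; have := congr1 (fun A : 'rV_n => A 0 l) zY.
    rewrite !mxE => E; rewrite -[RHS](mulr0 (alpha l)%:~R) -[in RHS]E; congr (_ * _).
    by apply: eq_bigr => j _; rewrite !mxE /y eqxx.
  rewrite (eq_bigr (fun j => (m1 j * alpha j)%:~R * z 0 l)) => [|j _].
    rewrite -mulr_suml -rmorph_sum -/(dot m1 alpha) m1d => /eqP.
    rewrite mulf_eq0 intr_frac_eq0 gt_eqF //= => /eqP zl0.
    case/negP: z0; apply/eqP/rowP=> j; rewrite mxE.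
    by have /eqP := zl j; rewrite zl0 mulr0 mulf_eq0 intr_frac_eq0 (negPf al_l) => /eqP.
  by rewrite mulrA zl intrM mulrC mulrA.
have prod0 : \prod_j monom k (y j) != 0 :> K.
  by apply/prodf_neq0 => j _; apply: monom_neq0.
have J0 : jacobian (fun j => monom k (y j) : K) != 0.
  by apply: jacobian_neq0; rewrite detE; exact: (mulf_neq0 detY prod0).
exists (fun j => monom k (y j)); split=> [j||]; last 1 first.
- have := congr1 v detE; rewrite (val_det_theta J0) (valM v_val detY prod0).
  rewrite (val_prod v_val) => [|j]; last exact: monom_neq0.
  rewrite val_int; last by rewrite -intr_frac_eq0; exact: detY.
  have -> : \sum_j v (monom k (y j)) = d.
    rewrite (bigD1 l) //= vy eqxx big1 => [|j /negPf jl]; last by rewrite vy jl.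
    by rewrite addr0.
  by rewrite add0r; move: (v _) (\sum_i _) => x s; lia.
- by right; rewrite vy; case: eqP => _; rewrite // ltW.
- exact: J0.
Qed.

(** With [g] in place of the only monomial of positive weight, a single term is left in Cramer's
    rule, the Euler derivative of [g] times a unit. A value below [d] would give a better
    Jacobian. *)
Lemma euler_stable : ~ dx_order_ge v (\sum_i alpha i - d + 1) ->
  forall g, val_ge v 0 g -> val_ge v d (euler alpha g).
Proof.
move=> not_ge g g0.
pose f j := if j == l then g else monom k (adapted j).
pose M : 'M[K]_n := \matrix_(i, j) theta i (f j).
have detM : (alpha l)%:~R * \det M = euler alpha g * cofactor M l l.
  have := mul_row_det (\row_i (alpha i)%:~R) M l; rewrite mxE => ->.
  rewrite (bigD1 l) //= big1 => [|j jl].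
    by rewrite addr0 euler_theta {1}/f eqxx.
  by rewrite euler_theta {1}/f (negPf jl) euler_monom dot_adapted mul0r mul0r.
(* Outside row [l], the adapted exponents have a single nonzero entry, so the minor is diagonal. *)
have cofE : cofactor M l l = \prod_j ((alpha l)%:~R * monom k (adapted (lift l j))).
  rewrite /cofactor addnn -mul2n exprM sqrrN expr1n expr1n mul1r.
  have -> : row' l (col' l M) =
      diag_mx (\row_j ((alpha l)%:~R * monom k (adapted (lift l j)))).
    apply/matrixP=> i j; rewrite !mxE /f eq_sym (negPf (neq_lift _ _)) /theta theta_monom.
    rewrite /adapted (inj_eq lift_inj) [lift l i == l]eq_sym (negPf (neq_lift _ _)).
    rewrite mulr0 subr0; case: eqP => [->|_]; first by rewrite mulr1 mulr1n.
    by rewrite mulr0 mul0r mulr0n.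
  by rewrite det_diag; apply: eq_bigr => j _; rewrite mxE.
have a0 : (alpha l)%:~R != 0 :> K by rewrite intr_frac_eq0.
have term0 j : (alpha l)%:~R * monom k (adapted (lift l j)) != 0 :> K.
  exact: mulf_neq0 a0 (monom_neq0 _ _).
have cof0 : cofactor M l l != 0 by rewrite cofE; apply/prodf_neq0 => j _; apply: term0.
have vcof : v (cofactor M l l) = 0.
  rewrite cofE (val_prod v_val term0) big1 // => j _.
  by rewrite (valM v_val a0 (monom_neq0 _ _)) (val_int al_l) (val_monom v_disc) dot_adapted.
have [->|Dg0] := eqVneq (euler alpha g) 0; first exact: val_ge0.
rewrite val_geE; last exact: Dg0.
have J0 : jacobian f != 0.
  apply: jacobian_neq0; apply: contraTneq (mulf_neq0 Dg0 cof0) => M0.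
  by rewrite -detM /M M0 mulr0 eqxx.
have M0 : \det M != 0 by apply: det_theta_neq0.
have := congr1 v detM; rewrite (valM v_val a0 M0) (valM v_val Dg0 cof0) (val_int al_l) vcof.
rewrite (val_det_theta J0) => vE.
rewrite leNgt; apply/negP => lt; apply: not_ge; exists f; split=> [j||].
- rewrite /f; case: eqP => _; first exact/val_ringE.
  by right; rewrite (val_monom v_disc) dot_adapted.
- exact: J0.
by move: lt vE; move: (\sum_i _) (v _) (v _) => s x y; lia.
Qed.

(** The Euler derivation preserves the value [d] of its eigenvector [monom k m1], whereas
    [val_ge_der] forces at least [2 * d - 1]. *)
Lemma euler_weight_gcd :
  (forall g, val_ge v 0 g -> val_ge v d (euler alpha g)) -> d = 1.
Proof.
move=> Dd; have [t t0 vt] := uniformizer v_disc.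
have vm : v (monom k m1) = d by rewrite (val_monom v_disc).
have := val_ge_der v_val (euler_der k alpha) vt t0 Dd (f := monom k m1).
have d0 : d%:~R != 0 :> K by rewrite intr_frac_eq0 gt_eqF.
rewrite vm euler_monom m1d val_geE; last exact: mulf_neq0 d0 (monom_neq0 _ _).
rewrite (valM v_val d0 (monom_neq0 _ _)) val_int ?gt_eqF // vm.
by move=> /(_ (ltW d_gt0)); lia.
Qed.

End AdaptedMonomials.

(** Only homogeneous elements are constrained, but this fixes a valuation: a polynomial has the
    value of its part of lowest weight. *)
Definition monomial_valuation (u : 'I_n -> int) : Prop :=
  forall s (f : K), f != 0 -> laurent (fun a => dot a u = s) f -> v f = s.

Lemma euler_homogeneous u s (f : K) : laurent (fun a => dot a u = s) f ->
  euler u f = s%:~R * f.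
Proof.
case=> l [z [m [ms ->]]]; rewrite (der_sum (euler_der k u)) mulr_sumr.
apply: eq_bigr => j _.
by rewrite (derM (euler_der k u)) euler_cst mul0r add0r euler_monom ms mulrCA.
Qed.

(* For f homogeneous of weight s, the unit eps = f / monom (v f * m1) satisfies
   euler eps = (s - v f) * eps, which is in the maximal ideal only if s = v f. *)
Lemma euler_monomial_valuation m1 : dot m1 alpha = 1 ->
  (forall g, val_ge v 0 g -> val_ge v 1 (euler alpha g)) ->
  monomial_valuation alpha.
Proof.
move=> m11 D1 s f f0 fs; pose a i := - v f * m1 i.
have va : v (monom k a) = - v f by rewrite (val_monom v_disc) dotZl m11 mulr1.
have e0 : f * monom k a != 0 by apply: mulf_neq0 (monom_neq0 _ _).
have ve : v (f * monom k a) = 0 by rewrite (valM v_val f0 (monom_neq0 _ _)) va subrr.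
have De : euler alpha (f * monom k a) = (s - v f)%:~R * (f * monom k a).
  rewrite (derM (euler_der k alpha)) (euler_homogeneous fs) euler_monom dotZl m11.
  by rewrite mulr1 intrD mulrDl -mulrA; congr (_ + _); rewrite mulrCA.
apply/eqP; rewrite eq_sym -subr_eq0; apply: contraT => ne.
have := D1 (f * monom k a); rewrite De; move: (f * monom k a) e0 ve => e e0 ve.
rewrite (val_geE _ _ e0) ve lexx => /(_ isT).
have sv0 : (s - v f)%:~R != 0 :> K by rewrite intr_frac_eq0.
by rewrite (val_geE _ _ (mulf_neq0 sv0 e0)) (valM v_val sv0 e0) (val_int ne) ve.
Qed.

(** Replacing the [j]-th coordinate by [g] among the coordinate functions gives the Jacobian
    [partial j g], so a negative value would raise the order. *)
Lemma partial_stable : (forall i, alpha i = 0) -> ~ dx_order_ge v 1 ->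
  forall j g, val_ge v 0 g -> val_ge v 0 (partial j g).
Proof.
move=> al0 not_ge j g g0.
pose f l : K := if l == j then g else coord k l.
have JE : jacobian f = partial j g.
  rewrite jacobianE; have := mul_row_det (delta_mx 0 j) (\matrix_(i, l) partial i (f l)) j.
  rewrite mxE !eqxx mul1r => ->; rewrite -rowE (bigD1 j) //= big1 => [|l lj].
    rewrite !mxE /f eqxx addr0 /cofactor addnn -mul2n exprM sqrrN expr1n expr1n mul1r.
    have -> : row' j (col' j (\matrix_(i, l) partial i (f l))) = 1%:M.
      apply/matrixP=> i l; rewrite !mxE /f eq_sym (negPf (neq_lift _ _)) partial_coord.
      by rewrite (inj_eq lift_inj).
    by rewrite det1 mulr1.
  by rewrite !mxE /f (negPf lj) partial_coord eq_sym (negPf lj) mul0r.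
have [->|D0] := eqVneq (partial j g) 0; first exact: val_ge0.
rewrite val_geE; last exact: D0.
rewrite leNgt; apply/negP => lt; apply: not_ge; exists f; split=> [l||].
- rewrite /f; case: eqP => _; first exact/val_ringE.
  by right; rewrite -/(alpha l) al0.
- by rewrite JE.
- by rewrite JE; lia.
Qed.

End Valuation.
End Orders.

(** * Valuation rings stable under derivations *)

Lemma ex_minimal (T : Type) (P : T -> Prop) (m : T -> nat) :
  (exists x, P x) -> exists2 x, P x & forall y, P y -> (m x <= m y)%N.
Proof.
case=> x; have [N] := ubnP (m x); elim: N x => // N IH x /ltnSE mx Px.
have [[y [Py lt]]|no] := EM (exists y, P y /\ (m y < m x)%N).
  by apply: IH Py; apply: leq_trans mx.
by exists x => // y Py; rewrite leqNgt; apply/negP => lt; apply: no; exists y.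
Qed.

Section Constants.
Variables (K : fieldType) (D : K -> K).
Hypothesis D_der : (forall f g, D (f + g) = D f + D g) /\
  (forall f g, D (f * g) = D f * g + f * D g).

(** Polynomials over the field of constants of [D], kept as polynomials over [K]. *)
Definition constant_coefs (p : {poly K}) : Prop := forall i, D p`_i = 0.

Let D0 := der0 D_der.

Lemma constant_coefsD p q :
  constant_coefs p -> constant_coefs q -> constant_coefs (p + q).
Proof. by move=> Lp Lq i; rewrite coefD (derD D_der) Lp Lq addr0. Qed.

Lemma constant_coefsM p q :
  constant_coefs p -> constant_coefs q -> constant_coefs (p * q).
Proof.
move=> Lp Lq i; rewrite coefM (der_sum D_der) big1 // => j _.
by rewrite (derM D_der) Lp Lq mul0r mulr0 addr0.
Qed.

Lemma constant_coefsC c : D c = 0 -> constant_coefs c%:P.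
Proof. by move=> c0 i; rewrite coefC; case: eqP. Qed.

Lemma constant_coefsX : constant_coefs 'X.
Proof. by move=> i; rewrite coefX; case: eqP => _; rewrite ?(der1 D_der). Qed.

Lemma constant_coefsN p : constant_coefs p -> constant_coefs (- p).
Proof. by move=> Lp i; rewrite coefN (derN D_der) Lp oppr0. Qed.

Lemma constant_coefs_deriv p : constant_coefs p -> constant_coefs p^`().
Proof.
move=> Lp i; rewrite coef_deriv; move: p`_i.+1 (Lp i.+1) => c c0.
by elim: i.+1 => [|m IH]; rewrite ?mulr0n // mulrS (derD D_der) c0 IH addr0.
Qed.

(** A quotient of constants is a constant, so long division never leaves the field of constants. *)
Lemma constant_coefs_edivp p a : constant_coefs p -> constant_coefs a -> p != 0 ->
  exists q r, [/\ constant_coefs q, constant_coefs r, a = q * p + r & (size r < size p)%N].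
Proof.
move=> Lp + p0; have [N] := ubnP (size a); elim: N a => // N IH a /ltnSE aN La.
have [lt|le] := ltnP (size a) (size p).
  by exists 0, a; split=> // [i|]; rewrite ?coef0 ?mul0r ?add0r.
have a0 : a != 0 by rewrite -size_poly_gt0 (leq_trans _ le) // size_poly_gt0.
pose c := lead_coef a / lead_coef p; pose e := (size a - size p)%N.
have Lc : constant_coefs (c%:P * 'X^e).
  apply: constant_coefsM.
    apply: constant_coefsC; rewrite (der_div D_der) ?lead_coef_eq0 //.
    by rewrite !lead_coefE Lp La mul0r mulr0 subrr mul0r.
  by move=> i; rewrite coefXn; case: eqP => _; rewrite ?(der1 D_der).
have [||q [r [Lq Lr aE rp]]] := IH (a - c%:P * 'X^e * p).
- apply: leq_trans aN; have cp0 : c%:P * 'X^e * p != 0.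
    by rewrite !mulf_neq0 ?polyC_eq0 ?mulf_neq0 ?invr_eq0 ?lead_coef_eq0 ?expf_neq0 ?polyX_eq0.
  have sz : size (c%:P * 'X^e * p) = size a.
    rewrite -mulrA mul_polyC size_scale; last first.
      by rewrite mulf_neq0 ?invr_eq0 ?lead_coef_eq0.
    by rewrite mulrC size_mulXn // /e subnK.
  have ld : lead_coef (c%:P * 'X^e * p) = lead_coef a.
    by rewrite !lead_coefM lead_coefC lead_coefXn mulr1 divfK ?lead_coef_eq0.
  rewrite ltnNge; apply/negP => le2.
  have sz2 : size (a - c%:P * 'X^e * p) = size a.
    apply/eqP; rewrite eqn_leq le2 andbT (leq_trans (size_polyD _ _)) //.
    by rewrite size_polyN sz maxnn.
  have : lead_coef (a - c%:P * 'X^e * p) = 0.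
    by rewrite lead_coefE sz2 coefB -{2}sz -!lead_coefE ld subrr.
  move/eqP; rewrite lead_coef_eq0 => /eqP E.
  by move: sz2; rewrite E size_poly0 => /esym/eqP; rewrite size_poly_eq0 (negPf a0).
- by apply: constant_coefsD => //; apply: constant_coefsN; apply: constant_coefsM.
exists (q + c%:P * 'X^e), r; split=> //; first exact: constant_coefsD.
by rewrite mulrDl addrAC -aE subrK.
Qed.

Lemma der_horner p y : constant_coefs p -> D y = 1 -> D p.[y] = p^`().[y].
Proof.
elim/poly_ind: p => [|p c IH] Lp Dy; first by rewrite horner0 linear0 horner0.
have {IH} IH : D p.[y] = p^`().[y].
  by apply: IH => // i; have := Lp i.+1; rewrite coefD coefMX coefC /= addr0.
have c0 : D c = 0 by have := Lp 0%N; rewrite coefD coefMX coefC /= add0r.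
rewrite hornerD hornerMX hornerC (derD D_der) (derM D_der) c0 addr0 IH Dy.
by rewrite derivD derivM derivX derivC addr0 !mulr1 hornerD hornerMX.
Qed.

End Constants.

(* The uniformizer pi = p(y), with p of minimal degree among the polynomials over
   the constants that take a non-unit value at y, divides every such value. *)
Section StableUnderDerivation.
Variables (K : fieldType) (v : K -> int) (D : K -> K) (y g0 : K) (B : K -> Prop).
Hypothesis char_K : [pchar K] =i pred0.
Hypothesis v_val : valuation v.
Hypothesis D_der : (forall f g, D (f + g) = D f + D g) /\
  (forall f g, D (f * g) = D f * g + f * D g).
Hypothesis D_stable : forall f, val_ge v 0 f -> val_ge v 0 (D f).
Hypotheses (y0 : val_ge v 0 y) (Dy : D y = 1).
Hypotheses (g0_neq0 : g0 != 0) (vg0 : v g0 = 1).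
Hypotheses (Dg0_neq0 : D g0 != 0) (vDg0 : v (D g0) = 0).
Hypothesis val_nat : forall m, v m.+1%:R = 0.
Hypothesis fracs : forall f, exists a b, [/\ constant_coefs D a, constant_coefs D b,
  b.[y] != 0 & f = a.[y] / b.[y]].
Hypothesis B_const : forall c, D c = 0 -> B c.
Hypothesis B_y : B y.
Hypothesis B_add : forall f g, B f -> B g -> B (f + g).
Hypothesis B_mul : forall f g, B f -> B g -> B (f * g).
Hypothesis B_div : forall f g, B f -> B g -> g != 0 -> v g = 0 -> B (f / g).

(** In [h = g0 ^ s.+1 * e] with [e] a unit, the term [s.+1 * g0 ^ s * D g0 * e] has value [s], since
    [s.+1] is a unit, and the other term has a larger value. *)
Lemma val_der h : h != 0 -> 0 < v h -> D h != 0 /\ v (D h) = v h - 1.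
Proof.
clear y0 Dy fracs B_const B_y B_add B_mul B_div.
move=> h0 vh; pose s := `|v h|%N.-1.
have vhE : v h = s.+1%:Z by rewrite /s; lia.
have [e [hE e0 ve]] : exists e, [/\ h = g0 ^+ s.+1 * e, e != 0 & v e = 0].
  exists (h / g0 ^+ s.+1); rewrite mulrC divfK ?mulf_neq0 ?invr_eq0 ?expf_neq0 //.
  by split; rewrite // (val_div v_val) ?expf_neq0 // (valX v_val) // vg0 vhE; lia.
have s0 : s.+1%:R != 0 :> K by move/pcharf0P: char_K => ->.
have DhE : D h = g0 ^+ s * D g0 * s.+1%:R * e + g0 ^+ s.+1 * D e.
  by rewrite hE (derM D_der) (derX D_der) mulr_natr.
have m0 : g0 ^+ s * D g0 * s.+1%:R * e != 0 by rewrite !mulf_neq0 ?expf_neq0.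
have vm : v (g0 ^+ s * D g0 * s.+1%:R * e) = s.
  rewrite !(valM v_val) ?mulf_neq0 ?expf_neq0 // (valX v_val) // vg0 vDg0 val_nat ve.
  by rewrite !addr0; lia.
have [] := val_addr v_val (g := g0 ^+ s.+1 * D e) m0; last first.
  by rewrite -DhE vm vhE => -> ->; split=> //; lia.
rewrite vm -[_ + 1]addr0; apply: (val_geM v_val).
  by rewrite val_geE ?expf_neq0 // (valX v_val) // vg0; lia.
by apply: D_stable; rewrite val_geE // ve.
Qed.

(** Otherwise the constant or its inverse would have positive value, hence a nonzero derivative. *)
Lemma val_constant c : c != 0 -> D c = 0 -> v c = 0.
Proof.
clear y0 Dy fracs B_const B_y B_add B_mul B_div.
move=> c0 Dc; have nlt c' : c' != 0 -> D c' = 0 -> ~ (0 < v c').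
  by move=> c'0 Dc' lt; have [] := val_der c'0 lt; rewrite Dc' eqxx.
have := nlt c c0 Dc; have := nlt c^-1 (invr_neq0 c0).
by rewrite (derV D_der) // Dc oppr0 mul0r (valV v_val) // => /(_ erefl); lia.
Qed.

Lemma val_ge_horner a : constant_coefs D a -> val_ge v 0 a.[y].
Proof.
move=> La; rewrite horner_coef; apply: (val_ge_sum v_val) => i _.
rewrite -[0]addr0; apply: (val_geM v_val).
  have [->|a0] := eqVneq a`_i 0; first exact: val_ge0.
  by rewrite val_geE // val_constant.
elim: (nat_of_ord i) => [|m IH]; first by rewrite expr0 val_geE ?oner_neq0 // (val1 v_val).
by rewrite exprS -[0]addr0; apply: (val_geM v_val).
Qed.

Lemma B_horner a : constant_coefs D a -> B a.[y].
Proof.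
move=> La; rewrite horner_coef; elim/big_ind: _ => [||i _].
- by apply: B_const; apply: (der0 D_der).
- exact: B_add.
apply: B_mul; first exact: B_const.
elim: (nat_of_ord i) => [|m IH]; first by apply: B_const; rewrite expr0 (der1 D_der).
by rewrite exprS; apply: B_mul.
Qed.

Lemma val_ring_sub_local f : val_ge v 0 f -> B f.
Proof.
pose P p := [/\ constant_coefs D p, p != 0 & val_ge v 1 p.[y]].
have [p [Lp p0 vp] pmin] : exists2 p, P p & forall q, P q -> (size p <= size q)%N.
  apply: ex_minimal; have [a [b [La Lb b0 g0E]]] := fracs g0.
  have a0 : a.[y] != 0 by apply: contra_neq g0_neq0 => a0; rewrite g0E a0 mul0r.
  exists a; split=> //; first by apply: contra_neq a0 => ->; rewrite horner0.
  have := val_ge_horner Lb; rewrite !val_geE // => vb.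
  by move: vg0; rewrite g0E (val_div v_val) //; lia.
have small q : constant_coefs D q -> val_ge v 1 q.[y] -> (size q < size p)%N -> q = 0.
  move=> Lq vq lt; apply/eqP; apply: contraTT lt => q0; rewrite -leqNgt.
  exact: pmin.
have szp : (1 < size p)%N.
  rewrite ltnNge; apply/negP => /size1_polyC pE; move: p0 vp (Lp 0%N).
  rewrite pE polyC_eq0 hornerC coefC eqxx => c0 + Dc.
  by rewrite val_geE // val_constant.
have p'0 : p^`() != 0.
  rewrite -lead_coef_eq0; apply/eqP => E.
  have := coef_deriv p (size p).-2; rewrite prednK; last by case: (size p) szp => [|[]].
  have -> : p^`()`_(size p).-2 = 0.
    have [->|ne] := eqVneq p^`() 0; first by rewrite coef0.
    by move: E => /eqP; rewrite lead_coef_eq0 (negPf ne).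
  move/esym/eqP; rewrite -mulr_natr mulf_eq0 -/(lead_coef p) lead_coef_eq0 (negPf p0) /=.
  by move/pcharf0P: char_K => ->; case: (size p) szp => [|[]].
have szp' : (size p^`() < size p)%N by rewrite lt_size_deriv.
(* The derivative is nonzero of smaller degree, so by minimality its value at [y] is a unit. As it
   equals [D p.[y]], the value of [p.[y]] is exactly 1. *)
have np' : ~~ val_ge v 1 p^`().[y].
  apply: contra_neqN p'0 => vp'; apply: small => //; exact: constant_coefs_deriv.
have DpE : D p.[y] = p^`().[y] by apply: der_horner.
have py0 : p.[y] != 0.
  by apply: contraNneq np' => E; rewrite -DpE E (der0 D_der) val_ge0.
have vp1 : v p.[y] = 1.
  move: vp; rewrite val_geE // => vp; have [] := val_der py0; first lia.
  rewrite DpE => p'y0 vp'; move: np'; rewrite val_geE // vp'; lia.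
(* The remainder of the division by [p] has smaller degree and a non-unit value at [y], hence
   vanishes. *)
have divp a : constant_coefs D a -> val_ge v 1 a.[y] ->
    exists2 q, constant_coefs D q & a.[y] = q.[y] * p.[y].
  move=> La va; have [q [r [Lq Lr aE rp]]] := constant_coefs_edivp D_der Lp La p0.
  exists q => //; rewrite aE hornerD hornerM (small r) ?horner0 ?addr0 //.
  have -> : r.[y] = a.[y] - q.[y] * p.[y] by rewrite aE hornerD hornerM addrC addKr.
  apply: (val_geB v_val) => //; rewrite -[1]add0r; apply: (val_geM v_val) => //.
  exact: val_ge_horner.
move=> vf; have [a [b [La Lb b0 fE]]] := fracs f.
have := val_ge_horner Lb; rewrite val_geE //.
move=> /gez0_abs /esym; move: `|_|%N => s vb.
(* While the denominator is not a unit, both it and the numerator are divisible by [p.[y]]; each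
   division lowers its value by 1. *)
elim: s a b La Lb b0 fE vb => [|s IH] a b La Lb b0 fE vb.
  by rewrite fE; apply: B_div => //; apply: B_horner.
have [|b' Lb' bE] := divp b Lb; first by rewrite val_geE // vb.
have va : val_ge v 1 a.[y].
  have -> : a.[y] = f * b.[y] by rewrite fE divfK.
  rewrite -[1]add0r; apply: (val_geM v_val) => //; by rewrite val_geE // vb.
have [a' La' aE] := divp a La va.
have b'0 : b'.[y] != 0 by apply: contra_neq b0 => E; rewrite bE E mul0r.
apply: (IH a' b') => //; first by rewrite fE aE bE -mulf_div divff // mulr1.
by apply: (addIr 1); rewrite -[in LHS]vp1 -(valM v_val) // -bE vb -addn1 PoszD.
Qed.

End StableUnderDerivation.

Section StablePolynomials.
Variables (k : fieldType) (n : nat).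
Hypothesis char_k : [pchar k] =i pred0.

Notation K := {fraction {mpoly k[n]}}.
Notation tofrac := (@FracField.tofrac {mpoly k[n]}).

Lemma mderiv_eq0_const (p : {mpoly k[n]}) :
  (forall j, p^`M(j) = 0) -> p = (p@_0)%:MP.
Proof.
move=> p0; apply/mpolyP=> m; rewrite mcoeffC; case: eqP => [->|/eqP m0].
  by rewrite mulr1.
rewrite mulr0; have [j mj] : exists j, m j != 0%N.
  apply/existsP; apply: contraNT m0 => /existsPn mj; apply/eqP/mnmP=> j.
  by rewrite mnmE; apply/eqP; rewrite -[_ == _]negbK mj.
have := mcoeff_deriv j (m - U_(j))%MM p; rewrite p0 mcoeff0 submK; last first.
  by rewrite lep1mP.
move/esym/eqP; rewrite -mulr_natr mulf_eq0; move/pcharf0P: char_k => ->.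
by rewrite orbF => /eqP.
Qed.

Lemma msize_mderiv (p : {mpoly k[n]}) j : p^`M(j) != 0 ->
  (msize p^`M(j) < msize p)%N.
Proof.
move=> D0; have := mlead_supp D0; rewrite mcoeff_msupp mcoeff_deriv => nz.
have : (mlead p^`M(j) + U_(j))%MM \in msupp p.
  by rewrite mcoeff_msupp; apply: contraNneq nz => ->; rewrite mul0rn.
by move/msize_mdeg_lt; rewrite mdegD mdeg1 addn1 mlead_deg.
Qed.

Section Valuation.
Variable v : K -> int.
Hypothesis v_disc : discrete_valuation v.
Let v_val := disc_val v_disc.

Lemma val_ge_mpoly p : (forall i, 0 <= v (coord k i)) -> val_ge v 0 (tofrac p).
Proof.
move=> x0; rewrite -[tofrac p]mulr1 -monom0.
apply: (val_ge_laurent v_disc (Q := fun a => 0 <= dot a (weights v))) => //.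
apply: laurent_shift => m _; apply: sumr_ge0 => i _.
by rewrite /shift addr0 mulr_ge0 //; apply: x0.
Qed.

(** When the coordinates have nonnegative value, this is the local ring of affine space at the
    center of [v]. *)
Definition local_ring (f : K) : Prop := exists g h : {mpoly k[n]},
  [/\ h != 0, v (tofrac h) = 0 & f = tofrac g / tofrac h].

Lemma local_ring_mpoly g : local_ring (tofrac g).
Proof. by exists g, 1; rewrite oner_neq0 tofrac1 (val1 v_val) divr1. Qed.

Lemma local_ringD f g : local_ring f -> local_ring g -> local_ring (f + g).
Proof.
move=> [a [b [b0 vb ->]]] [a' [b' [b'0 vb' ->]]].
have B0 : tofrac b != 0 by rewrite tofrac_eq0.
have B'0 : tofrac b' != 0 by rewrite tofrac_eq0.
exists (a * b' + a' * b), (b * b'); split; first exact: mulf_neq0.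
  by rewrite tofracM (valM v_val B0 B'0) vb vb'.
by rewrite (addf_div _ _ B0 B'0) -!tofracM -tofracD.
Qed.

Lemma local_ringM f g : local_ring f -> local_ring g -> local_ring (f * g).
Proof.
move=> [a [b [b0 vb ->]]] [a' [b' [b'0 vb' ->]]].
have B0 : tofrac b != 0 by rewrite tofrac_eq0.
have B'0 : tofrac b' != 0 by rewrite tofrac_eq0.
exists (a * a'), (b * b'); split; first exact: mulf_neq0.
  by rewrite tofracM (valM v_val B0 B'0) vb vb'.
by rewrite mulf_div -!tofracM.
Qed.

Lemma local_ringV f : local_ring f -> f != 0 -> v f = 0 -> local_ring f^-1.
Proof.
move=> [a [b [b0 vb ->]]] ab0 vab; have B0 : tofrac b != 0 by rewrite tofrac_eq0.
have A0 : tofrac a != 0 by apply: contraNneq ab0 => ->; rewrite mul0r.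
have a0 : a != 0 by rewrite -tofrac_eq0.
exists b, a; split; rewrite ?invf_div //.
by move: vab; rewrite (val_div v_val A0 B0) vb subr0.
Qed.

(** A polynomial [p] of least degree among those of positive value has a nonzero partial derivative,
    which is a unit by minimality; so [p] is a uniformizer. The previous argument then applies to
    [partial j], [y = coord k j] and [g0 = tofrac p]. *)
Lemma stable_local_ring :
  (forall i, 0 <= v (coord k i)) ->
  (forall j g, val_ge v 0 g -> val_ge v 0 (partial j g)) ->
  forall f, val_ge v 0 f -> local_ring f.
Proof.
move=> x0 stable; pose P p := p != 0 /\ 0 < v (tofrac p).
have [p [p0 vp] pmin] : exists2 p, P p & forall q, P q -> (msize p <= msize q)%N.
  apply: ex_minimal; have [t + +] := uniformizer v_disc.
  have [[a b] /= b0 ->] := fracP t => t0 vt.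
  have B0 : tofrac b != 0 by rewrite tofrac_eq0.
  have A0 : tofrac a != 0 by apply: contraNneq t0 => ->; rewrite mul0r.
  exists a; split; first by rewrite -tofrac_eq0.
  have := val_ge_mpoly b x0; rewrite (val_geE _ _ B0).
  by move: vt; rewrite (val_div v_val A0 B0); lia.
have P0 : tofrac p != 0 by rewrite tofrac_eq0.
have [j Dp0] : exists j, p^`M(j) != 0.
  apply/existsP; apply: contraT => /existsPn Dp.
  have pC : p = (p@_0)%:MP by apply: mderiv_eq0_const => j; apply/eqP/negPn/Dp.
  have c0 : p@_0 != 0 by apply: contraNneq p0 => E; rewrite pC E mpolyC0.
  by move: vp; rewrite pC -/(cst n p@_0) (val_cst v_disc c0).
have DP0 : tofrac p^`M(j) != 0 by rewrite tofrac_eq0.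
have vDp : v (tofrac p^`M(j)) = 0.
  apply/eqP; rewrite eq_le -(val_geE _ _ DP0) val_ge_mpoly // andbT leNgt.
  by apply/negP => lt; have := pmin _ (conj Dp0 lt); rewrite leqNgt msize_mderiv.
have DpE : partial j (tofrac p) = tofrac p^`M(j) by apply: partial_tofrac.
have vp1 : v (tofrac p) = 1.
  have [t t0 vt] := uniformizer v_disc.
  have := val_ge_der v_val (partial_der k j) vt t0 (@stable j) (ltW vp).
  by rewrite DpE (val_geE _ _ DP0) vDp; lia.
have xj : partial j (coord k j) = 1 by rewrite partial_coord eqxx.
have horner_mpoly q : exists2 a : {poly K},
    constant_coefs (partial j) a & tofrac q = a.[coord k j].
  rewrite (mpolyE q) rmorph_sum.
  apply: (big_ind (fun f => exists2 a, constant_coefs (partial j) a & f = a.[coord k j])).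
  - exists 0; last by rewrite horner0.
    by move=> i; rewrite coef0 (der0 (partial_der k j)).
  - move=> f g [a La ->] [b Lb ->]; exists (a + b); last by rewrite hornerD.
    exact: (constant_coefsD (partial_der k j)).
  move=> m _; exists ((cst n q@_m * \prod_(i | i != j) coord k i ^+ m i)%:P * 'X^(m j)).
    apply: (constant_coefsM (partial_der k j)); last first.
      elim: (m j) => [|e IH].
        move=> i; rewrite coef1; case: eqP => _.
          exact: (der1 (partial_der k j)).
        exact: (der0 (partial_der k j)).
      rewrite exprS; apply: (constant_coefsM (partial_der k j)) => //.
      exact: (constant_coefsX (partial_der k j)).
    apply: (constant_coefsC (partial_der k j)).
    rewrite (derM (partial_der k j)) partial_cst mul0r add0r.
    suff -> : partial j (\prod_(i | i != j) coord k i ^+ m i) = 0 :> K by rewrite mulr0.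
    apply: (big_ind (fun f => partial j f = 0)) => [|f g Df Dg|i ij].
    - exact: (der1 (partial_der k j)).
    - by rewrite (derM (partial_der k j)) Df Dg mul0r mulr0 addr0.
    by rewrite (derX (partial_der k j)) partial_coord eq_sym (negPf ij) mulr0 mul0rn.
  rewrite hornerM hornerC hornerXn /= -mul_mpolyC tofracM mpolyXE_id rmorph_prod /=.
  rewrite (bigD1 j) //= tofracXn -mulrA; congr (_ * _).
  by rewrite mulrC; congr (_ * _); apply: eq_bigr => i _; rewrite tofracXn.
have char_K : [pchar K] =i pred0.
  by apply/pcharf0P => m; rewrite -[m%:R]/(m%:~R) intr_frac_eq0.
have val_nat m : v m.+1%:R = 0 by apply: (val_int char_k v_disc (z := m.+1)).
have DP0' : partial j (tofrac p) != 0 by rewrite DpE.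
have vDp' : v (partial j (tofrac p)) = 0 by rewrite DpE.
have xj0 : val_ge v 0 (coord k j) by rewrite (val_geE _ _ (coord_neq0 _ _)) x0.
apply: (val_ring_sub_local char_K v_val (partial_der k j) (stable j) xj0 xj P0 vp1
  DP0' vDp' val_nat).
- move=> f; have [[a b] /= b0 ->] := fracP f.
  have [pa La aE] := horner_mpoly a; have [pb Lb bE] := horner_mpoly b.
  by exists pa, pb; rewrite -aE -bE tofrac_eq0.
(* For [c = a / b] with [b] of least degree, differentiating [a = c * b] gives [c = a' / b'] with a
   smaller denominator unless [b' = 0]. So [b] is killed by the derivation, hence a unit. *)
- move=> c Dc; pose P' (b : {mpoly k[n]}) := b != 0 /\ exists a, c = tofrac a / tofrac b.
  have [b [b0 [a cE]] bmin] : exists2 b, P' b & forall q, P' q -> (msize b <= msize q)%N.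
    apply: ex_minimal; have [[a b] /= b0 cE] := fracP c.
    by exists b; split=> //; exists a.
  have B0 : tofrac b != 0 by rewrite tofrac_eq0.
  have aE : tofrac a = c * tofrac b by rewrite cE divfK.
  have Da : tofrac a^`M(j) = c * tofrac b^`M(j).
    by rewrite -!partial_tofrac aE (derM (partial_der k j)) Dc mul0r add0r.
  have Db : b^`M(j) = 0.
    apply/eqP; apply: contraT => Db0; have := msize_mderiv Db0.
    rewrite ltnNge bmin //; split=> //; exists a^`M(j).
    have DB0 : tofrac b^`M(j) != 0 by rewrite tofrac_eq0.
    by rewrite Da; exact: (esym (mulfK DB0 c)).
  exists a, b; split=> //.
  apply: (val_constant char_K v_val (partial_der k j) (stable j) P0 vp1 DP0' vDp' val_nat B0).
  by rewrite partial_tofrac Db tofrac0.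
- exact: local_ring_mpoly.
- exact: local_ringD.
- exact: local_ringM.
- move=> f g Bf Bg g0 vg; apply: local_ringM => //; exact: local_ringV.
Qed.

End Valuation.
End StablePolynomials.

(** * Monomial valuations *)

Section MonomialValuations.
Variables (k : fieldType) (n : nat) (u : 'I_n -> int).

Notation K := {fraction {mpoly k[n]}}.
Notation tofrac := (@FracField.tofrac {mpoly k[n]}).
Implicit Types (p q : {mpoly k[n]}) (m : 'X_{1..n}).

Definition weight m : int := dot (fun i => (m i)%:Z) u.

Lemma weightD m m' : weight (m + m')%MM = weight m + weight m'.
Proof. by rewrite -dotDl; congr dot; apply: funext => i; rewrite mnmDE PoszD. Qed.

Lemma dot_shift C m : dot (shift C m) u = weight m + dot C u.
Proof. by rewrite dotDl. Qed.

Definition min_weight p (s : int) : Prop :=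
  (forall m, m \in msupp p -> s <= weight m) /\ exists2 m, m \in msupp p & weight m = s.

Lemma min_weight_uniq p s s' : min_weight p s -> min_weight p s' -> s = s'.
Proof.
move=> [ge [m mp ms]] [ge' [m' m'p ms']]; apply/eqP.
by rewrite eq_le -{1}ms' ge // -{1}ms ge'.
Qed.

Lemma min_weight_exists p : p != 0 -> exists s, min_weight p s.
Proof.
rewrite -msupp_eq0 => p0; suff H (l : seq 'X_{1..n}) : l != [::] ->
    exists2 m, m \in l & forall m', m' \in l -> weight m <= weight m'.
  have [m mp mmin] := H _ p0.
  by exists (weight m); split=> //; exists m.
elim: l => // m [|m1 l] IH _.
  by exists m => [|m']; rewrite inE // => /eqP->.
have [//|m' m'l m'min] := IH.
have [le|lt] := leP (weight m) (weight m').
  exists m => [|m2]; rewrite inE ?eqxx // => /orP[/eqP->//|/m'min].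
  exact: le_trans.
exists m' => [|m2]; rewrite inE ?m'l ?orbT // => /orP[/eqP->|/m'min//].
exact: ltW.
Qed.

Lemma min_weight_split p s : min_weight p s -> exists p0 p1,
  [/\ p = p0 + p1, p0 != 0, forall m, m \in msupp p0 -> weight m = s
    & forall m, m \in msupp p1 -> s + 1 <= weight m].
Proof.
move=> [ge [m mp ms]].
have [p0 [p1 [pE p0P p1P]]] := mpoly_split (fun m => weight m == s) p.
exists p0, p1; split=> // [|m' /p0P[_ /eqP]//|m' /p1P[m'p ne]].
  apply/eqP => p00; move: mp; rewrite pE p00 add0r => /p1P[_].
  by rewrite ms eqxx.
by have := ge _ m'p; move: ne; move: (weight m') => w; lia.
Qed.

(** The parts of least weight have a nonzero product, and all other products have larger weight, so
    the leading monomial of [p0 * q0] survives. *)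
Lemma min_weight_mul p q s t :
  min_weight p s -> min_weight q t -> min_weight (p * q) (s + t).
Proof.
move=> ps qt; have supp p' q' (x y : int) : (forall m, m \in msupp p' -> x <= weight m) ->
    (forall m, m \in msupp q' -> y <= weight m) ->
    forall m, m \in msupp (p' * q') -> x + y <= weight m.
  move=> xp yq m /msuppM_le/allpairsP[[m1 m2] /= [m1p m2q ->]].
  by rewrite weightD lerD ?xp ?yq.
split; first by apply: supp; [case: ps|case: qt].
have [p0 [p1 [pE p00 p0P p1P]]] := min_weight_split ps.
have [q0 [q1 [qE q00 q0P q1P]]] := min_weight_split qt.
have pq0 : p0 * q0 != 0 by rewrite mulf_neq0.
have mP := mlead_supp pq0; set m := mlead _ in mP.
have mst : weight m = s + t.
  have /msuppM_le/allpairsP[[m1 m2] /= [m1p m2q ->]] := mP.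
  by rewrite weightD p0P ?q0P.
exists m => //.
rewrite pE qE mulrDl mulrDr mcoeff_msupp -addrA mcoeffD.
have -> : (p0 * q1 + p1 * (q0 + q1))@_m = 0.
  rewrite mcoeffD; have /memN_msupp_eq0-> : m \notin msupp (p0 * q1).
    apply/negP => /(supp _ _ s (t + 1)); rewrite mst => H.
    have p0w m' : m' \in msupp p0 -> s <= weight m' by move/p0P->.
    by have := H p0w q1P; lia.
  have /memN_msupp_eq0-> : m \notin msupp (p1 * (q0 + q1)).
    apply/negP => /(supp _ _ (s + 1) t p1P); rewrite mst -qE => H.
    by have := H (proj1 qt); lia.
  by rewrite addr0.
by rewrite addr0 -mcoeff_msupp.
Qed.

(** The value is the least weight of the numerator minus that of the denominator. The relation [R]
    leaves the value at 0 free. *)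
Lemma monomial_valuation_exists :
  exists2 v : K -> int, valuation v & monomial_valuation v u.
Proof.
pose R f s := f != 0 :> K -> exists p q a b,
  [/\ q != 0, f = tofrac p / tofrac q, min_weight p a, min_weight q b & s = a - b].
have /choice[v vP] : forall f, exists s, R f s.
  move=> f; have [->|f0] := eqVneq f 0.
    by exists 0 => /eqP.
  have [[p q] /= q0 fE] := fracP f.
  have p0 : p != 0 by apply: contraNneq f0 => p0; rewrite fE p0 tofrac0 mul0r.
  have [a pa] := min_weight_exists p0; have [b qb] := min_weight_exists q0.
  by exists (a - b) => _; exists p, q, a, b.
have vE p q a b : q != 0 -> min_weight p a -> min_weight q b ->
    v (tofrac p / tofrac q) = a - b.
  move=> q0 pa qb; have Q0 : tofrac q != 0 by rewrite tofrac_eq0.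
  have p0 : p != 0.
    by case: pa => _ [m + _]; apply: contraTneq => ->; rewrite msupp0.
  have P0 : tofrac p != 0 by rewrite tofrac_eq0.
  have pq0 : tofrac p / tofrac q != 0 := mulf_neq0 P0 (invr_neq0 Q0).
  have [p' [q' [a' [b' [q'0 eqf p'a q'b ->]]]]] := vP _ pq0.
  have Q'0 : tofrac q' != 0 by rewrite tofrac_eq0.
  have eqp : p * q' = p' * q.
    by move/eqP: eqf; rewrite (eqr_div _ _ Q0 Q'0) -!tofracM tofrac_eq => /eqP.
  have := min_weight_mul pa q'b; rewrite eqp => /min_weight_uniq/(_ (min_weight_mul p'a qb)).
  lia.
exists v.
  split=> f g f0 g0.
    have [p [q [a [b [q0 fE pa qb ->]]]]] := vP _ f0.
    have [p' [q' [a' [b' [q'0 gE p'a q'b ->]]]]] := vP _ g0.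
    rewrite fE gE mulf_div -!tofracM (vE _ _ _ _ (mulf_neq0 q0 q'0)
      (min_weight_mul pa p'a) (min_weight_mul qb q'b)).
    lia.
  move=> fg0.
  have [p [q [a [b [q0 fE pa qb ->]]]]] := vP _ f0.
  have [p' [q' [a' [b' [q'0 gE p'a q'b ->]]]]] := vP _ g0.
  have Q0 : tofrac q != 0 by rewrite tofrac_eq0.
  have Q'0 : tofrac q' != 0 by rewrite tofrac_eq0.
  have fgE : f + g = tofrac (p * q' + p' * q) / tofrac (q * q').
    by rewrite fE gE (addf_div _ _ Q0 Q'0) tofracD !tofracM.
  have s0 : p * q' + p' * q != 0.
    by apply: contraNneq fg0 => s0; rewrite fgE s0 tofrac0 mul0r.
  have [c sc] := min_weight_exists s0.
  rewrite fgE (vE _ _ _ _ (mulf_neq0 q0 q'0) sc (min_weight_mul qb q'b)).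
  have [_ [m + mc]] := sc; move/msuppD_le; rewrite mem_cat => /orP[].
    by move/(proj1 (min_weight_mul pa q'b)); rewrite mc; lia.
  by move/(proj1 (min_weight_mul p'a qb)); rewrite mc; lia.
move=> s f f0 /laurentP[p [C [fE pC]]].
(* Positive and negative parts of [C], so that [monom k C] is a fraction of two monomials. *)
pose m1 : 'X_{1..n} := [multinom if (0 <= C i)%R then `|C i|%N else 0%N | i < n].
pose m2 : 'X_{1..n} := [multinom if (0 <= C i)%R then 0%N else `|C i|%N | i < n].
have CE : C = fun i => (m1 i)%:Z + - (m2 i)%:Z.
  by apply: funext => i; rewrite !mnmE; case: ifP; lia.
have {}fE : f = tofrac (p * 'X_[m1]) / tofrac 'X_[m2].
  by rewrite fE CE monomD monomV !monom_mnm tofracM mulrA.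
have minX m : min_weight 'X_[m] (weight m).
  split=> [m'|]; first by move=> /mem_msuppXP->.
  by exists m => //; apply/mem_msuppXP.
have p0 : p != 0 by apply: contraNneq f0 => p0; rewrite fE p0 mul0r tofrac0 mul0r.
have pw : min_weight p (s - dot C u).
  have wE m : m \in msupp p -> weight m = s - dot C u.
    by move/pC; rewrite dot_shift => <-; rewrite addrK.
  split=> [m /wE->//|]; exists (mlead p); first exact: mlead_supp.
  exact/wE/mlead_supp.
have X0 : 'X_[m2] != 0 :> {mpoly k[n]} by rewrite -msupp_eq0 msuppX.
rewrite fE (vE _ _ _ _ X0 (min_weight_mul pw (minX m1)) (minX m2)).
have -> : dot C u = weight m1 - weight m2 by rewrite CE dotDl dotNl.
lia.
Qed.

Variable v : K -> int.
Hypotheses (v_val : valuation v) (v_mon : monomial_valuation v u).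

Lemma monomial_val_monom a : v (monom k a) = dot a u.
Proof. by apply: v_mon; [apply: monom_neq0|apply: laurent_monom]. Qed.

Lemma monomial_val_cst (a : k) : a != 0 -> v (cst n a) = 0.
Proof.
move=> a0; apply: v_mon; first by rewrite cst_eq0.
exists 1%N, (fun=> a), (fun=> fun=> 0); split=> [_|].
  by rewrite /dot big1 // => i _; rewrite mul0r.
by rewrite big_ord1 monom0 mulr1.
Qed.

Lemma monomial_val_ge s f :
  laurent (fun a => s <= dot a u) f -> val_ge v s f.
Proof.
move=> [l [z [m [Qm ->]]]]; apply: (val_ge_sum v_val) => j _.
have [->|z0] := eqVneq (z j) 0; first by rewrite /cst mpolyC0 tofrac0 mul0r val_ge0.
have c0 : cst n (z j) != 0 by rewrite cst_eq0.
rewrite (val_geE _ _ (mulf_neq0 c0 (monom_neq0 _ _))).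
by rewrite (valM v_val c0 (monom_neq0 _ _)) monomial_val_cst // monomial_val_monom add0r.
Qed.

Lemma monomial_weights : weights v = u.
Proof.
by apply: funext => i; rewrite /weights -monom_coord monomial_val_monom dot_delta.
Qed.

Lemma monomial_discrete (a : 'I_n -> int) : dot a u = 1 -> discrete_valuation v.
Proof.
move=> a1; case: v_val => vM vD; split=> //; first exact: monomial_val_cst.
by exists (monom k a); [apply: monom_neq0|rewrite monomial_val_monom].
Qed.

Lemma monomial_val_mpoly p s : min_weight p s ->
  tofrac p != 0 /\ v (tofrac p) = s.
Proof.
move=> /min_weight_split[p0 [p1 [-> p00 p0P p1P]]]; rewrite tofracD.
have P00 : tofrac p0 != 0 by rewrite tofrac_eq0.
have lau Q q : (forall m, m \in msupp q -> Q (fun i => (m i)%:Z)) -> laurent Q (tofrac q).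
  move=> qQ; rewrite -[tofrac q]mulr1 -monom0; apply: laurent_shift => m mq.
  have -> : shift (fun=> 0) m = (fun i => (m i)%:Z) by apply: funext => i; rewrite /shift addr0.
  exact: qQ.
have vs : v (tofrac p0) = s by apply: (v_mon P00); apply: lau => m /p0P.
have := val_addr v_val (g := tofrac p1) P00; rewrite vs; apply.
by apply: monomial_val_ge; apply: lau => m /p1P.
Qed.

End MonomialValuations.

(** * Affine toric charts *)

(** [d] is the gcd of the entries, found as the least positive value of [dot m u]; a nonzero
    remainder on division by [d] would be a smaller one. *)
Lemma primitive_multiple n (u : 'I_n -> int) (l : 'I_n) : u l != 0 ->
  exists d u' m, [/\ 0 < d, dot m u = d & forall i, u i = d * u' i].
Proof.
move=> ul; have [m m0 mmin] : exists2 m, 0 < dot m u &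
    forall m', 0 < dot m' u -> (`|dot m u| <= `|dot m' u|)%N.
  apply: ex_minimal; have [pos|neg] := ltP 0 (u l).
    by exists (fun j => (j == l)%:Z); rewrite dot_delta.
  exists (fun j => - (j == l)%:Z); rewrite dotNl dot_delta; lia.
suff /choice[u' uE] : forall i, exists q, u i = dot m u * q by exists (dot m u), u', m.
move=> i; have [q [r [uE r0 rd]]] : exists q r, [/\ u i = q * dot m u + r, 0 <= r & r < dot m u].
  exists (u i %/ dot m u)%Z, (u i %% dot m u)%Z.
  by rewrite -divz_eq modz_ge0 ?gt_eqF // ltz_pmod.
exists q; have := mmin (fun j => (j == i)%:Z + - (q * m j)).
rewrite dotDl dotNl dotZl dot_delta {}uE addrAC subrr add0r mulrC.
move: (dot m u) m0 rd => d d0 rd min; have [r_pos|] := ltP 0 r; last by lia.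
by have := min r_pos; lia.
Qed.

Section Cones.
Variables (k : fieldType) (n : nat).
Hypothesis char_k : [pchar k] =i pred0.
Variables (T : finType) (beta : T -> 'I_n -> int) (F : pred T).

Notation K := {fraction {mpoly k[n]}}.
Notation tofrac := (@FracField.tofrac {mpoly k[n]}).

Definition in_dual (a : 'I_n -> int) : Prop := forall t, F t -> 0 <= dot a (beta t).

Definition cone_ring : K -> Prop := laurent in_dual.

Definition in_cone (u : 'I_n -> int) : Prop := exists lam : T -> rat,
  [/\ forall t, 0 <= lam t, forall t, ~~ F t -> lam t = 0
    & forall i, (u i)%:~R = \sum_t lam t * (beta t i)%:~R].

Lemma dot_cone u lam a : (forall i, (u i)%:~R = \sum_t lam t * (beta t i)%:~R :> rat) ->
  (dot a u)%:~R = \sum_t lam t * (dot a (beta t))%:~R :> rat.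
Proof.
move=> uE; rewrite rmorph_sum /=.
rewrite (eq_bigr (fun i => \sum_t lam t * ((a i)%:~R * (beta t i)%:~R))).
  rewrite exchange_big; apply: eq_bigr => t _.
  by rewrite -mulr_sumr rmorph_sum /=; congr (_ * _); apply: eq_bigr => i _; rewrite intrM.
move=> i _; rewrite intrM uE mulr_sumr; apply: eq_bigr => t _.
by rewrite mulrCA.
Qed.

(* Multiplying numerator and denominator by a high power of monom m0 brings their
   exponents into the dual cone. *)
Lemma localize (v : K -> int) (u : 'I_n -> int) p q a1 m0 :
  valuation v -> (forall a, v (monom k a) = dot a u) ->
  q != 0 -> v (tofrac q) + dot a1 u = 0 -> dot m0 u = 0 -> in_dual m0 ->
  (forall m t, m \in msupp p ++ msupp q -> F t ->
    0 < dot m0 (beta t) \/ 0 <= dot (shift a1 m) (beta t)) ->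
  exists g h, [/\ cone_ring g, cone_ring h, h != 0, v h = 0 & tofrac p / tofrac q = g / h].
Proof.
move=> v_val v_mon q0 vq m0u m0_dual pos.
have Q0 : tofrac q != 0 by rewrite tofrac_eq0.
pose N : int := \sum_(m <- msupp p ++ msupp q) \sum_t `|dot (shift a1 m) (beta t)|.
pose a i := a1 i + N * m0 i.
have aP m : m \in msupp p ++ msupp q -> in_dual (shift a m).
  move=> mpq t Ft; have -> : dot (shift a m) (beta t) =
      dot (shift a1 m) (beta t) + N * dot m0 (beta t).
    by rewrite -dotZl -dotDl; congr dot; apply: funext => i; rewrite /shift addrA.
  have N_ge0 : 0 <= N by apply: sumr_ge0 => *; apply: sumr_ge0.
  have [gt0|ge0] := pos _ _ mpq Ft; last by rewrite addr_ge0 ?mulr_ge0 ?m0_dual.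
  have : `|dot (shift a1 m) (beta t)| <= N.
    rewrite /N (big_rem m) //= (bigD1 t) //= -addrA lerDl addr_ge0 //.
      exact: sumr_ge0.
    by apply: sumr_ge0 => *; apply: sumr_ge0.
  have : N <= N * dot m0 (beta t) by rewrite ler_peMr.
  by move: (dot _ _) (N * _) => x y; lia.
have A0 := monom_neq0 k a.
exists (tofrac p * monom k a), (tofrac q * monom k a); split.
- by apply: laurent_shift => m mp; apply: aP; rewrite mem_cat mp.
- by apply: laurent_shift => m mq; apply: aP; rewrite mem_cat mq orbT.
- exact: (mulf_neq0 Q0 A0).
- by rewrite (valM v_val Q0 A0) v_mon /a dotDl dotZl m0u mulr0 addr0.
by rewrite -mulf_div (divff A0) mulr1.
Qed.

Lemma cone_ring_one : cone_ring 1.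
Proof.
rewrite -monom0; apply: laurent_monom => t _.
by rewrite /dot big1 // => i _; rewrite mul0r.
Qed.

Lemma cone_ring_zero : cone_ring 0.
Proof.
exists 0%N, (fun=> 0), (fun=> fun=> 0); split; first by case.
by rewrite big_ord0.
Qed.

(** The monomial of exponent [m0] is a unit at [v], and inverting it removes from the chart every
    ray other than [u]. *)
Lemma monomial_localization (v : K -> int) (u m0 : 'I_n -> int) :
  valuation v -> monomial_valuation v u -> dot m0 u = 0 -> in_dual m0 ->
  (forall t, F t -> 0 < dot m0 (beta t) \/ beta t = u) ->
  fractions_with_unit_denominators cone_ring v.
Proof.
move=> v_val v_mon m0u m0_dual pos f fO.
have [->|f0] := eqVneq f 0.
  exists 0, 1; split; [exact: cone_ring_zero|exact: cone_ring_one|exact: oner_neq0| |].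
    exact: val1.
  by rewrite mul0r.
have [[p q] /= q0 fE] := fracP f.
have p0 : p != 0 by apply: contraNneq f0 => p0; rewrite fE p0 tofrac0 mul0r.
have [s ps] := min_weight_exists u p0; have [s' qs'] := min_weight_exists u q0.
have [P0 vp] := monomial_val_mpoly v_val v_mon ps.
have [Q0 vq] := monomial_val_mpoly v_val v_mon qs'.
have ss' : s' <= s.
  move: fO => /val_ringE; rewrite (val_geE _ _ f0) fE (val_div v_val P0 Q0) vp vq.
  lia.
have [_ [mq mqq mqs]] := qs'; rewrite fE.
(* Dividing by a monomial of least weight in the denominator makes the denominator a unit. *)
apply: (localize (a1 := fun i => - (mq i)%:Z) v_val (monomial_val_monom v_mon) q0 _ m0u m0_dual).
  by rewrite vq dotNl -/(weight u mq) mqs subrr.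
move=> m t mpq Ft; have [|->] := pos t Ft; first by left.
right; rewrite dot_shift dotNl -/(weight u mq) mqs subr_ge0.
move: mpq; rewrite mem_cat => /orP[/(proj1 ps)|/(proj1 qs')] //.
exact: le_trans.
Qed.

(** As all weights vanish, a monomial that is positive on every ray is still a unit at [v];
    inverting it leaves the torus, where every polynomial is regular. *)
Lemma local_ring_localization (v : K -> int) (m0 : 'I_n -> int) :
  discrete_valuation v -> (forall i, weights v i = 0) ->
  (forall f, val_ge v 0 f -> local_ring v f) ->
  (forall t, F t -> 0 < dot m0 (beta t)) ->
  fractions_with_unit_denominators cone_ring v.
Proof.
move=> v_disc w0 local m0_pos f /val_ringE/local[p [q [q0 vq ->]]].
have dot0 a : dot a (weights v) = 0 by rewrite /dot big1 // => i _; rewrite w0 mulr0.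
apply: (localize (a1 := fun=> 0) (m0 := m0) (disc_val v_disc) (val_monom v_disc) q0).
- by rewrite vq dot0.
- exact: dot0.
- by move=> t Ft; apply/ltW/m0_pos.
- by move=> m t _ Ft; left; apply: m0_pos.
Qed.

Lemma cone_ring_weights (w : K -> int) f : discrete_valuation w ->
  centered cone_ring w -> cone_ring f -> laurent (fun a => 0 <= dot a (weights w)) f.
Proof.
move=> w_disc cent; apply: laurentW => a a_dual; rewrite -(val_monom w_disc).
have : val_ge w 0 (monom k a) by apply/val_ringE/cent/laurent_monom.
by rewrite (val_geE _ _ (monom_neq0 _ _)).
Qed.

(* Otherwise some unit monom m of the valuation ring has negative order along
   beta t, and it is no quotient g / h of elements of the cone ring with w h = 0:
   all the exponents of h = g / monom m would be positive on beta t, hence on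
   the weights of w. *)
Lemma prime_divisor_weights (w : K -> int) lam :
  discrete_valuation w -> fractions_with_unit_denominators cone_ring w ->
  (forall t, 0 <= lam t) -> (forall t, ~~ F t -> lam t = 0) ->
  (forall i, (weights w i)%:~R = \sum_t lam t * (beta t i)%:~R :> rat) ->
  forall t m, 0 < lam t -> dot m (weights w) = 0 -> dot m (beta t) = 0.
Proof.
move=> w_disc frac lam_ge0 lamF wE t m lam_t.
have Ft : F t by apply: contraLR lam_t => /lamF->; rewrite ltxx.
suff H m1 : dot m1 (weights w) = 0 -> 0 <= dot m1 (beta t).
  move=> m0; apply/eqP; rewrite eq_le H // andbT -oppr_ge0 -dotNl H // dotNl m0.
  by rewrite oppr0.
move=> m10; rewrite leNgt; apply/negP => lt.
have M0 := monom_neq0 k m1.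
have [g [h [Ag Ah h0 wh mE]]] : exists g h, [/\ cone_ring g, cone_ring h, h != 0, w h = 0 &
    monom k m1 = g / h].
  by apply: frac; right; rewrite (val_monom w_disc) m10.
have gE : g = h * monom k m1 by rewrite mE mulrC divfK.
have [v v_val v_mon] := monomial_valuation_exists k (beta t).
have vh : 1 <= v h.
  have : val_ge v 0 g.
    by apply: (monomial_val_ge v_val v_mon); apply: laurentW Ag => a; apply.
  rewrite gE (val_geE _ _ (mulf_neq0 h0 M0)) (valM v_val h0 M0).
  by rewrite (monomial_val_monom v_mon); move: lt; lia.
have [p [C [hE pC]]] := laurentP Ah.
have [p0 [p1 [pE p0P p1P]]] := mpoly_split (fun m => dot (shift C m) (beta t) == 0) p.
have C0 := monom_neq0 k C.
have p1_dual m' : m' \in msupp p1 -> in_dual (shift C m') /\ 1 <= dot (shift C m') (beta t).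
  move=> /p1P[/pC d ne]; split=> //; have := d t Ft; move: ne.
  by move: (dot _ _) => x; lia.
have p00 : p0 = 0.
  apply/eqP; apply: contraT => p00; have P0 : tofrac p0 != 0 by rewrite tofrac_eq0.
  have PC0 := mulf_neq0 P0 C0.
  have v0 : v (tofrac p0 * monom k C) = 0.
    by apply: (v_mon _ _ PC0); apply: laurent_shift => m' /p0P[_ /eqP].
  have [|_] := val_addr v_val (g := tofrac p1 * monom k C) PC0.
    rewrite v0 add0r; apply: (monomial_val_ge v_val v_mon).
    by apply: laurent_shift => m' /p1_dual[].
  by rewrite -mulrDl -tofracD -pE -hE v0; move: vh; lia.
have : val_ge w 1 h.
  rewrite hE pE p00 add0r; apply: (val_ge_laurent w_disc (Q := fun a =>
    in_dual a /\ 1 <= dot a (beta t))); last exact: laurent_shift.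
  move=> a [a_dual a_t]; rewrite -gtz0_ge1 -(ltr0z rat) (dot_cone _ wE) (bigD1 t) //=.
  apply: ltr_wpDr; last by rewrite mulr_gt0 // ltr0z gtz0_ge1.
  apply: sumr_ge0 => t' _; have [Ft'|/lamF->] := boolP (F t'); last by rewrite mul0r.
  by rewrite mulr_ge0 // ler0z a_dual.
by rewrite (val_geE _ _ h0) wh.
Qed.

(** The valuation ring is a localization of the chart ring, on which Euler derivatives have at least
    the gcd [d] of the weights as value. This forces [d = 1], and then the lower and upper bounds on
    the order meet. *)
Lemma prime_divisor_order (w : K -> int) (l : 'I_n) :
  prime_divisor cone_ring w -> weights w l != 0 ->
  dx_order w (\sum_i weights w i - 1) /\
  exists m, dot m (weights w) = 1.
Proof.
move=> [w_disc cent frac] wl.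
have AL f : cone_ring f -> laurent (fun a => 0 <= dot a (weights w)) f.
  exact: cone_ring_weights.
have [d [u' [m [d0 md wd]]]] := primitive_multiple wl.
have d1 : d = 1.
  apply: (euler_weight_gcd char_k w_disc wl md d0).
  apply: (val_ge_euler w_disc AL) frac => a.
  have -> : weights w = (fun i => d * u' i) by apply: funext.
  rewrite dotZr pmulr_rgt0 // => a0; by rewrite -[leLHS]mulr1 ler_pM2l.
split; last by exists m; rewrite md.
split; last by rewrite subrK; apply: dx_order_upper AL frac wl.
by rewrite -d1; apply: (dx_order_lower char_k w_disc wl md d0).
Qed.

Lemma prime_divisor_order0 (w : K -> int) :
  prime_divisor cone_ring w -> (forall i, weights w i = 0) -> dx_order w 0.
Proof.
move=> [w_disc cent frac] w0; split; first exact: dx_order_ge0.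
rewrite add0r; apply: dx_order_upper0 frac w0 => //.
by move=> f; apply: cone_ring_weights.
Qed.

Lemma centered_in_cone (v : K -> int) : discrete_valuation v ->
  centered cone_ring v ->
  (forall u, (forall a, in_dual a -> 0 <= dot a u) -> in_cone u) -> in_cone (weights v).
Proof.
move=> v_disc cent farkas; apply: farkas => a a_dual; rewrite -(val_monom v_disc).
have : val_ge v 0 (monom k a) by apply/val_ringE/cent/laurent_monom.
by rewrite (val_geE _ _ (monom_neq0 _ _)).
Qed.

(** * Terminality from the lattice points of a cone *)

Section Criterion.
Hypothesis farkas : forall u, (forall a, in_dual a -> 0 <= dot a u) -> in_cone u.
Variables (r : nat) (m' : 'I_n -> int).
Hypotheses (r_gt0 : (0 < r)%N) (m'F : forall t, F t -> dot m' (beta t) = r).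
Hypothesis terminal_points : forall u (l : 'I_n), u l != 0 -> in_cone u ->
  r%:Z < dot m' u \/ exists2 t, F t & beta t = u.
Hypothesis separate : forall t, F t -> exists m0, dot m0 (beta t) = 0 /\
  forall t', F t' -> 0 < dot m0 (beta t') \/ beta t' = beta t.

(** The form [dx_1 /\ ... /\ dx_n] is the product of the coordinates times the invariant form, so
    its [r]-th power shifts every exponent by [r]. *)
Let a i := m' i - r%:Z.

Lemma dot_canonical u : dot a u = dot m' u - r%:Z * \sum_i u i.
Proof. by rewrite mulr_sumr -sumrB; apply: eq_bigr => i _; rewrite mulrBl. Qed.

(** The weight of [w] is primitive and some generator is a positive integer multiple of it, so [m']
    is at most [r] on it; under this bound [terminal_points] leaves only generators. *)
Lemma prime_divisor_ray (w : K -> int) (l : 'I_n) :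
  prime_divisor cone_ring w -> weights w l != 0 -> dot m' (weights w) = r.
Proof.
move=> w_prime wl; have [_ [m1 m1w]] := prime_divisor_order w_prime wl.
have [w_disc cent frac] := w_prime.
have w_cone := centered_in_cone w_disc cent farkas.
have [lam [lam0 lamF wE]] := w_cone.
have [t lam_t] : exists t, 0 < lam t.
  apply/existsP; apply: contraT => /existsPn lamn.
  have : (weights w l)%:~R = 0 :> rat.
    rewrite wE big1 // => t _; have := lamn t; rewrite -leNgt => lt0.
    by rewrite (@le_anti _ _ (lam t) 0) ?mul0r // lt0 lam0.
  by move/eqP; rewrite intr_eq0 (negPf wl).
have Ft : F t by apply: contraLR lam_t => /lamF->; rewrite ltxx.
have orth := prime_divisor_weights w_disc frac lam0 lamF wE lam_t.
have bE i : beta t i = dot m1 (beta t) * weights w i.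
  have := orth (fun j => (j == i)%:Z + - (weights w i * m1 j)).
  rewrite !dotDl !dotNl !dotZl !dot_delta m1w mulr1 subrr => /(_ erefl)/eqP.
  by rewrite subr_eq0 mulrC => /eqP.
have rE : r%:Z = dot m1 (beta t) * dot m' (weights w).
  by rewrite -(m'F Ft) -dotZr; congr dot; apply: funext.
have m'w : 0 < dot m' (weights w).
  rewrite -(ltr0z rat) (dot_cone _ wE) (bigD1 t) //=; apply: ltr_wpDr.
    apply: sumr_ge0 => t' _; have [Ft'|/lamF->] := boolP (F t'); last by rewrite mul0r.
    by rewrite mulr_ge0 // m'F // ler0z.
  by rewrite mulr_gt0 // m'F // ltr0z.
have [lt|[t' Ft' <-]] := terminal_points wl w_cone; last exact: m'F.
have : 0 < dot m1 (beta t) * dot m' (weights w) by rewrite -rE.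
rewrite pmulr_lgt0 // => mu0; move: lt; rewrite rE ltNge.
by rewrite -[leLHS]mul1r ler_pM2r // -gtz0_ge1 mu0.
Qed.

Lemma exceptional_order (v : K -> int) : exceptional cone_ring v ->
  exists2 e, dx_order_ge v e & 0 < r%:Z * e + v (monom k a).
Proof.
move=> [[v_disc _] cent not_prime].
have v_cone := centered_in_cone v_disc cent farkas.
have not_frac : ~ fractions_with_unit_denominators cone_ring v.
  by move=> frac; apply: not_prime.
have r0 : 0 < r%:Z by [].
have [/forallP w0|/forallPn[l vl]] := boolP [forall i, weights v i == 0].
  have {}w0 i : weights v i = 0 by apply/eqP.
  exists 1; last first.
    by rewrite (val_monom v_disc) /dot big1 ?addr0 ?mulr1 // => i _; rewrite w0 mulr0.
  apply: contrapT => not_ge; apply: not_frac.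
  apply: (local_ring_localization v_disc w0 (m0 := m')); last by move=> t Ft; rewrite m'F.
  apply: (stable_local_ring char_k v_disc) => [i|]; first by rewrite -/(weights v i) w0.
  exact: (partial_stable w0 not_ge).
have [d [u [m1 [d0 m1d vE]]]] := primitive_multiple vl.
have vE' : weights v = (fun i => d * u i) by apply: funext.
have ul : u l != 0 by apply: contraNneq vl => ul; rewrite vE ul mulr0.
have u_cone : in_cone u.
  have [lam [lam0 lamF wE]] := v_cone; exists (fun t => lam t / d%:~R); split=> [t|t Ft|i].
  - by rewrite divr_ge0 // ler0z ltW.
  - by rewrite lamF // mul0r.
  have d0' : d%:~R != 0 :> rat by rewrite intr_eq0 gt_eqF.
  apply: (mulfI d0'); rewrite -intrM -vE wE mulr_sumr; apply: eq_bigr => t _.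
  by rewrite mulrA [d%:~R * _]mulrC divfK.
rewrite (val_monom v_disc) dot_canonical.
set s := \sum_i weights v i.
have [lt|[t Ft tu]] := terminal_points ul u_cone.
  (* The total order is [d * (<m', u> - r)]. *)
  exists (s - d); first exact: (dx_order_lower char_k v_disc vl m1d d0).
  have -> : dot m' (weights v) = d * dot m' u by rewrite vE' dotZr.
  have : 0 < d * (dot m' u - r%:Z) by rewrite mulr_gt0 // subr_gt0.
  lia.
(* On a ray the order [s - d] would only give the total 0; one more gives [r]. If this bound fails,
   [v] is shown to be a prime divisor. *)
exists (s - d + 1); last first.
  have -> : dot m' (weights v) = d * r%:Z by rewrite vE' dotZr -tu m'F.
  lia.
apply: contrapT => not_ge; apply: not_frac.
have stable := euler_stable char_k v_disc vl m1d d0 not_ge.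
have d1 := euler_weight_gcd char_k v_disc vl m1d d0 stable.
have vu : weights v = u by apply: funext => i; rewrite vE d1 mul1r.
rewrite d1 in m1d stable.
have v_mon := euler_monomial_valuation char_k v_disc m1d stable.
have [m0 [m0t m0F]] := separate Ft.
apply: (monomial_localization (m0 := m0) (disc_val v_disc) v_mon); rewrite ?vu -?tu //.
by move=> t' /m0F[/ltW//|->]; rewrite m0t.
Qed.

Lemma terminal_cone_ring : terminal_chart cone_ring.
Proof.
exists r, a; split=> // [w w_prime|v]; last exact: exceptional_order.
have [w_disc _ _] := w_prime.
have [/forallP w0|/forallPn[l wl]] := boolP [forall i, weights w i == 0].
  have {}w0 i : weights w i = 0 by apply/eqP.
  exists 0; first exact: prime_divisor_order0.
  by rewrite (val_monom w_disc) /dot big1 ?addr0 ?mulr0 // => i _; rewrite w0 mulr0.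
have [order _] := prime_divisor_order w_prime wl.
exists (\sum_i weights w i - 1) => //.
rewrite (val_monom w_disc) dot_canonical (prime_divisor_ray w_prime wl).
by move: (\sum_i _) => s; lia.
Qed.

End Criterion.

End Cones.

(** * Exceptional monomial valuations *)

Section NotTerminal.
Variables (k : fieldType) (n : nat).
Hypothesis char_k : [pchar k] =i pred0.

Notation K := {fraction {mpoly k[n]}}.
Notation tofrac := (@FracField.tofrac {mpoly k[n]}).

Lemma dx_order_geW (v : K -> int) e e' : e <= e' -> dx_order_ge v e' -> dx_order_ge v e.
Proof.
move=> le [f [fO J0 vJ]]; exists f; split=> //.
by apply: le_trans vJ _; rewrite lerN2.
Qed.

Lemma dx_order_uniq (v : K -> int) e e' : dx_order v e -> dx_order v e' -> e = e'.
Proof.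
move=> [ge not_ge] [ge' not_ge']; apply/eqP; rewrite eq_le.
apply/andP; split; rewrite leNgt; apply/negP => lt.
  by apply: not_ge'; apply: dx_order_geW ge; lia.
by apply: not_ge; apply: dx_order_geW ge'; lia.
Qed.

Lemma monomX (a : 'I_n -> int) (e : nat) :
  monom k a ^+ e = monom k (fun i => e%:Z * a i) :> K.
Proof.
elim: e => [|e IH].
  by rewrite expr0 -monom0; congr monom; apply: funext => i; rewrite mul0r.
rewrite exprS IH -monomD; congr monom; apply: funext => i.
by rewrite -addn1 PoszD mulrDl mul1r addrC.
Qed.

Lemma monom_prod l (f : 'I_l -> 'I_n -> int) :
  \prod_j monom k (f j) = monom k (fun i => \sum_j f j i) :> K.
Proof.
elim: l f => [|l IH] f.
  by rewrite big_ord0 -monom0; congr monom; apply: funext => i; rewrite big_ord0.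
rewrite big_ord_recl IH -monomD; congr monom; apply: funext => i.
by rewrite big_ord_recl.
Qed.

(** Distinct Laurent monomials are linearly independent: one shift makes all exponents natural, and
    a coefficient of [p] can be read off. *)
Lemma monom_sum_neq0 (l : nat) (p : {mpoly k[l]}) (phi : 'X_{1..l} -> 'I_n -> int) :
  injective phi -> p != 0 ->
  \sum_(m <- msupp p) cst n p@_m * monom k (phi m) != 0 :> K.
Proof.
move=> phi_inj p0; pose C i : int := \sum_(m <- msupp p) `|phi m i|.
pose E m : 'X_{1..n} := [multinom `|(phi m i + C i)%R|%N | i < n].
have EE m : m \in msupp p -> forall i, (E m i)%:Z = phi m i + C i.
  move=> mp i; rewrite mnmE /C (big_rem m) //=.
  have : 0 <= \sum_(y <- rem m (msupp p)) `|phi y i| by apply: sumr_ge0.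
  by move: (\sum_(_ <- _) _) => s; lia.
have -> : \sum_(m <- msupp p) cst n p@_m * monom k (phi m) =
    tofrac (\sum_(m <- msupp p) p@_m *: 'X_[E m]) * monom k (fun i => - C i) :> K.
  rewrite rmorph_sum mulr_suml !big_seq; apply: eq_bigr => m mp /=.
  rewrite -mul_mpolyC tofracM -monom_mnm -mulrA -monomD; congr (_ * monom k _).
  by apply: funext => i; rewrite EE // addrK.
apply: mulf_neq0 (monom_neq0 _ _); rewrite tofrac_eq0.
have mp := mlead_supp p0; set m0 := mlead p in mp.
apply/eqP => /(congr1 (mcoeff (E m0))); rewrite mcoeff0 raddf_sum /=.
rewrite (bigD1_seq m0) ?msupp_uniq //= mcoeffZ mcoeffX eqxx mulr1.
rewrite big_seq_cond big1 ?addr0 => [/eqP|m /andP[mp' ne]].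
  by rewrite mcoeff_eq0 mp.
rewrite mcoeffZ mcoeffX; case: eqP => [EQ|]; last by rewrite mulr0.
case/eqP: ne; apply: phi_inj; apply: funext => i.
by apply: (addIr (C i)); rewrite -!EE // EQ.
Qed.

(** The [n.-1] adapted monomials have weight 0 and independent exponents, so a nonzero polynomial in
    them is a nonzero homogeneous element of weight 0. *)
Lemma monomial_divisorial (v : K -> int) (u m : 'I_n -> int) (l : 'I_n) :
  valuation v -> monomial_valuation v u -> dot m u = 1 -> u l != 0 -> divisorial v.
Proof.
move=> v_val v_mon mu ul; split; first exact: (monomial_discrete v_val v_mon mu).
have vu := monomial_weights v_mon.
pose f j := adapted v l (lift l j).
pose phi (m : 'X_{1..n.-1}) i := \sum_j (m j)%:Z * f j i.
have dot_f j : dot (f j) u = 0 by rewrite -vu dot_adapted.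
exists (fun j => monom k (f j)); split=> [j|p p0].
  by right; rewrite (monomial_val_monom v_mon) dot_f.
have -> : mmap (@cst k n) (fun j => monom k (f j)) p =
    \sum_(m <- msupp p) cst n p@_m * monom k (phi m) :> K.
  apply: eq_bigr => m' _; congr (_ * _); rewrite /mmap1 /phi -monom_prod.
  by apply: eq_bigr => j _; rewrite monomX.
have phi_inj : injective phi.
  move=> m1 m2 eqphi; apply/mnmP => j; have := congr1 (@^~ (lift l j)) eqphi.
  have phiE m' : phi m' (lift l j) = (m' j)%:Z * u l.
    rewrite /phi (bigD1 j) //= big1 => [|j' ne]; rewrite /f /adapted vu.
      rewrite eqxx [lift l j == l]eq_sym (negPf (neq_lift _ _)).
      by rewrite mulr1 mulr0 subr0 addr0.
    rewrite [lift l j == l]eq_sym (negPf (neq_lift _ _)) (inj_eq lift_inj).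
    by rewrite eq_sym (negPf ne) !mulr0.
  by rewrite /= !phiE => /(mulIf ul) [].
have sum0 := monom_sum_neq0 phi_inj p0; split; first exact: sum0.
apply: v_mon sum0 _; exists (size (msupp p)),
  (fun j => p@_(tnth (in_tuple (msupp p)) j)), (fun j => phi (tnth (in_tuple (msupp p)) j)).
split=> [j|]; last by rewrite big_tnth.
rewrite /dot /phi (eq_bigr (fun i => \sum_j0 (tnth (in_tuple (msupp p)) j j0)%:Z * (f j0 i * u i))).
  rewrite exchange_big big1 // => j0 _; rewrite -mulr_sumr.
  by have := dot_f j0; rewrite /dot => ->; rewrite mulr0.
by move=> i _; rewrite mulr_suml; apply: eq_bigr => j0 _; rewrite mulrA.
Qed.

Variables (T : finType) (beta : T -> 'I_n -> int) (F : pred T).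

Lemma monomial_centered (v : K -> int) u : valuation v -> monomial_valuation v u ->
  (forall a, in_dual beta F a -> 0 <= dot a u) -> centered (@cone_ring k n T beta F) v.
Proof.
move=> v_val v_mon dual f Af; apply/val_ringE; apply: (monomial_val_ge v_val v_mon).
exact: laurentW Af.
Qed.

Lemma monomial_prime_divisor (v : K -> int) t m m0 :
  valuation v -> monomial_valuation v (beta t) -> F t -> dot m (beta t) = 1 ->
  dot m0 (beta t) = 0 ->
  (forall t', F t' -> 0 < dot m0 (beta t') \/ beta t' = beta t) ->
  prime_divisor (@cone_ring k n T beta F) v.
Proof.
move=> v_val v_mon Ft mt m0t m0F; split; first exact: (monomial_discrete v_val v_mon mt).
  by apply: (monomial_centered v_val v_mon) => a; apply.
apply: (monomial_localization v_val v_mon m0t) => // t' /m0F[/ltW//|->].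
by rewrite m0t.
Qed.

Lemma monomial_order_upper (v : K -> int) (u m : 'I_n -> int) (l : 'I_n) e :
  valuation v -> monomial_valuation v u -> dot m u = 1 -> u l != 0 ->
  dx_order_ge v e -> e <= \sum_i u i - 1.
Proof.
move=> v_val v_mon mu ul ge; rewrite leNgt; apply/negP => lt.
have v_disc := monomial_discrete v_val v_mon mu; have vu := monomial_weights v_mon.
(* The upper bound is applied on the chart of the single ray [u], where [v] becomes a prime
   divisor. *)
apply: (@dx_order_upper k n char_k v v_disc (@cone_ring k n unit (fun=> u) predT) l).
- move=> f; apply: laurentW => a a_dual; rewrite vu; exact: (a_dual tt isT).
- apply: (monomial_localization (m0 := fun=> 0) v_val v_mon).
  + by rewrite /dot big1 // => i _; rewrite mul0r.
  + by move=> t _; rewrite /dot big1 // => i _; rewrite mul0r.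
  by move=> t _; right.
- by rewrite vu.
by rewrite vu; apply: dx_order_geW ge; lia.
Qed.

(* The exceptional divisor of u has discrepancy zero when u is the midpoint of two rays. *)
Lemma midpoint_not_terminal (u : 'I_n -> int) t1 t2 me m1 :
  F t1 -> F t2 -> (forall i, u i *+ 2 = beta t1 i + beta t2 i) ->
  dot me u = 1 -> dot me (beta t1) = 1 -> dot me (beta t2) = 1 ->
  dot m1 u = 0 -> dot m1 (beta t1) != 0 ->
  (forall t, (t == t1) || (t == t2) -> exists m0, dot m0 (beta t) = 0 /\
    forall t', F t' -> 0 < dot m0 (beta t') \/ beta t' = beta t) ->
  ~ terminal_chart (@cone_ring k n T beta F).
Proof.
move=> F1 F2 u2 meu me1 me2 m1u m1t sep [r [a [r0 primeP excP]]].
have dot2 b : dot b u *+ 2 = dot b (beta t1) + dot b (beta t2).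
  rewrite /dot -sumrMnl -big_split; apply: eq_bigr => i _.
  by rewrite /= -mulrDr -u2 mulrnAr.
have nz w : dot me w = 1 -> exists l, w l != 0.
  move=> mw; apply/existsP; apply: contra_eqT mw => /existsPn w0.
  by rewrite /dot big1 // => i _; have /negPn/eqP-> := w0 i; rewrite mulr0.
(* Along the two rays, which give prime divisors, the form has order 0. This determines [dot a] on
   them, hence on their midpoint. *)
have ray t : F t -> (t == t1) || (t == t2) ->
    r%:Z * (\sum_i beta t i - 1) + dot a (beta t) = 0.
  move=> Ft tt; have met : dot me (beta t) = 1 by case/orP: tt => /eqP->.
  have [v v_val v_mon] := monomial_valuation_exists k (beta t).
  have [m0 [m0t m0F]] := sep t tt; have [l tl] := nz _ met.
  have v_prime := monomial_prime_divisor v_val v_mon Ft met m0t m0F.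
  have vt := monomial_weights v_mon.
  have [e e_order eE] := primeP v v_prime.
  have [] := prime_divisor_order char_k v_prime (_ : weights v l != 0); rewrite vt //.
  by move=> /(dx_order_uniq e_order) <- _; rewrite -(monomial_val_monom v_mon).
have [v v_val v_mon] := monomial_valuation_exists k u.
have [l ul] := nz _ meu; have vu := monomial_weights v_mon.
have v_disc := monomial_discrete v_val v_mon meu.
have [] := excP v.
  split; first exact: (monomial_divisorial v_val v_mon meu ul).
    apply: (monomial_centered v_val v_mon) => b b_dual.
    by have := dot2 b; have := b_dual _ F1; have := b_dual _ F2; lia.
  (* For a prime divisor of weight [u], every functional vanishing on [u] would vanish on the two
     rays as well; [m1] does not. *)
  case=> _ _ frac; move/eqP: m1t; apply.
  pose lam t : rat := ((t == t1)%:R + (t == t2)%:R) / 2.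
  apply: (prime_divisor_weights v_disc frac (lam := lam)).
  - by move=> t; rewrite divr_ge0 ?addr_ge0.
  - move=> t nF; rewrite /lam; case: eqP => [E|_]; first by rewrite E F1 in nF.
    by case: eqP => [E|_]; [rewrite E F2 in nF|rewrite addr0 mul0r].
  - move=> i; rewrite vu /lam.
    rewrite (eq_bigr (fun t =>
      ((t == t1)%:R * (beta t i)%:~R + (t == t2)%:R * (beta t i)%:~R) / 2)).
      rewrite -mulr_suml big_split /= (bigD1 t1) //= eqxx mul1r big1 => [|t /negPf->]; last first.
        by rewrite mul0r.
      rewrite (bigD1 t2) //= eqxx mul1r big1 => [|t /negPf->]; last by rewrite mul0r.
      by rewrite !addr0 -intrD -u2 rmorphMn /= -(mulr_natr _%:~R) mulfK.
    by move=> t _; rewrite mulrAC -mulrDl.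
  - by rewrite /lam eqxx divr_gt0 // ltr_wpDr.
  - by rewrite vu.
move=> e /(monomial_order_upper v_val v_mon meu ul) e_le.
rewrite (monomial_val_monom v_mon).
have sum2 : (\sum_i u i) *+ 2 = \sum_i beta t1 i + \sum_i beta t2 i.
  by rewrite -sumrMnl -big_split; apply: eq_bigr => i _; rewrite u2.
have := ray t1 F1; have := ray t2 F2; rewrite !eqxx orbT => /(_ isT) E2 /(_ isT) E1.
have : r%:Z * e <= r%:Z * (\sum_i u i - 1) by rewrite ler_pM2l.
move: (dot2 a) sum2 E1 E2.
move: (dot a u) (dot a _) (dot a _) (\sum_i u i) (\sum_i _) (\sum_i _) => x x1 x2 s s1 s2.
move: (r%:Z) r0 => R _; nia.
Qed.

End NotTerminal.

(** * Rational cones *)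

Lemma clear_denominators (I : finType) (m : I -> rat) : exists2 D : int, 0 < D &
  exists a : I -> int, forall i, (a i)%:~R = D%:~R * m i.
Proof.
exists (\prod_i denq (m i)); first by apply: prodr_gt0 => i _; apply: denq_gt0.
exists (fun i => numq (m i) * \prod_(j | j != i) denq (m j)) => i.
rewrite [in RHS](bigD1 i) //= !intrM numqE [RHS]mulrC [in RHS]mulrA; congr (_ * _).
Qed.

Section Farkas.
Variable n : nat.
Implicit Types (a b m u : 'I_n -> rat).

Let dotq a b : rat := \sum_i a i * b i.

Let dotq_subl a b c u : dotq (fun i => a i - c * b i) u = dotq a u - c * dotq b u.
Proof.
rewrite /dotq mulr_sumr -sumrB; apply: eq_bigr => i _.
by rewrite mulrBl mulrA.
Qed.

Let dotq_subr a b c u : dotq u (fun i => a i - c * b i) = dotq u a - c * dotq u b.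
Proof.
rewrite /dotq mulr_sumr -sumrB; apply: eq_bigr => i _.
by rewrite mulrBr mulrCA.
Qed.

(* Induction on the number of generators: if a functional m that separates u from
   the cone on s is negative on the new generator v, then project everything along
   v onto the kernel of m. *)
Lemma farkas_seq (T : eqType) (s : seq T) (b : T -> 'I_n -> rat) u : uniq s ->
  (exists2 lam : T -> rat, forall t, 0 <= lam t &
    forall i, u i = \sum_(t <- s) lam t * b t i) \/
  (exists m, (forall t, t \in s -> 0 <= \sum_i m i * b t i) /\ \sum_i m i * u i < 0).
Proof.
elim: s b u => [|t0 s IH] b u /=.
  move=> _; have [/forallP u0|/forallPn[i ui]] := boolP [forall i, u i == 0].
    by left; exists (fun=> 0) => // i; rewrite big_nil; apply/eqP.
  right; exists (fun i => - u i); split=> //.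
  under eq_bigr do rewrite mulNr; rewrite sumrN oppr_lt0 (bigD1 i) //=.
  apply: ltr_wpDr; first by apply: sumr_ge0 => j _; rewrite -expr2 sqr_ge0.
  by rewrite -expr2 exprn_even_gt0.
move=> /andP[t0s us]; have [[lam lam0 uE]|[m [ms mu]]] := IH b u us.
  left; exists (fun t => if t == t0 then 0 else lam t) => [t|i].
    by case: ifP.
  rewrite big_cons eqxx mul0r add0r uE !big_seq; apply: eq_bigr => t ts.
  by case: eqP => // E; rewrite E (negPf t0s) in ts.
have [ge0|lt0] := leP 0 (\sum_i m i * b t0 i).
  by right; exists m; split=> // t; rewrite inE => /orP[/eqP->|/ms].
pose c := dotq m (b t0).
have [[lam lam0 uE]|[m2 [m2s m2u]]] := IH (fun t i => b t i - dotq m (b t) / c * b t0 i)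
    (fun i => u i - dotq m u / c * b t0 i) us.
  left; exists (fun t => if t == t0 then
      dotq m u / c - \sum_(t <- s) lam t * (dotq m (b t) / c) else lam t).
    move=> t; case: ifP => // _; rewrite addr_ge0 //.
      by rewrite mulr_le0 ?invr_le0 ?ltW.
    rewrite -sumrN big_seq sumr_ge0 // => t' t's.
    by rewrite -mulrN mulr_ge0 // -mulrN mulr_ge0 ?ms // -invrN invr_ge0 oppr_ge0 ltW.
  move=> i; rewrite big_cons eqxx.
  have -> : \sum_(t <- s) (if t == t0 then dotq m u / c -
      \sum_(t <- s) lam t * (dotq m (b t) / c) else lam t) * b t i =
      \sum_(t <- s) lam t * b t i.
    rewrite !big_seq; apply: eq_bigr => t ts.
    by case: eqP => // E; rewrite E (negPf t0s) in ts.
  have := uE i.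
  rewrite (eq_bigr (fun t => lam t * b t i - lam t * (dotq m (b t) / c) * b t0 i)); last first.
    by move=> t _; ring.
  rewrite sumrB -mulr_suml => /eqP; rewrite subr_eq => /eqP->.
  by ring.
right; exists (fun i => m2 i - dotq m2 (b t0) / c * m i); split; last first.
  move: m2u; rewrite -/(dotq m2 _) -/(dotq _ u) dotq_subl dotq_subr.
  by have -> : dotq m2 (b t0) / c * dotq m u = dotq m u / c * dotq m2 (b t0) by ring.
move=> t; rewrite -/(dotq _ (b t)) dotq_subl inE => /orP[/eqP->|/m2s].
  by rewrite -/c divfK ?subrr // lt_eqF.
rewrite -/(dotq m2 _) dotq_subr.
by have -> : dotq m2 (b t0) / c * dotq m (b t) = dotq m (b t) / c * dotq m2 (b t0) by ring.
Qed.
End Farkas.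

Lemma farkas n (T : finType) (beta : T -> 'I_n -> int) (F : pred T) u :
  (forall a, in_dual beta F a -> 0 <= dot a u) -> in_cone beta F u.
Proof.
move=> dual; pose b t i : rat := (beta t i)%:~R.
have [[lam lam0 uE]|[m [mb mu]]] :=
    farkas_seq b (fun i => (u i)%:~R) (enum_uniq F).
  exists (fun t => if F t then lam t else 0); split=> [t|t /negPf->//|i].
    by case: ifP.
  rewrite uE big_enum [in LHS]big_mkcond; apply: eq_bigr => t _.
  by rewrite unfold_in; case: ifP; rewrite ?mul0r.
have [D D0 [a aE]] := clear_denominators m.
have dotE w : (dot a w)%:~R = D%:~R * \sum_i m i * (w i)%:~R :> rat.
  rewrite rmorph_sum mulr_sumr; apply: eq_bigr => i _ /=.
  by rewrite intrM aE mulrA.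
have : 0 <= dot a u.
  apply: dual => t Ft; rewrite -(ler0z rat) dotE; apply: mulr_ge0.
    by rewrite ler0z ltW.
  by apply: mb; rewrite mem_enum.
by rewrite -(ler0z rat) dotE pmulr_rge0 ?ltr0z // leNgt mu.
Qed.

(** Solvability of a linear system with rational coefficients is unchanged by field extension, so
    the real solution yields a rational one, and [r] clears its denominators. *)
Lemma rational_solution (R : realType) n (T : finType) (beta : T -> 'I_n -> int)
    (F : pred T) (x : 'I_n -> R) :
  (forall t, F t -> \sum_i x i * (beta t i)%:~R = 1) ->
  exists (r : nat) (m : 'I_n -> int), (0 < r)%N /\ forall t, F t -> dot m (beta t) = r.
Proof.
move=> xP; pose B : 'M[rat]_(n, #|T|) :=
  \matrix_(i, j) if F (enum_val j) then (beta (enum_val j) i)%:~R else 0.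
pose e : 'rV[rat]_#|T| := \row_j (F (enum_val j))%:R.
have /submxP[y yE] : (e <= B)%MS.
  rewrite -(map_submx (@ratr R)); apply/submxP; exists (\row_i x i).
  apply/rowP=> j; rewrite !mxE; case: (boolP (F (enum_val j))) => Fj.
    rewrite rmorph1 -(xP _ Fj); apply: eq_bigr => i _.
    by rewrite !mxE Fj rmorph_int.
  rewrite rmorph0 big1 // => i _.
  by rewrite !mxE (negPf Fj) rmorph0 mulr0.
have [D D0 [m mE]] := clear_denominators (y 0).
exists `|D|%N, m; split=> [|t Ft]; first by rewrite absz_gt0 gt_eqF.
apply: (@intr_inj rat); rewrite gtz0_abs // rmorph_sum /=.
have := congr1 (fun A : 'rV_#|T| => A 0 (enum_rank t)) yE.
rewrite !mxE enum_rankK Ft => /(congr1 ( *%R D%:~R)); rewrite mulr1 => ->.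
rewrite mulr_sumr; apply: eq_bigr => i _.
by rewrite !mxE enum_rankK Ft intrM mE mulrA.
Qed.

Lemma dual_basis n (E : finType) (b : 'I_n -> E -> int) :
  (forall a : 'I_n -> int, (forall e, \sum_i a i * b i e = 0) -> forall i, a i = 0) ->
  exists d : 'I_n -> E -> rat, forall i j, \sum_e d i e * (b j e)%:~R = (i == j)%:R.
Proof.
move=> b_free; pose B : 'M[rat]_(n, #|E|) := \matrix_(i, j) (b i (enum_val j))%:~R.
have B_free : row_free B.
  apply/inj_row_free => v vB; have [D D0 [a aE]] := clear_denominators (v 0).
  have a0 := b_free a; apply/rowP=> i; rewrite mxE.
  have D0' : D%:~R != 0 :> rat by rewrite intr_eq0 gt_eqF.
  apply: (mulfI D0'); rewrite mulr0 -aE a0 // => e.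
  apply: (@intr_inj rat); rewrite rmorph_sum /=.
  have := congr1 (fun A : 'rV_#|E| => D%:~R * A 0 (enum_rank e)) vB.
  rewrite !mxE mulr0 mulr_sumr => E0; rewrite -[RHS]E0; apply: eq_bigr => j _.
  by rewrite !mxE enum_rankK intrM aE mulrA.
exists (fun i e => pinvmx B (enum_rank e) i) => i j.
have := congr1 (fun A : 'M_n => A j i) (mulmxVp B_free).
rewrite !mxE eq_sym => <-; rewrite (reindex (@enum_val _ E)) /=; last first.
  exact/onW_bij/enum_val_bij.
by apply: eq_bigr => l _; rewrite enum_valK mulrC; congr (_ * _); rewrite /B mxE.
Qed.

(** * Corners of trivalent graphs *)

Section Corners.
Variable G : graph.
Hypothesis trivalent : forall v : vertex G, valency v = 3.

Implicit Types (t : corner G) (e : edge G) (v : vertex G).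

Definition sign (x : 'F_2) : int := (-1) ^+ x.

Lemma sign_inj : injective sign.
Proof. by move=> [[|[|i]] Hi] [[|[|j]] Hj] //= _; apply: val_inj. Qed.

Lemma sign_cases x : sign x = 1 \/ sign x = -1.
Proof. by case: x => [[|[|i]] Hi] //; [left|right]. Qed.

Definition mult v e : int := \sum_(d : bool | endpoint (e, d) == v) 1.

Lemma multE v e :
  mult v e = (endpoint (e, true) == v)%:R + (endpoint (e, false) == v)%:R.
Proof. by rewrite /mult big_mkcond big_bool /=; do 2 case: eqP => _. Qed.

Lemma sum_half_edges (f : edge G * bool -> int) v :
  \sum_(h | endpoint h == v) f h = \sum_e \sum_(d : bool | endpoint (e, d) == v) f (e, d).
Proof. by rewrite pair_big_dep; apply: eq_big => [[]|[]]. Qed.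

Lemma corner_dot (f : edge G -> int) t :
  \sum_e f e * corner_vec t e = \sum_(h | endpoint h == t.1) f h.1 * sign (t.2 h).
Proof.
rewrite (sum_half_edges (fun h => f h.1 * sign (t.2 h))); apply: eq_bigr => e _.
by rewrite mulr_sumr.
Qed.

Lemma sum_mult v : \sum_e mult v e = 3.
Proof.
transitivity ((valency v)%:R : int); last by rewrite trivalent.
rewrite -(sum_half_edges (fun=> 1)) /valency -sum1_card natr_sum.
by apply: eq_bigl => h; rewrite inE.
Qed.

Lemma corner_dot_le (f : edge G -> int) t : (forall e, `|f e| <= 1) ->
  \sum_e f e * corner_vec t e <= 3.
Proof.
move=> f1; rewrite corner_dot -(sum_mult t.1) -(sum_half_edges (fun=> 1)).
by apply: ler_sum => h _; have := f1 h.1; have [->|->] := sign_cases (t.2 h); lia.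
Qed.

Lemma corner_dot_max (f : edge G -> int) t : (forall e, `|f e| <= 1) ->
  \sum_e f e * corner_vec t e = 3 ->
  forall h, endpoint h = t.1 -> f h.1 = sign (t.2 h).
Proof.
move=> f1; rewrite corner_dot -(sum_mult t.1) -(sum_half_edges (fun=> 1)) => E h hv.
have : \sum_(h | endpoint h == t.1) (1 - f h.1 * sign (t.2 h)) = 0.
  by rewrite sumrB E subrr.
move/psumr_eq0P => H; have {}H : 1 - f h.1 * sign (t.2 h) = 0.
  apply: H => [h' _|]; last by rewrite hv.
  by have := f1 h'.1; have [->|->] := sign_cases (t.2 h'); lia.
by move: H; have [->|->] := sign_cases (t.2 h); lia.
Qed.

Lemma abs_corner_vec t e : `|corner_vec t e| <= mult t.1 e.
Proof.
rewrite /corner_vec /mult (le_trans (ler_norm_sum _ _ _)) //.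
by apply: ler_sum => d _; have [] := sign_cases (t.2 (e, d)); rewrite /sign => ->.
Qed.

Lemma aligned_corner_vec (f : edge G -> int) t :
  (forall h, endpoint h = t.1 -> f h.1 = sign (t.2 h)) ->
  forall e, corner_vec t e = f e * mult t.1 e.
Proof.
move=> fP e; rewrite /corner_vec /mult mulr_sumr; apply: eq_bigr => d /eqP dv.
by rewrite mulr1 -[LHS]/(sign (t.2 (e, d))) -(fP (e, d)).
Qed.

(** The sign vector of [t] has entries of absolute value at most 1, so it is at most 3 on every
    corner. In case of equality all half-edges at the vertex of [t'] are aligned with it; so [t']
    uses only edges met by [t], and the multiplicities, both of sum 3, agree. *)
Lemma corner_separation t t' : \sum_e `|corner_vec t e| = 3 ->
  \sum_e sgz (corner_vec t e) * corner_vec t e = 3 /\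
  (\sum_e sgz (corner_vec t e) * corner_vec t' e < 3 \/
   forall e, corner_vec t' e = corner_vec t e).
Proof.
move=> t3; pose f e := sgz (corner_vec t e).
have f1 e : `|f e| <= 1 by rewrite /f; case: sgzP.
have ft : \sum_e f e * corner_vec t e = 3.
  by rewrite -t3; apply: eq_bigr => e _; rewrite /f; case: sgzP => [->|x0|x0]; lia.
split=> //; have := corner_dot_le t' f1; rewrite le_eqVlt => /orP[/eqP ft'|]; last by left.
right; have vt := aligned_corner_vec (corner_dot_max f1 ft).
have vt' := aligned_corner_vec (corner_dot_max f1 ft').
have le e : mult t'.1 e <= mult t.1 e.
  have [->//|ne] := eqVneq t'.1 t.1.
  have [m0|m0] := leP (mult t'.1 e) 0; first by apply: le_trans m0 _; rewrite multE; lia.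
  have [d dv] : exists d, endpoint (e, d) = t'.1.
    move: m0; rewrite multE; case: eqP => [E _|_]; first by exists true.
    by case: eqP => [E _|_ //]; exists false.
  have := corner_dot_max f1 ft' dv; rewrite /= /f vt multE => fe.
  have : mult t.1 e != 0.
    apply/eqP => m; move: fe; rewrite -multE m mulr0 sgz0.
    by have [->|->] := sign_cases (t'.2 (e, d)).
  have excl x : ~~ ((x == t'.1) && (x == t.1)).
    by apply: contra ne => /andP[/eqP<-].
  rewrite !multE; have := excl (endpoint (e, true)); have := excl (endpoint (e, false)).
  by do 4 case: (_ == _).
move=> e; rewrite vt vt'; congr (_ * _).
have : \sum_e (mult t.1 e - mult t'.1 e) = 0 by rewrite sumrB !sum_mult.
move/psumr_eq0P => H; apply/eqP; rewrite eq_sym -subr_eq0; apply/eqP; apply: H => // e' _.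
by rewrite subr_ge0.
Qed.

Lemma connect_invariant (S : {set edge G}) (P : pred (vertex G)) :
  (forall e d, e \in S -> P (endpoint (e, d)) -> P (endpoint (e, ~~ d))) ->
  forall x y, connect (adjacent S) x y -> P x -> P y.
Proof.
move=> inv x y /connectP[p + ->]; elim: p x => //= z p IH x /andP[xz zp] Px.
apply: IH zp _; case/existsP: xz => e /andP[eS /existsP[d /andP[/eqP E /eqP <-]]].
by apply: inv; rewrite ?E.
Qed.

(** A loop leaves a single half-edge at its vertex, and the edge of that half-edge is the only way
    out. *)
Lemma loop_separating e : endpoint (e, true) = endpoint (e, false) ->
  exists f : edge G, separating f.
Proof.
set v := endpoint (e, true) => loop.
have mev : mult v e = 2 by rewrite multE -loop !eqxx.
have [f fe mfv] : exists2 f, f != e & mult v f != 0.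
  apply/exists_inP; apply: contraT => /exists_inPn no.
  have := sum_mult v; rewrite (bigD1 e) //= mev big1 // => f fe.
  by apply/eqP; have := no f fe; rewrite negbK.
have rest : \sum_(f' | f' != e) mult v f' = 1.
  have := sum_mult v; rewrite (bigD1 e) //= mev; move: (\sum_(_ | _) _) => x; lia.
have mult_ge0 f' : 0 <= mult v f' by rewrite multE; lia.
have mf1 : mult v f = 1 /\ forall f', f' != e -> f' != f -> mult v f' = 0.
  have rest0 : 0 <= \sum_(f' | (f' != e) && (f' != f)) mult v f'.
    by apply: sumr_ge0 => f' _; apply: mult_ge0.
  have mf : 0 < mult v f by rewrite lt_def mfv mult_ge0.
  have [m1 rest00] : mult v f = 1 /\ \sum_(f' | (f' != e) && (f' != f)) mult v f' = 0.
    move: rest rest0 mf; rewrite (bigD1 f) //=; move: (mult v f) (\sum_(_ | _) _) => a b *.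
    by split; lia.
  split=> // f' fe' ff'; move/psumr_eq0P: rest00 => -> //; last by rewrite fe' ff'.
exists f; apply/negP => /forallP/(_ v)/forallP conn.
have [d dv] : exists d, endpoint (f, d) != v.
  have := mf1.1; rewrite multE; case: eqP => [_|/eqP ne _]; last by exists true.
  by case: eqP => [//|/eqP ne _]; exists false.
have := connect_invariant (P := pred1 v) _ (conn (endpoint (f, d))).
rewrite /= eqxx (negPf dv) => H; suff : false by []; apply: H => // g d'.
rewrite !inE => gf /eqP gv.
have mg : mult v g != 0.
  by rewrite multE; case: d' gv => ->; rewrite eqxx; case: (_ == v).
have -> : g = e by apply/eqP; apply: contraNT mg => ge; rewrite mf1.2.
by case: d' {gv} => /=; rewrite -?loop.
Qed.

Lemma mult_le1 : ~ (exists e : edge G, separating e) -> forall v e, mult v e <= 1.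
Proof.
move=> nosep v e; rewrite multE; case: eqP => [E|_]; case: eqP => [E'|_] //.
by case: nosep; apply: (@loop_separating e); rewrite E E'.
Qed.

(* Modulo 2, the vectors of N are the cuts of the graph. *)
Lemma in_N_cut u : in_N u -> exists (s : vertex G -> int) (w : edge G -> int),
  forall e, u e = s (endpoint (e, true)) + s (endpoint (e, false)) + w e *+ 2.
Proof.
move=> [a uE]; exists (fun v => \sum_(t | t.1 == v) a t).
exists (fun e => \sum_t a t * - \sum_(d : bool | endpoint (e, d) == t.1) (t.2 (e, d) != 0)%:R).
move=> e; rewrite uE -sumrMnl.
have split t : corner_vec t e = mult t.1 e +
    (- \sum_(d : bool | endpoint (e, d) == t.1) (t.2 (e, d) != 0)%:R) *+ 2.
  rewrite /corner_vec /mult mulNrn -sumrMnl -sumrB; apply: eq_bigr => d _.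
  by case: (t.2 (e, d)) => [[|[|i]] Hi].
rewrite (eq_bigr (fun t => a t * mult t.1 e +
    a t * - (\sum_(d : bool | endpoint (e, d) == t.1) (t.2 (e, d) != 0)%:R) *+ 2)); last first.
  by move=> t _; rewrite split mulrDr mulrnAr.
rewrite big_split /=; congr (_ + _); rewrite [in RHS]big_mkcond [X in _ + X]big_mkcond.
rewrite -big_split; apply: eq_bigr => t _ /=; rewrite multE mulrDr ![_ == t.1]eq_sym.
by congr (_ + _); case: eqP => _; rewrite ?mulr1 ?mulr0.
Qed.

(** * Lattice points of the polytope when no edge separates *)

Section NoSeparatingEdges.
Hypothesis no_separating : ~ (exists e : edge G, separating e).
Variable c : coloring G.
Variable F : pred (corner G).
Hypothesis F_parity : forall t, F t -> corner_parity t = c t.1.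
Variables (u : edge G -> int) (lam : corner G -> rat).
Hypotheses (uN : in_N u) (lam_ge0 : forall t, 0 <= lam t).
Hypothesis lamF : forall t, ~~ F t -> lam t = 0.
Hypothesis uE : forall e, (u e)%:~R = \sum_t lam t * (corner_vec t e)%:~R.
Hypothesis lam_le1 : \sum_t lam t <= 1.

Lemma corner_vec_le1 t e : `|corner_vec t e| <= 1.
Proof. by apply: le_trans (abs_corner_vec t e) _; apply: mult_le1. Qed.

Lemma cone_dot (f : edge G -> int) : (\sum_e f e * u e)%:~R =
  \sum_t lam t * (\sum_e f e * corner_vec t e)%:~R :> rat.
Proof.
rewrite rmorph_sum /= (eq_bigr (fun e => \sum_t lam t * (f e * corner_vec t e)%:~R)).
  by rewrite exchange_big; apply: eq_bigr => t _; rewrite -mulr_sumr rmorph_sum.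
by move=> e _; rewrite intrM uE mulr_sumr; apply: eq_bigr => t _; rewrite intrM mulrCA.
Qed.

Lemma abs_u_le1 e : `|u e| <= 1.
Proof.
rewrite -(ler_int rat) intr_norm uE (le_trans (ler_norm_sum _ _ _)) //.
apply: le_trans lam_le1; apply: ler_sum => t _.
rewrite normrM (ger0_norm (lam_ge0 t)) -[leRHS]mulr1 ler_wpM2l //.
by rewrite -intr_norm -[1]/(1%:~R) ler_int corner_vec_le1.
Qed.

(** The entries are 0, 1 or -1, so the support is the set of odd entries. *)
Lemma u_odd_cut : exists s : pred (vertex G), forall e,
  (u e != 0) = (s (endpoint (e, true)) != s (endpoint (e, false))).
Proof.
have [s [w E]] := in_N_cut uN; exists (fun v => odd `|s v|%N) => e.
have := abs_u_le1 e; rewrite E.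
by move: (s _) (s _) (w e) => x y z; rewrite -mulr_natr; lia.
Qed.

(** A support reduced to the edge [i] would be a cut, and [i] would separate. *)
Lemma norm_u_ge2 i : u i != 0 -> 2 <= \sum_e u e * u e.
Proof.
move=> ui; have [s sP] := u_odd_cut.
have [j ji uj] : exists2 j, j != i & u j != 0.
  apply/exists_inP; apply: contraT => /exists_inPn no.
  have /negP/negPn/forallP/(_ (endpoint (i, true))) : ~ separating i.
    by move=> sep; apply: no_separating; exists i.
  move/forallP/(_ (endpoint (i, false))) => conn.
  have := sP i; rewrite ui => /esym; suff -> : s (endpoint (i, true)) = s (endpoint (i, false)).
    by rewrite eqxx.
  pose P x := s x == s (endpoint (i, true)).
  have := connect_invariant (P := P) _ conn; rewrite /P eqxx => H.
  apply/esym/eqP; apply: H => // e d; rewrite !inE => ei.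
  have := no e ei; rewrite negbK => /eqP ue; have := sP e; rewrite ue eqxx.
  by move=> /esym/negbFE/eqP E; case: d; rewrite /= E.
rewrite (bigD1 i) //= (bigD1 j) //=.
have : 0 <= \sum_(e | (e != i) && (e != j)) u e * u e.
  by apply: sumr_ge0 => e _; rewrite -expr2 sqr_ge0.
have sq x : x != 0 -> 1 <= x * x :> int by move=> x0; nia.
move: (sq _ ui) (sq _ uj).
by move: (u i * u i) (u j * u j) (\sum_(_ | _) _) => a b s0; lia.
Qed.

Lemma lam_pos_exists i : u i != 0 -> exists t, 0 < lam t.
Proof.
move=> ui; apply/existsP; apply: contraT => /existsPn no.
have /eqP : (u i)%:~R = 0 :> rat.
  rewrite uE big1 // => t _; have := no t; rewrite -leNgt => lt0.
  by rewrite (@le_anti _ _ (lam t) 0) ?mul0r // lt0 lam_ge0.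
by rewrite intr_eq0 (negPf ui).
Qed.

Lemma u_corner_le t e : u e * corner_vec t e <= u e * u e.
Proof.
have := abs_u_le1 e; have := corner_vec_le1 t e.
by move: (u e) (corner_vec t e) => x y; nia.
Qed.

(** The pairing of [u] with itself combines its pairings with the corners, each at most
    [\sum_e u e * u e], with coefficients of sum at most 1. So equality holds for every corner
    involved, edge by edge. *)
Lemma u_corner_eq t e : 0 < lam t -> u e * corner_vec t e = u e * u e.
Proof.
move=> lam_t; pose N := \sum_e u e * u e.
have N0 : 0 <= N by apply: sumr_ge0 => e' _; rewrite -expr2 sqr_ge0.
have E t' : 0 <= N - \sum_e u e * corner_vec t' e.
  by rewrite subr_ge0; apply: ler_sum => e' _; apply: u_corner_le.
have : \sum_t' lam t' * (N - \sum_e u e * corner_vec t' e)%:~R = 0 :> rat.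
  apply/eqP; rewrite eq_le; apply/andP; split; last first.
    by apply: sumr_ge0 => t' _; rewrite mulr_ge0 // ler0z E.
  rewrite (eq_bigr (fun t' => lam t' * N%:~R - lam t' * (\sum_e u e * corner_vec t' e)%:~R)).
    rewrite sumrB -mulr_suml -cone_dot -/N subr_le0 -[leRHS]mul1r ler_wpM2r //.
    by rewrite ler0z.
  by move=> t' _; rewrite intrB mulrBr.
move/psumr_eq0P => H; have : lam t * (N - \sum_e u e * corner_vec t e)%:~R = 0.
  by apply: H => // t' _; rewrite mulr_ge0 // ler0z E.
move/eqP; rewrite mulf_eq0 gt_eqF //= intr_eq0 /N -sumrB => /eqP.
move/psumr_eq0P => H'; apply/eqP; rewrite eq_sym -subr_eq0; apply/eqP; apply: H' => // e' _.
by rewrite subr_ge0 u_corner_le.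
Qed.

Lemma norm_u_half_edges t : 0 < lam t ->
  \sum_(h | endpoint h == t.1) (1 - u h.1 * sign (t.2 h)) = 3 - \sum_e u e * u e.
Proof.
move=> lam_t; rewrite sumrB -corner_dot (sum_half_edges (fun=> 1)) (sum_mult t.1).
by congr (_ - _); apply: eq_bigr => e _; apply: u_corner_eq.
Qed.

Lemma u_sign_le1 t h : 0 <= 1 - u h.1 * sign (t.2 h).
Proof.
have := abs_u_le1 h.1; move: (u h.1) => x.
by have [->|->] := sign_cases (t.2 h); lia.
Qed.

Lemma corner_vec_nonloop t e d : endpoint (e, d) = t.1 -> corner_vec t e = sign (t.2 (e, d)).
Proof.
move=> dt; rewrite /corner_vec (bigD1 d) ?dt //= big1 ?addr0 // => d' /andP[/eqP d't dd'].
have := mult_le1 no_separating t.1 e; rewrite multE.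
by case: d d' dt d't dd' => [] [] // -> ->; rewrite eqxx.
Qed.

Lemma mult_half_edge v e : mult v e != 0 -> exists d, endpoint (e, d) = v.
Proof.
rewrite multE; have [E _|_] := eqVneq (endpoint (e, true)) v; first by exists true.
by have [E _|] := eqVneq (endpoint (e, false)) v; first by exists false.
Qed.

Lemma norm_u_eq3 t : 0 < lam t -> \sum_e u e * u e = 3 -> forall e, corner_vec t e = u e.
Proof.
move=> lam_t N3 e; have := norm_u_half_edges lam_t; rewrite N3 subrr => /psumr_eq0P H.
have {}H h : endpoint h = t.1 -> u h.1 = sign (t.2 h).
  move=> /eqP ht; have := H (fun h _ => u_sign_le1 t h) h ht.
  by move: (u h.1) => x; have [->|->] := sign_cases (t.2 h); lia.
have [ue|ue] := eqVneq (u e) 0; last by apply: (mulfI ue); apply: u_corner_eq.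
rewrite ue; have [m0|/mult_half_edge[d dt]] := eqVneq (mult t.1 e) 0.
  by have := abs_corner_vec t e; rewrite m0 normr_le0 => /eqP.
by have := H _ dt; rewrite /= ue; have [->|->] := sign_cases (t.2 (e, d)).
Qed.

(** A corner in the combination uses both edges of the support and leaves one half-edge [h0] on
    which [u] is 0. The coloring fixes the sign at [h0], so the coordinate of this edge cannot
    cancel. *)
Lemma norm_u_neq2 i : u i != 0 -> \sum_e u e * u e <> 2.
Proof.
move=> ui N2; have [t0 lam_t0] := lam_pos_exists ui.
have sum1 t : 0 < lam t -> \sum_(h | endpoint h == t.1) (1 - u h.1 * sign (t.2 h)) = 1.
  by move=> lam_t; rewrite norm_u_half_edges // N2.
(* If [u] vanished on no half-edge there, every term of the sum would be 0 or 2, against the total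
   1. *)
have [h0 h0v uh0] : exists2 h0, endpoint h0 = t0.1 & u h0.1 = 0.
  have [/exists_inP[h /eqP hv /eqP]|/exists_inPn no] :=
    boolP [exists h in [pred h | endpoint h == t0.1], u h.1 == 0]; first by exists h.
  have : (2 %| \sum_(h | endpoint h == t0.1) (1 - u h.1 * sign (t0.2 h)))%Z.
    apply: (big_ind (fun x => (2 %| x)%Z)) => // [x y|h hv]; first exact: rpredD.
    have := no h hv; have := abs_u_le1 h.1; move: (u h.1) => x.
    have [->|->] := sign_cases (t0.2 h) => x1 x0.
      by have [->|->] : x = 1 \/ x = -1 by lia.
    by have [->|->] : x = 1 \/ x = -1 by lia.
  by rewrite sum1.
have [s sP] := u_odd_cut.
have same t : 0 < lam t -> t.1 = t0.1 -> forall h, endpoint h = t0.1 -> h != h0 ->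
    u h.1 = sign (t.2 h).
  move=> lam_t tt0 h hv hh0; have := sum1 t lam_t.
  rewrite (bigD1 h0) ?h0v ?tt0 //= uh0 mul0r subr0 => /eqP; rewrite -subr_eq0 addrAC subrr add0r.
  move/eqP/psumr_eq0P => H; have : 1 - u h.1 * sign (t.2 h) = 0.
    by apply: H => [h' _|]; [apply: u_sign_le1|rewrite hv eqxx].
  by move: (u h.1) => x; have [->|->] := sign_cases (t.2 h); lia.
(* The signs at the other two half-edges are those of [u], so the prescribed parity determines the
   third. *)
have parity t : 0 < lam t -> t.1 = t0.1 -> t.2 h0 = t0.2 h0.
  move=> lam_t tt0; have Ft t' : 0 < lam t' -> F t'.
    by move=> l'; apply: contraLR l' => /lamF->; rewrite ltxx.
  have := F_parity (Ft t lam_t); rewrite tt0 -(F_parity (Ft t0 lam_t0)).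
  rewrite /corner_parity tt0 (bigD1 h0) ?h0v //= [in RHS](bigD1 h0) ?h0v //=.
  rewrite (eq_bigr (fun h => t0.2 h)) => [|h /andP[/eqP hv hh0]]; first exact: addIr.
  by apply: sign_inj; rewrite -(same t) // -(same t0).
(* If a corner at another vertex also met the edge of [h0], this edge and [i] would join the same
   two vertices, though only [i] crosses the cut. *)
have vec t : 0 < lam t -> 0 <= corner_vec t h0.1 * sign (t0.2 h0).
  move=> lam_t; have [tt0|tt0] := eqVneq t.1 t0.1.
    rewrite (@corner_vec_nonloop t h0.1 h0.2) -?surjective_pairing ?tt0 //.
    by rewrite parity // -expr2 sqr_ge0.
  have [m0|m0] := eqVneq (mult t.1 h0.1) 0.
    have := abs_corner_vec t h0.1; rewrite m0 normr_le0 => /eqP->.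
    by rewrite mul0r.
  have inc t' : 0 < lam t' -> mult t'.1 i != 0.
    move=> l'; apply/eqP => m; have := u_corner_eq i l'.
    have := abs_corner_vec t' i; rewrite m normr_le0 => /eqP->.
    by rewrite mulr0 => /esym/eqP; rewrite mulf_eq0 (negPf ui).
  have [d1 E1] := mult_half_edge (inc t lam_t).
  have [d2 E2] := mult_half_edge (inc t0 lam_t0).
  have [d3 E3] := mult_half_edge m0.
  have E4 : endpoint (h0.1, h0.2) = t0.1 by rewrite -surjective_pairing.
  have d12 : d1 = ~~ d2.
    by case: d1 d2 E1 E2 => [] [] // E1 E2; move: tt0; rewrite -E1 -E2 eqxx.
  have d34 : d3 = ~~ h0.2.
    move: E3 E4; case: d3 h0.2 => [] [] // E3 E4; move: tt0; rewrite -E3 -E4 eqxx //.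
  have := sP i; rewrite ui; have := sP h0.1; rewrite uh0 eqxx.
  move: E1 E2 E3 E4; rewrite d12 d34.
  by case: d2 {d12} => /= -> ->; case: h0.2 {d34} => /= -> ->; case: (s t.1); case: (s t0.1).
have : (u h0.1 * sign (t0.2 h0))%:~R =
    \sum_t lam t * (corner_vec t h0.1 * sign (t0.2 h0))%:~R :> rat.
  rewrite intrM uE mulr_suml; apply: eq_bigr => t _.
  by rewrite intrM mulrA.
rewrite uh0 mul0r (bigD1 t0) //= => E.
have : 0 < lam t0 * (corner_vec t0 h0.1 * sign (t0.2 h0))%:~R.
  rewrite (@corner_vec_nonloop t0 h0.1 h0.2) -?surjective_pairing // mulr_gt0 // ltr0z.
  by rewrite -expr2 exprn_even_gt0 //; have [->|->] := sign_cases (t0.2 h0).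
have : 0 <= \sum_(t | t != t0) lam t * (corner_vec t h0.1 * sign (t0.2 h0))%:~R.
  apply: sumr_ge0 => t _; have := lam_ge0 t; rewrite le_eqVlt => /orP[/eqP<-|lam_t].
    by rewrite mul0r.
  by rewrite mulr_ge0 // ler0z vec.
by move: E; lra.
Qed.

Lemma lattice_point_is_corner i : u i != 0 ->
  exists2 t, F t & forall e, corner_vec t e = u e.
Proof.
move=> ui; have [t lam_t] := lam_pos_exists ui.
have Ft : F t by apply: contraLR lam_t => /lamF->; rewrite ltxx.
exists t => //; apply: norm_u_eq3 => //.
have := norm_u_half_edges lam_t; have := norm_u_ge2 ui; have := norm_u_neq2 ui.
have : 0 <= \sum_(h | endpoint h == t.1) (1 - u h.1 * sign (t.2 h)).
  by apply: sumr_ge0 => h _; apply: u_sign_le1.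
by move: (\sum_(_ | _) _) (\sum_e _) => x y; lia.
Qed.

End NoSeparatingEdges.

End Corners.

Section LatticeN.
Variable G : graph.
Implicit Types (u w : edge G -> int).

Lemma in_N_ext u w : (forall e, u e = w e) -> in_N u -> in_N w.
Proof. by move=> uw [a E]; exists a => e; rewrite -uw. Qed.

Lemma in_N_corner (t : corner G) : in_N (corner_vec t).
Proof.
exists (fun t' => (t' == t)%:R) => e; rewrite (bigD1 t) //= eqxx mul1r big1 ?addr0 //.
by move=> t' /negPf->; rewrite mul0r.
Qed.

Lemma in_N0 : in_N (fun _ : edge G => 0).
Proof. by exists (fun=> 0) => e; rewrite big1 // => t _; rewrite mul0r. Qed.

Lemma in_ND u w : in_N u -> in_N w -> in_N (fun e => u e + w e).
Proof.
move=> [a E] [a' E']; exists (fun t => a t + a' t) => e.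
by rewrite E E' -big_split; apply: eq_bigr => t _; rewrite mulrDl.
Qed.

Lemma in_NZ z u : in_N u -> in_N (fun e => z * u e).
Proof.
move=> [a E]; exists (fun t => z * a t) => e.
by rewrite E mulr_sumr; apply: eq_bigr => t _; rewrite mulrA.
Qed.

Lemma in_N_sum (I : Type) (r : seq I) (P : pred I) (f : I -> edge G -> int) :
  (forall i, P i -> in_N (f i)) -> in_N (fun e => \sum_(i <- r | P i) f i e).
Proof.
move=> fN; elim: r => [|i r IH].
  by apply: in_N_ext in_N0 => e; rewrite big_nil.
have [Pi|nPi] := boolP (P i).
  by apply: in_N_ext (in_ND (fN i Pi) IH) => e; rewrite big_cons Pi.
by apply: in_N_ext IH => e; rewrite big_cons (negPf nPi).
Qed.

Definition plus_corner (v : vertex G) : corner G := (v, [ffun=> 0]).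

Lemma plus_corner_vec v e : corner_vec (plus_corner v) e = mult v e.
Proof. by rewrite /corner_vec /mult; apply: eq_bigr => d _; rewrite ffunE expr0. Qed.

(** The difference of two corners at one vertex that differ in the sign of a single half-edge. *)
Lemma in_N_double (e0 : edge G) : in_N (fun e => (e == e0)%:R *+ 2).
Proof.
pose v := endpoint (e0, true).
pose t : corner G := (v, [ffun h => (h == (e0, true))%:R]).
apply: in_N_ext (in_ND (in_N_corner (plus_corner v)) (in_NZ (-1) (in_N_corner t))) => e.
rewrite /= mulN1r /corner_vec -sumrB big_mkcond big_bool /= !ffunE !expr0 !xpair_eqE.
have [->|_] := eqVneq e e0; rewrite /= ?eqxx ?andbF ?expr0 ?expr1.
  by rewrite (subrr 1) if_same addr0.
by rewrite (subrr 1) !if_same addr0.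
Qed.

End LatticeN.

(** * Separating edges and the corners at their ends *)

Section SeparatingEdge.
Variable G : graph.
Hypothesis trivalent : forall v : vertex G, valency v = 3.
Hypothesis connected : connected_by [set: edge G].
Variable e0 : edge G.
Hypothesis e0_separating : separating e0.

Let x0 := endpoint (e0, true).
Let y0 := endpoint (e0, false).
Let S : pred (vertex G) := connect (adjacent [set~ e0]) x0.

Lemma adjacent_sym (A : {set edge G}) x y : adjacent A x y = adjacent A y x.
Proof.
 apply/idP/idP => /existsP[e /andP[eA /existsP[d /andP[dx dy]]]];
by apply/existsP; exists e; rewrite eA; apply/existsP; exists (~~ d); rewrite negbK dx dy.
Qed.

Lemma side_edge (e : edge G) d : e != e0 -> S (endpoint (e, d)) -> S (endpoint (e, ~~ d)).
Proof.
move=> ee0 Sd; apply: connect_trans Sd (connect1 _).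
apply/existsP; exists e; rewrite !inE ee0; apply/existsP; exists d.
by rewrite !eqxx.
Qed.

Lemma separating_sides : ~~ S y0.
Proof.
apply/negP => Sy0; case/negP: e0_separating; apply/forallP => x; apply/forallP => y.
have all_S z : S z.
  have /forallP/(_ x0)/forallP/(_ z) conn := connected.
  apply: (connect_invariant _ conn) => [e d _|]; last exact: connect0.
  have [->|ee0] := eqVneq e e0; last exact: side_edge.
  by case: d => // _; apply: connect0.
apply: connect_trans (all_S y).
by rewrite (sym_connect_sym (adjacent_sym _)); apply: all_S.
Qed.

Lemma separating_endpoints : endpoint (e0, false) != endpoint (e0, true).
Proof. by apply: contraNneq separating_sides => E; rewrite /y0 E; apply: connect0. Qed.

(** Summed over the vertices on one side, the all-plus corners count [e0] once and each edge inside
    that side twice; the doubled edges are subtracted. *)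
Lemma in_N_separating : in_N (fun e : edge G => (e == e0)%:R).
Proof.
pose f e := ((e != e0) && S (endpoint (e, true)))%:R : int.
have H := in_ND (in_N_sum (index_enum _) (P := S)
    (fun v _ => in_N_corner (plus_corner v)))
  (in_NZ (-1) (in_N_sum (index_enum _) (P := predT)
    (fun e1 _ => in_NZ (f e1) (in_N_double e1)))).
apply: in_N_ext H => e /=.
have -> : \sum_e1 f e1 * ((e == e1)%:R *+ 2) = f e *+ 2.
  rewrite (bigD1 e) //= eqxx big1 => [|e1 ne]; first by rewrite addr0 mulrnAr mulr1.
  by rewrite eq_sym (negPf ne) mul0rn mulr0.
have -> : \sum_(v | S v) corner_vec (plus_corner v) e =
    (S (endpoint (e, true)))%:R + (S (endpoint (e, false)))%:R.
  rewrite (eq_bigr (fun v => mult v e)) => [|v _]; last exact: plus_corner_vec.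
  rewrite (eq_bigr (fun v => (endpoint (e, true) == v)%:R + (endpoint (e, false) == v)%:R)).
    rewrite big_split /=.
    have sumS x : \sum_(v | S v) (x == v)%:R = (S x)%:R :> int.
      have [Sx|nSx] := boolP (S x).
        rewrite (bigD1 x) //= eqxx big1 ?addr0 // => v /andP[_ ne].
        by rewrite eq_sym (negPf ne).
      by rewrite big1 // => v Sv; case: eqP => // E; rewrite E Sv in nSx.
    by rewrite !sumS.
  by move=> v _; apply: multE.
rewrite /f; have [->|ee0] := eqVneq e e0.
  have -> : S (endpoint (e0, true)) by apply: connect0.
  by rewrite (negPf separating_sides).
have [St|nSt] := boolP (S (endpoint (e, true))); first by rewrite (side_edge ee0 St).
have /negPf-> // : ~~ S (endpoint (e, false)).
by apply: contra nSt; apply: (@side_edge e false).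
Qed.

Variable c : coloring G.

(** The two half-edges at this vertex other than that of [e0] share the sign [s], which drops out of
    the parity modulo 2. So both values of [s] are admissible, and the two corners average to [x_e0]
    up to sign. *)
Definition bridge_corner (s : 'F_2) : corner G :=
  (endpoint (e0, true), [ffun h => if h == (e0, true) then c (endpoint (e0, true)) else s]).

Lemma bridge_corner_parity s : corner_parity (bridge_corner s) = c (bridge_corner s).1.
Proof.
rewrite /corner_parity (bigD1 (e0, true)) //= ffunE eqxx.
rewrite (eq_bigr (fun=> s)) => [|h /andP[_ /negPf ne]]; last by rewrite ffunE ne.
rewrite -[RHS]addr0; congr (_ + _).
rewrite sumr_const; have -> : #|[pred h | (endpoint h == x0) && (h != (e0, true))]| = 2%N.
  have := trivalent x0; rewrite /valency (cardD1 (e0, true)) inE eqxx => H.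
  transitivity #|[predD1 [set h | endpoint h == x0] & (e0, true)]|; last first.
    by move: H; rewrite -[3]/3%N add1n => -[].
  by apply: eq_card => h; rewrite !inE andbC.
by rewrite -mulr_natr; case: s => [[|[|i]] Hi]; apply: val_inj.
Qed.

Lemma bridge_corner_vec s e : corner_vec (bridge_corner s) e =
  if e == e0 then sign (c (endpoint (e0, true))) else sign s * mult (endpoint (e0, true)) e.
Proof.
rewrite /corner_vec; have [->|ne] := eqVneq e e0.
  rewrite (bigD1 true) //= ffunE eqxx big1 ?addr0 // => d /andP[/eqP + dt]; case: d dt => // _ E.
  by have := separating_endpoints; rewrite E eqxx.
rewrite /mult mulr_sumr; apply: eq_bigr => d _.
by rewrite ffunE xpair_eqE (negPf ne) mulr1.
Qed.

Lemma mult_bridge : mult (endpoint (e0, true)) e0 = 1.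
Proof. by rewrite multE eqxx (negPf separating_endpoints). Qed.

(** Needed for [corner_separation]; there is no cancellation even if the two other half-edges form a
    loop, as their signs agree. *)
Lemma bridge_corner_norm s : \sum_e `|corner_vec (bridge_corner s) e| = 3.
Proof.
rewrite -(sum_mult trivalent x0); apply: eq_bigr => e _; rewrite bridge_corner_vec.
case: eqP => [->|_]; first by rewrite mult_bridge; have [->|->] := sign_cases (c x0).
have : 0 <= mult x0 e by rewrite multE; lia.
by rewrite normrM; have [->|->] := sign_cases s; rewrite ?normrN normr1 mul1r => /ger0_norm.
Qed.

Lemma bridge_third_edge : exists2 e, e != e0 & mult (endpoint (e0, true)) e != 0.
Proof.
apply/exists_inP; apply: contraT => /exists_inPn no.
have := sum_mult trivalent x0; rewrite (bigD1 e0) //= mult_bridge big1 // => e ne.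
by have := no e ne; rewrite negbK => /eqP.
Qed.

Lemma bridge_corner_le1 t : `|corner_vec t e0| <= 1.
Proof.
apply: le_trans (abs_corner_vec t e0) _; rewrite multE.
case: eqP => [E|_]; case: eqP => [E'|_] //.
by have := separating_endpoints; rewrite E E' eqxx.
Qed.

End SeparatingEdge.

(** * The charts of the toric variety *)

Section Charts.
Variables (R : realType) (k : fieldType).
Hypothesis char_k : [pchar k] =i pred0.
Variables (G : graph) (n : nat) (b : 'I_n -> edge G -> int).
Hypothesis b_basis : lattice_basis b.

Notation cvec t := (int_vec R (corner_vec t)).

Definition combination (a : 'I_n -> int) (e : edge G) : int := \sum_i a i * b i e.

(** The transpose of [combination]: the restriction to [N] of a functional on [Z^E], in
    coordinates. *)
Definition exponents (f : edge G -> int) (i : 'I_n) : int := \sum_e f e * b i e.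

Lemma dot_exponents f a : dot (exponents f) a = \sum_e f e * combination a e.
Proof.
rewrite /dot /exponents (eq_bigr (fun i => \sum_e f e * (a i * b i e))).
  by rewrite exchange_big; apply: eq_bigr => e _; rewrite mulr_sumr.
by move=> i _; rewrite mulr_suml; apply: eq_bigr => e _; rewrite mulrAC mulrA.
Qed.

Lemma combination_inj a a' : (forall e, combination a e = combination a' e) -> a = a'.
Proof.
case: b_basis => _ _ b_free E; apply: funext => i; apply/eqP; rewrite -subr_eq0.
apply/eqP; move: i; apply: b_free => e; under eq_bigr do rewrite mulrBl.
by rewrite sumrB; apply/eqP; rewrite subr_eq0; apply/eqP/E.
Qed.

Lemma combination_in_N a : in_N (combination a).
Proof. by case: b_basis => bN _ _; apply: in_N_sum => i _; apply: in_NZ. Qed.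

Lemma coordinates : exists beta : corner G -> 'I_n -> int,
  forall t e, corner_vec t e = combination (beta t) e.
Proof.
have /choice[beta H] : forall t, exists a, forall e, corner_vec t e = combination a e.
  by case: b_basis => _ gen _ t; apply: gen; apply: in_N_corner.
by exists beta.
Qed.

Lemma pairing_suml (I : finType) (a : I -> R) (f : I -> edge G -> R) y :
  pairing (fun e => \sum_i a i * f i e) y = \sum_i a i * pairing (f i) y.
Proof.
rewrite /pairing; under eq_bigr do rewrite mulr_suml.
rewrite exchange_big; apply: eq_bigr => i _; rewrite mulr_sumr.
by apply: eq_bigr => e _; rewrite mulrA.
Qed.

Lemma pairingC (x y : edge G -> R) : pairing x y = pairing y x.
Proof. by apply: eq_bigr => e _; rewrite mulrC. Qed.

Lemma pairing_combination (y : edge G -> R) a :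
  pairing y (int_vec R (combination a)) = \sum_i pairing y (int_vec R (b i)) * (a i)%:~R.
Proof.
rewrite /pairing (eq_bigr (fun e => \sum_i y e * (b i e)%:~R * (a i)%:~R)).
  by rewrite exchange_big; apply: eq_bigr => i _; rewrite mulr_suml.
move=> e _; rewrite /int_vec rmorph_sum mulr_sumr; apply: eq_bigr => i _ /=.
by rewrite intrM mulrA mulrAC.
Qed.

Variable c : coloring G.

Lemma in_Pcirc_corner t : corner_parity t = c t.1 -> in_Pcirc c (cvec t).
Proof.
move=> ct; exists (fun t' => (t' == t)%:R); split=> [t'|t' ne||e].
- exact: ler0n.
- by case: eqP => // E; rewrite E ct eqxx in ne.
- by rewrite (bigD1 t) //= eqxx big1 ?addr0 // => t' /negPf->.
rewrite (bigD1 t) //= eqxx mul1r big1 ?addr0 // => t' /negPf->.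
by rewrite mul0r.
Qed.

Section Face.
Variable q : edge G -> R.
Hypothesis q_P : in_P c q.

Definition face : pred (corner G) :=
  fun t => (corner_parity t == c t.1) && (pairing (cvec t) q == -1).

(** A point of the face is a convex combination of corners on which [q] is at least -1. Since the
    mean is -1, every corner with a positive coefficient lies on the face. *)
Lemma dual_cone_face m : dual_cone c q m <->
  forall t, face t -> 0 <= pairing m (cvec t).
Proof.
split=> [dual t /andP[/eqP ct /eqP tq]|dual p].
  apply: dual; right; exists 1, (cvec t); split=> // [|e]; last by rewrite mul1r.
  exact: in_Pcirc_corner.
case=> [p0|[s [x [s0 xP xq pE]]]].
  by rewrite /pairing big1 // => e _; rewrite p0 mulr0.
have [a [a0 aP a1 xE]] := xP.
have xE' : x = (fun e => \sum_t a t * cvec t e) by apply: funext.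
have pm : pairing m p = s * \sum_t a t * pairing m (cvec t).
  rewrite (_ : \sum_t _ = pairing m x).
    by rewrite /pairing mulr_sumr; apply: eq_bigr => e _; rewrite pE mulrCA.
  by rewrite xE' pairingC pairing_suml; apply: eq_bigr => t _; rewrite pairingC.
rewrite pm mulr_ge0 // sumr_ge0 // => t _.
have [at0|at0] := eqVneq (a t) 0; first by rewrite at0 mul0r.
rewrite mulr_ge0 // dual //; have ct : corner_parity t = c t.1.
  by apply/eqP; apply: contraNT at0 => /aP->.
rewrite /face ct eqxx /=.
have : \sum_t a t * (pairing (cvec t) q + 1) = 0.
  under eq_bigr do rewrite mulrDr mulr1.
  by rewrite big_split /= a1 -pairing_suml -xE' xq addNr.
move/psumr_eq0P => H; have : a t * (pairing (cvec t) q + 1) = 0.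
  apply: H => // t' _; have [ct'|/aP->] := eqVneq (corner_parity t') (c t'.1).
    by rewrite mulr_ge0 // -lerBlDr sub0r q_P //; apply: in_Pcirc_corner.
  by rewrite mul0r.
by move/eqP; rewrite mulf_eq0 (negPf at0) addr_eq0.
Qed.

Variable beta : corner G -> 'I_n -> int.
Hypothesis betaE : forall t e, corner_vec t e = combination (beta t) e.

Lemma corner_vecE t : corner_vec t = combination (beta t).
Proof. by apply: funext => e. Qed.

Lemma dot_exponents_corner f t : dot (exponents f) (beta t) = \sum_e f e * corner_vec t e.
Proof. by rewrite dot_exponents; apply: eq_bigr => e _; rewrite betaE. Qed.

Lemma chart_ringE : @chart_ring G R k n b c q = @cone_ring k n _ beta face.
Proof.
apply: funext => f; apply: propext; split=> [[l [z [m [mP ->]]]]|[l [z [a [aP ->]]]]].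
  exists l, z, (fun j i => Num.floor (pairing (m j) (int_vec R (b i)))).
  split=> // j t Ft; have [mM /dual_cone_face/(_ t Ft)] := mP j.
  rewrite corner_vecE pairing_combination -(ler0z R) rmorph_sum /=.
  congr (0 <= _); apply: eq_bigr => i _; rewrite intrM; congr (_ * _).
  by rewrite floorK //; apply: mM; case: b_basis.
(* The dual vectors provide an element of [M] with prescribed integer pairings with the basis. *)
have [_ _ b_free] := b_basis; have [d dE] := dual_basis b_free.
pose m j e : R := \sum_i (a j i)%:~R * ratr (d i e).
have mb j i : pairing (m j) (int_vec R (b i)) = (a j i)%:~R.
  have dR i' : pairing (fun e => ratr (d i' e)) (int_vec R (b i)) = (i' == i)%:R.
    have /(congr1 (@ratr R)) := dE i' i; rewrite rmorph_nat => <-.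
    rewrite rmorph_sum; apply: eq_bigr => e _ /=.
    by rewrite rmorphM /= rmorph_int.
  rewrite pairing_suml (bigD1 i) //= dR eqxx mulr1 big1 ?addr0 // => i' /negPf ne.
  by rewrite dR ne mulr0.
have mcomb j w : pairing (m j) (int_vec R (combination w)) = (dot (a j) w)%:~R.
  rewrite pairing_combination rmorph_sum; apply: eq_bigr => i _ /=.
  by rewrite mb intrM.
exists l, z, m; split=> [j|]; last first.
  apply: eq_bigr => j _; congr (_ * _); rewrite /character; congr monom.
  by apply: funext => i; rewrite mb intrKfloor.
split.
  move=> u; case: b_basis => _ gen _ /gen[w uw].
  have -> : u = combination w by apply: funext.
  by rewrite mcomb intr_int.
apply/dual_cone_face => t Ft; rewrite corner_vecE mcomb ler0z.
exact: aP.
Qed.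

(** On the face [m] is constantly [r], and the sign vector [f] of [t] is at most 3, with equality
    only at the point of [t]; hence the functional [3 m - r f]. *)
Lemma face_separation m r t : 0 < r -> (forall t, face t -> dot m (beta t) = r) ->
  (forall v : vertex G, valency v = 3) ->
  \sum_e `|corner_vec t e| = 3 -> face t ->
  exists m0, dot m0 (beta t) = 0 /\
    forall t', face t' -> 0 < dot m0 (beta t') \/ beta t' = beta t.
Proof.
move=> r0 mr trivalent t3 Ft.
pose f e := sgz (corner_vec t e).
exists (fun i => 3 * m i + - (r * exponents f i)); split=> [|t' Ft'].
  rewrite dotDl dotNl !dotZl mr // dot_exponents_corner.
  by rewrite (corner_separation trivalent t t3).1 mulrC subrr.
have [_ [lt|E]] := corner_separation trivalent t' t3; last first.
  by right; apply: combination_inj => e; rewrite -!betaE.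
left; rewrite dotDl dotNl !dotZl mr // dot_exponents_corner mulrC -mulrBr.
by rewrite mulr_gt0 // subr_gt0.
Qed.

End Face.

Lemma no_separating_terminal :
  (forall v : vertex G, valency v = 3) -> ~ (exists e : edge G, separating e) ->
  terminal_toric_variety R k b c.
Proof.
move=> trivalent no_sep q q_P; have [beta betaE] := coordinates.
rewrite (chart_ringE q_P betaE).
have [r [m [r0 mr]]] : exists (r : nat) (m : 'I_n -> int), (0 < r)%N /\
    forall t, face q t -> dot m (beta t) = r.
  (* By definition of the face, [-q] takes the value 1 on its corners. *)
  apply: (@rational_solution R n _ beta (face q) (fun i => - pairing q (int_vec R (b i)))).
  move=> t /andP[_ /eqP tq]; under eq_bigr do rewrite mulNr.
  by rewrite sumrN -pairing_combination -(corner_vecE betaE) pairingC tq opprK.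
have r0' : 0 < r%:Z by [].
apply: (terminal_cone_ring char_k (farkas (F := face q)) r0 mr); last first.
  move=> t Ft; apply: (face_separation betaE r0' mr) => //.
  (* In the absence of loops no signs cancel within an entry, so the norm of a corner is 3. *)
  rewrite -(sum_mult trivalent t.1); apply: eq_bigr => e _.
  have [m0|/mult_half_edge[d dt]] := eqVneq (mult t.1 e) 0.
    by apply/eqP; rewrite m0 eq_le normr_ge0 andbT -m0 abs_corner_vec.
  rewrite (corner_vec_nonloop trivalent no_sep dt).
  have := mult_le1 trivalent no_sep t.1 e; have : mult t.1 e != 0.
    by rewrite multE; case: d dt => ->; rewrite eqxx; case: (_ == t.1).
  have : 0 <= mult t.1 e by rewrite multE; lia.
  have -> : `|sign (t.2 (e, d))| = 1 by have [->|->] := sign_cases (t.2 (e, d)).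
  by move: (mult _ _) => x; lia.
move=> u l ul u_cone; have [lam [lam0 lamF uE]] := u_cone.
(* The sum of the coefficients is [<m, u> / r], so it tells the points of the polytope from those
   beyond the face. *)
have [le1|gt1] := leP (\sum_t lam t) 1.
  right; have [e ue] : exists e, combination u e != 0.
    apply/existsP; apply: contraNT ul => /existsPn u0.
    suff -> : u = fun=> 0 by [].
    apply: combination_inj => e; have /negPn/eqP-> := u0 e.
    by rewrite /combination big1 // => i _; rewrite mul0r.
  have uE' e' : (combination u e')%:~R = \sum_t lam t * (corner_vec t e')%:~R :> rat.
    have := dot_cone (fun i => b i e') uE.
    rewrite /dot /combination; under eq_bigr do rewrite mulrC.
    move=> ->; apply: eq_bigr => t _; rewrite betaE; congr (_ * _%:~R).
    by apply: eq_bigr => i _; rewrite mulrC.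
  have face_parity t : face q t -> corner_parity t = c t.1 by case/andP => /eqP.
  have [t Ft tE] := lattice_point_is_corner trivalent no_sep face_parity
    (combination_in_N u) lam0 lamF uE' le1 ue.
  by exists t => //; apply: combination_inj => e'; rewrite -betaE.
left; rewrite -(ltr_int rat) (dot_cone m uE).
rewrite (eq_bigr (fun t => lam t * r%:R)) => [|t _].
  by rewrite -mulr_suml -[ltLHS]mul1r ltr_pM2r // ltr0n.
by have [/mr->//|/lamF->] := boolP (face q t); rewrite !mul0r.
Qed.

Lemma separating_not_terminal (e0 : edge G) :
  (forall v : vertex G, valency v = 3) -> connected_by [set: edge G] ->
  separating e0 -> ~ terminal_toric_variety R k b c.
Proof.
move=> trivalent conn sep; have [beta betaE] := coordinates.
pose eps := sign (c (endpoint (e0, true))).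
have eps2 : eps * eps = 1 by rewrite /eps; have [->|->] := sign_cases (c (endpoint (e0, true))).
(* This [q] exposes the face where the coordinate at [e0] takes its extreme value [eps]; both bridge
   corners lie on it. *)
pose q (e : edge G) : R := - (eps * (e == e0)%:R)%:~R.
have pair_q t : pairing (cvec t) q = - (eps * corner_vec t e0)%:~R.
  rewrite /pairing (bigD1 e0) //= /q eqxx mulr1 big1 => [|e /negPf ne].
    by rewrite addr0 mulrN /int_vec -intrM mulrC.
  by rewrite ne mulr0 oppr0 mulr0.
have q_P : in_P c q.
  move=> p [a [a0 _ a1 pE]]; have -> : p = (fun e => \sum_t a t * cvec t e) by apply: funext.
  rewrite pairing_suml -a1 -sumrN; apply: ler_sum => t _.
  rewrite -[leLHS]mulr1 -mulrN1 mulrAC mulr1.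
  rewrite ler_wpM2l // pair_q lerN2 -[1]/(1%:~R) ler_int.
  have := bridge_corner_le1 conn sep t.
  by rewrite /eps; have [->|->] := sign_cases (c (endpoint (e0, true))); lia.
pose t1 := bridge_corner e0 c 0; pose t2 := bridge_corner e0 c 1.
have face_t s : face q (bridge_corner e0 c s).
  rewrite /face bridge_corner_parity // eqxx pair_q bridge_corner_vec // eqxx.
  by rewrite eps2 eqxx.
(* This functional is 1 on the face and on [u], which makes all these vectors primitive. *)
pose me := exponents (fun e => eps * (e == e0)%:R).
have me_comb w : dot me w = eps * combination w e0.
  rewrite dot_exponents (bigD1 e0) //= eqxx mulr1 big1 ?addr0 // => e /negPf ne.
  by rewrite ne mulr0 mul0r.
have me_face t : face q t -> dot me (beta t) = 1.
  move=> /andP[_]; rewrite pair_q eqr_opp -[1]/(1%:~R) eqr_int => /eqP <-.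
  by rewrite me_comb -betaE.
have [w wE] : exists w, forall e, (e == e0)%:R = combination w e.
  by case: b_basis => _ gen _; apply: gen; apply: in_N_separating.
pose u i := eps * w i.
have uE e : combination u e = eps * (e == e0)%:R.
  by rewrite wE /combination mulr_sumr; apply: eq_bigr => i _; rewrite /u mulrA.
(* The coordinate at another edge of the same vertex vanishes on the midpoint but not on the bridge
   corners. *)
have [e1 e10 e1v] := bridge_third_edge trivalent conn sep.
move=> /(_ q q_P); rewrite (chart_ringE q_P betaE).
apply: (midpoint_not_terminal char_k (u := u) (face_t 0) (face_t 1)
  (me := me) (m1 := exponents (fun e => (e == e1)%:R))).
- move=> i; suff -> : beta t2 = fun i => u i *+ 2 - beta t1 i by rewrite addrC subrK.
  apply: combination_inj => e; rewrite -betaE.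
  rewrite /combination; under eq_bigr do rewrite mulrBl mulrnAl.
  rewrite sumrB sumrMnl -!/(combination _ e) uE -betaE !bridge_corner_vec //.
  by case: eqP => _; rewrite ?mulr1 ?mulr0 ?mul0rn ?sub0r ?mulr2n ?addrK // mul1r mulN1r.
- by rewrite me_comb uE eqxx mulr1.
- exact/me_face/face_t.
- exact/me_face/face_t.
- rewrite dot_exponents big1 // => e _; rewrite uE.
  by have [->|_] := eqVneq e e1; rewrite ?(negPf e10) ?mulr0 ?mul0r.
- rewrite (dot_exponents_corner betaE) (bigD1 e1) //= eqxx mul1r big1 => [|e /negPf->].
    by rewrite addr0 bridge_corner_vec // (negPf e10) mul1r.
  by rewrite mul0r.
move=> t tt; have [s ->] : exists s, t = bridge_corner e0 c s.
  by case/orP: tt => /eqP->; [exists 0|exists 1].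
apply: (face_separation betaE ltr01 me_face trivalent) => //.
exact: bridge_corner_norm.
Qed.

End Charts.

Theorem theoremA3 (R : realType) (k : closedFieldType)
    (char_k : [pchar k] =i pred0)
    (G : graph) (G_trivalent : trivalent_graph G) (G_genus : (3 <= genus G)%N)
    (c : coloring G)
    (n : nat) (b : 'I_n -> edge G -> int) (b_basis : lattice_basis b) :
  terminal_toric_variety R k b c <-> ~ (exists e : edge G, separating e).
Proof.
have [_ connected trivalent] := G_trivalent; split; last first.
  exact: no_separating_terminal.
move=> terminal [e sep].
exact: (separating_not_terminal char_k b_basis trivalent connected sep terminal).
Qed.
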